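(* Let $\mathcal G$ be the Hopf algebra of graphs, and let $\mathcal A$ be the graded algebra of representations of graph automorphism groups, with the maps $\Delta_{\mathcal A}$, $\epsilon_{\mathcal A}$, $\zeta_{\mathcal A}$ defined in the context. (1) The comultiplication $\Delta_{\mathcal A}$ and counit $\epsilon_{\mathcal A}$ make $\mathcal A$ into a connected, commutative, and cocommutative graded Hopf algebra. (2) The map $\operatorname{reg}:\mathcal G\to\mathcal A$ sending $[\Gamma]$ to the regular representation of $\operatorname{Aut}\Gamma$ is an embedding of Hopf algebras. (3) The map $\zeta_{\mathcal A}:\mathcal A\to\mathbb Z$ is an algebra homomorphism, and the induced Hopf-algebra homomorphism $\mathcal A\to\operatorname{Sym}_{\mathbb Z}$ sends each representation $\gamma$ of $\operatorname{Aut}\Gamma$ (for each graph $\Gamma$) to the symmetric function $$X_{\Gamma,\gamma}:=\sum_{\alpha\in\operatorname{Comp}_{\#V(\Gamma)}}\big(\dim\operatorname{Hom}_{\operatorname{Aut}\Gamma}(\rho_{\Gamma,\alpha},\gamma)\big)M_\alpha.$$ (4) For each graph $\Gamma$ we have $X_{\Gamma,\operatorname{reg}_{\operatorname{Aut}\Gamma}}=X_\Gamma$, Stanley's chromatic symmetric function; and $$X_\Gamma=\sum_{\gamma\in\operatorname{Irr}(\operatorname{Aut}\Gamma)}(\dim\gamma)X_{\Gamma,\gamma},$$ where $\dim\gamma$ is the dimension of the $\Bbbk$-vector space underlying $\gamma$.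
   Context: $\Bbbk$ is an algebraically closed field of characteristic zero; representations are finite-dimensional over $\Bbbk$. For a finite group $G$, $R(G)$ is the Grothendieck group of $\operatorname{Rep}(G)$, free abelian on the set $\operatorname{Irr}(G)$ of isomorphism classes of irreducible representations; $R(G)\otimes_{\mathbb Z}R(G')\cong R(G\times G')$ canonically. $\operatorname{reg}_G$ is the regular representation, $\operatorname{triv}_G$ the trivial one-dimensional representation. $\mathcal P(V)$ is the power set of $V$. Graphs $\Gamma$ are finite, simple, undirected: a finite vertex set $V(\Gamma)$ and a set $E(\Gamma)$ of two-element subsets of $V(\Gamma)$. $\Gamma\sqcup\Lambda$ is disjoint union; for $U\subseteq V(\Gamma)$, $\Gamma|_U$ is the induced subgraph with vertex set $U$ and edges $E(\Gamma)\cap\mathcal P(U)$, and $U^c=V(\Gamma)\setminus U$. $\operatorname{Aut}\Gamma$ is the group of graph automorphisms. Hopf algebra of graphs: $\mathcal G$ is the free abelian group on isomorphism classes $[\Gamma]$ of graphs, graded by $\#V(\Gamma)$, with product $[\Gamma][\Lambda]=[\Gamma\sqcup\Lambda]$, coproduct $\Delta_{\mathcal G}[\Gamma]=\sum_{U\subseteq V(\Gamma)}[\Gamma|_U]\otimes[\Gamma|_{U^c}]$, unit the empty graph, and counit sending the empty graph to $1$ and all other graphs to $0$. The algebra $\mathcal A$: $\mathcal A=\big(\bigoplus_\Gamma R(\operatorname{Aut}\Gamma)\big)_{\mathrm{Graph}^\times}$, the sum being over finite simple graphs, where the subscript means one imposes $\gamma=\operatorname{Ad}_w\gamma$ for every graph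 isomorphism $w:\Gamma\to\Lambda$ and $\gamma\in R(\operatorname{Aut}\Gamma)$, with $\operatorname{Ad}_w\gamma=\gamma(w^{-1}\cdot w)\in R(\operatorname{Aut}\Lambda)$. $R(\operatorname{Aut}\Gamma)$ sits in degree $\#V(\Gamma)$. The product is the sum of the maps $R(\operatorname{Aut}\Gamma)\otimes R(\operatorname{Aut}\Lambda)\cong R(\operatorname{Aut}\Gamma\times\operatorname{Aut}\Lambda)\xrightarrow{\operatorname{ind}}R(\operatorname{Aut}(\Gamma\sqcup\Lambda))$; the unit is the trivial representation of the automorphism group of the empty graph. For $U\subseteq V(\Gamma)$ let $(\operatorname{Aut}\Gamma)_U=\{w\in\operatorname{Aut}\Gamma: w(U)=U\}$, viewed as a subgroup of $\operatorname{Aut}\Gamma$ and, via $w\mapsto(w|_U,w|_{U^c})$, of $\operatorname{Aut}(\Gamma|_U)\times\operatorname{Aut}(\Gamma|_{U^c})$. For $\gamma$ a representation of $\operatorname{Aut}\Gamma$, $$\Delta_{\mathcal A}\gamma=\sum_{U}\operatorname{ind}_{(\operatorname{Aut}\Gamma)_U}^{\operatorname{Aut}(\Gamma|_U)\times\operatorname{Aut}(\Gamma|_{U^c})}\operatorname{res}^{\operatorname{Aut}\Gamma}_{(\operatorname{Aut}\Gamma)_U}\gamma,$$ with $U$ running over representatives of the $\operatorname{Aut}\Gamma$-orbits in $\mathcal P(V(\Gamma))$ and each summand viewed in $R(\operatorname{Aut}(\Gamma|_U))\otimes R(\operatorname{Aut}(\Gamma|_{U^c}))$. $\epsilon_{\mathcal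 A}:\mathcal A\to\mathbb Z$ sends the trivial representation of the automorphism group of the empty graph to $1$ and all other irreducible representations to $0$. $\zeta_{\mathcal A}:\mathcal A\to\mathbb Z$ is the $\mathbb Z$-linear map with, for $\gamma\in\operatorname{Irr}(\operatorname{Aut}\Gamma)$, $\zeta_{\mathcal A}(\gamma)=1$ if $E(\Gamma)=\emptyset$ and $\gamma=\operatorname{triv}_{\operatorname{Aut}\Gamma}$, and $\zeta_{\mathcal A}(\gamma)=0$ otherwise. $\operatorname{Sym}_{\mathbb Z}$ is the graded Hopf algebra of symmetric functions in $x_1,x_2,\dots$ with integer coefficients. The Hopf-algebra homomorphism induced by a character $\zeta:\mathcal A\to\mathbb Z$ is the unique homomorphism of graded Hopf algebras $\Psi:\mathcal A\to\operatorname{Sym}_{\mathbb Z}$ with $\Psi(x)(1,0,0,\dots)=\zeta(x)$ for all $x$ (existence and uniqueness for connected graded cocommutative Hopf algebras is a theorem of Aguiar–Bergeron–Sottile). $\operatorname{Comp}_n$ is the set of integer compositions of $n$ (ordered lists of positive integers summing to $n$); for $\alpha=(\alpha_1,\dots,\alpha_\ell)$, $M_\alpha=\sum_{i_1<\dots<i_\ell}x_{i_1}^{\alpha_1}\cdots x_{i_\ell}^{\alpha_\ell}$ is the monomial quasisymmetric function. For $\alpha\in\operatorname{Comp}_{\#V(\Gamma)}$, $\operatorname{Col}_{\Gamma,\alpha}$ is the set of functions $\kappa:V(\Gamma)\to\{1,\dots,\ell\}$ with $\#\kappa^{-1}(i)=\alpha_i$ for all $i$ and $\kappa(v)\ne\kappa(w)$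 for all $\{v,w\}\in E(\Gamma)$. $\operatorname{Aut}\Gamma$ acts on it by $(w\kappa)(v)=\kappa(w^{-1}v)$, and $\rho_{\Gamma,\alpha}$ is the corresponding permutation representation on $\Bbbk^{\operatorname{Col}_{\Gamma,\alpha}}$. Stanley's chromatic symmetric function is $X_\Gamma=\sum_{\alpha\in\operatorname{Comp}_{\#V(\Gamma)}}(\#\operatorname{Col}_{\Gamma,\alpha})M_\alpha$. *)

(* Defs.v *)
From HB Require Import structures.
From mathcomp Require Import all_boot all_order all_fingroup all_algebra.
From mathcomp Require Import all_solvable all_field all_character finmap.
From mathcomp Require Import boolp.
From mathcomp.multinomials Require Import freeg.

Set Implicit Arguments.
Unset Strict Implicit.
Unset Printing Implicit Defensive.

Import GRing.Theory.
Local Open Scope ring_scope.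


Definition fgen (T : choiceType) (t : T) : {freeg T / int} := [freeg [:: (1, t)]].

Definition flift (T : choiceType) (M : zmodType) (f : T -> M)
  (x : {freeg T / int}) : M := fglift (f : T -> zmodule M) x.

Definition gen_subgroup (M : zmodType) (P : M -> Prop) : {pred M} :=
  fun x => `[< forall S : zmodClosed M, (forall y, P y -> y \in S) -> x \in S >].

Lemma gen_subgroup_closed (M : zmodType) (P : M -> Prop) :
  zmod_closed (gen_subgroup P).
Proof.
split=> [|x y /asboolP hx /asboolP hy]; apply/asboolP => S hS.
  exact: rpred0.
by apply: rpredB; [exact: hx | exact: hy].
Qed.

HB.instance Definition _ (M : zmodType) (P : M -> Prop) :=
  GRing.isZmodClosed.Build M (gen_subgroup P) (gen_subgroup_closed P).

(* Despite its name, the quotient of ring_quotient is the quotient of a zmodType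
   by a zmodClosed predicate. *)
Definition zquot (M : zmodType) (P : M -> Prop) : Type :=
  {ideal_quot (gen_subgroup P)}.

HB.instance Definition _ (M : zmodType) (P : M -> Prop) :=
  GRing.Zmodule.on (zquot P).

Definition zpi (M : zmodType) (P : M -> Prop) (x : M) : zquot P :=
  (\pi_({ideal_quot (gen_subgroup P)}) x)%qT.

Definition zrepr (M : zmodType) (P : M -> Prop) (x : zquot P) : M :=
  generic_quotient.repr (x : {ideal_quot (gen_subgroup P)}).

Lemma zreprK (M : zmodType) (P : M -> Prop) : cancel (@zrepr M P) (@zpi M P).
Proof. exact: reprK. Qed.

Lemma zpiB (M : zmodType) (P : M -> Prop) : {morph @zpi M P : x y / x - y}.
Proof. by move=> x y; rewrite /zpi !piE. Qed.

HB.instance Definition _ (M : zmodType) (P : M -> Prop) :=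
  GRing.isZmodMorphism.Build M (zquot P) (@zpi M P) (@zpiB M P).

Lemma zpi_eq (M : zmodType) (P : M -> Prop) (x y : M) :
  zpi P x = zpi P y <-> x - y \in gen_subgroup P.
Proof.
by rewrite -Quotient.equivE; split=> [/eqP|h]; [|apply/eqP]; rewrite piE.
Qed.

(* An additive map that kills the relations factors through the quotient. *)
Lemma zquot_lift (M N : zmodType) (P : M -> Prop) (f : {additive M -> N}) :
  (forall y, P y -> f y = 0) -> forall x, f (zrepr (zpi P x)) = f x.
Proof.
move=> fP x; apply/eqP; rewrite -subr_eq0 -raddfB; apply/eqP.
pose K : {pred M} := [pred z | f z == 0].
have Kz : zmod_closed K.
  split=> [|u v]; rewrite !inE ?raddf0 // => /eqP fu /eqP fv.
  by rewrite raddfB /= fu fv subrr.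
pose KS : zmodClosed M :=
  HB.pack_for (zmodClosed M) K (GRing.isZmodClosed.Build M K Kz).
have /zpi_eq/asboolP : zpi P (zrepr (zpi P x)) = zpi P x by rewrite zreprK.
by move=> /(_ KS) h; apply/eqP/h => y Py; rewrite inE; apply/eqP/fP.
Qed.

Definition bilinear2 (A B C : zmodType) (f : A -> B -> C) : Prop :=
  (forall b, {morph f^~ b : x y / x + y}) /\ (forall a, {morph f a : x y / x + y}).

Inductive tensor_rel (A B : zmodType) : {freeg (A * B)%type / int} -> Prop :=
| TensorRelL a a' b :
    tensor_rel (fgen (a + a', b) - (fgen (a, b) + fgen (a', b)))
| TensorRelR a b b' :
    tensor_rel (fgen (a, b + b') - (fgen (a, b) + fgen (a, b'))).

Definition tensor (A B : zmodType) : zmodType := zquot (@tensor_rel A B).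

Definition tens (A B : zmodType) (a : A) (b : B) : tensor A B :=
  zpi (@tensor_rel A B) (fgen (a, b)).

(* Evaluated on a chosen representative of t; the choice is immaterial when f is
   bilinear (see tliftE). *)
Definition tlift (A B C : zmodType) (f : A -> B -> C) (t : tensor A B) : C :=
  flift (fun p : A * B => f p.1 p.2) (zrepr t).

Lemma flift_is_additive (T : choiceType) (M : zmodType) (f : T -> M) :
  {morph flift f : x y / x - y}.
Proof. exact: (@lift_is_additive _ _ (zmodule M)). Qed.

HB.instance Definition _ (T : choiceType) (M : zmodType) (f : T -> M) :=
  GRing.isZmodMorphism.Build {freeg T / int} M (flift f) (flift_is_additive f).

Lemma flift_fgen (T : choiceType) (M : zmodType) (f : T -> M) t :
  flift f (fgen t) = f t.
Proof. by rewrite /flift /fgen liftU scale1r. Qed.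

Lemma tliftE (A B C : zmodType) (f : A -> B -> C) (a : A) (b : B) :
  bilinear2 f -> tlift f (tens a b) = f a b.
Proof.
move=> [fl fr]; rewrite /tlift /tens zquot_lift /= ?flift_fgen // => y [] *.
  by rewrite raddfB raddfD /= !flift_fgen /= fl subrr.
by rewrite raddfB raddfD /= !flift_fgen /= fr subrr.
Qed.

Definition tmap (A A' B B' : zmodType) (f : A -> A') (g : B -> B') :
  tensor A B -> tensor A' B' := tlift (fun a b => tens (f a) (g b)).

Definition tswap (A B : zmodType) : tensor A B -> tensor B A :=
  tlift (fun a b => tens b a).

Definition tassoc (A B C : zmodType) :
    tensor (tensor A B) C -> tensor A (tensor B C) :=
  tlift (fun t c => tlift (fun a b => tens a (tens b c)) t).


Record hopf_data := HopfData {
  carrier :> zmodType;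
  hmul : carrier -> carrier -> carrier;
  hone : carrier;
  hcomul : carrier -> tensor carrier carrier;
  hcounit : carrier -> int;
  hgrade : nat -> carrier -> Prop }.

Arguments hone {h}.

Definition additive_map (A B : zmodType) (f : A -> B) : Prop :=
  {morph f : x y / x + y}.

Definition tmul (H : hopf_data) (s t : tensor H H) : tensor H H :=
  tlift (fun a b => tlift (fun c d => tens (hmul a c) (hmul b d)) t) s.

Definition algebra_axioms (H : hopf_data) : Prop :=
  [/\ bilinear2 (@hmul H), associative (@hmul H),
      left_id hone (@hmul H) & right_id hone (@hmul H)].

Definition coalgebra_axioms (H : hopf_data) : Prop :=
  [/\ additive_map (@hcomul H), additive_map (@hcounit H),
      (forall x : H, tassoc (tmap (@hcomul H) id (hcomul x))
                     = tmap id (@hcomul H) (hcomul x)),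
      (forall x : H, tlift (fun a b => b *~ hcounit a) (hcomul x) = x)
    & (forall x : H, tlift (fun a b => a *~ hcounit b) (hcomul x) = x)].

Definition bialgebra_axioms (H : hopf_data) : Prop :=
  [/\ (forall x y : H, hcomul (hmul x y) = tmul (hcomul x) (hcomul y)),
      hcomul (hone : H) = tens hone hone,
      (forall x y : H, hcounit (hmul x y) = hcounit x * hcounit y)
    & hcounit (hone : H) = 1].

Definition antipode_axioms (H : hopf_data) (S : H -> H) : Prop :=
  [/\ additive_map S,
      (forall x, tlift (fun a b => hmul (S a) b) (hcomul x) = hone *~ hcounit x)
    & (forall x, tlift (fun a b => hmul a (S b)) (hcomul x) = hone *~ hcounit x)].

Definition hopf_algebra (H : hopf_data) : Prop :=
  [/\ algebra_axioms H, coalgebra_axioms H, bialgebra_axioms H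
    & exists S, @antipode_axioms H S].

Inductive pure_tensor_of_degree (H : hopf_data) (n : nat) : tensor H H -> Prop :=
| PureTensorOfDegree i j (a b : H) :
    (i + j)%N = n -> hgrade i a -> hgrade j b ->
    pure_tensor_of_degree n (tens a b).

Definition grading_axioms (H : hopf_data) : Prop :=
  [/\ (forall n, hgrade n (0 : H) /\
          forall x y : H, hgrade n x -> hgrade n y -> hgrade n (x - y)),
      (forall x : H, exists N (c : nat -> H),
          (forall n, hgrade n (c n)) /\ x = \sum_(n < N) c n)
    & (forall N (c : nat -> H), (forall n, hgrade n (c n)) ->
          \sum_(n < N) c n = 0 -> forall n, (n < N)%N -> c n = 0)].

Definition graded_structure (H : hopf_data) : Prop :=
  [/\ hgrade 0 (hone : H),
      (forall m n (x y : H), hgrade m x -> hgrade n y ->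
         hgrade (m + n) (hmul x y)),
      (forall n (x : H), hgrade n x ->
         hcomul x \in gen_subgroup (@pure_tensor_of_degree H n))
    & (forall n (x : H), (0 < n)%N -> hgrade n x -> hcounit x = 0)].

Definition graded_hopf_algebra (H : hopf_data) : Prop :=
  [/\ hopf_algebra H, grading_axioms H & graded_structure H].

Definition connected_hopf (H : hopf_data) : Prop :=
  forall x : H, hgrade 0 x -> exists! z : int, x = hone *~ z.

Definition commutative_hopf (H : hopf_data) : Prop :=
  commutative (@hmul H).

Definition cocommutative_hopf (H : hopf_data) : Prop :=
  forall x : H, tswap (hcomul x) = hcomul x.

Definition algebra_morphism (H : hopf_data) (f : H -> int) : Prop :=
  [/\ additive_map f, (forall x y, f (hmul x y) = f x * f y) & f hone = 1].

(* Bialgebra morphisms between Hopf algebras commute with the antipodes. *)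
Definition hopf_morphism (H K : hopf_data) (f : H -> K) : Prop :=
  [/\ additive_map f,
      (forall x y, f (hmul x y) = hmul (f x) (f y)) /\ f hone = hone,
      (forall x, hcomul (f x) = tmap f f (hcomul x))
    & (forall x, hcounit (f x) = hcounit x)].

Definition graded_hopf_morphism (H K : hopf_data) (f : H -> K) : Prop :=
  hopf_morphism f /\ forall n x, hgrade n x -> hgrade n (f x).


Record graph (V : finType) := Graph {
  edges :> {set {set V}};
  edges2 : [forall e in edges, #|e| == 2] }.

HB.instance Definition _ (V : finType) := [isSub for @edges V].
HB.instance Definition _ (V : finType) := [Finite of graph V by <:].

Record graph_iso (V W : finType) (G : graph V) (H : graph W) := GraphIso {
  iso_fun :> V -> W;
  iso_inv : W -> V;
  iso_funK : cancel iso_fun iso_inv;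
  iso_invK : cancel iso_inv iso_fun;
  iso_edges : [set iso_fun @: (e : {set V}) | e in edges G] = edges H }.

Lemma edges2P (V : finType) (E : {set {set V}}) :
  reflect (forall e, e \in E -> #|e| = 2) [forall e in E, #|e| == 2].
Proof. by apply: (iffP forall_inP) => h e /h /eqP. Qed.

Lemma edgeless2 (V : finType) : [forall e in (set0 : {set {set V}}), #|e| == 2].
Proof. by apply/edges2P => e; rewrite inE. Qed.

Definition empty_graph : graph 'I_0 := Graph (edgeless2 'I_0).

Section GraphOperations.
Variables V W : finType.

Lemma image2 (f : V -> W) (E : {set {set V}}) :
  injective f -> [forall e in E, #|e| == 2] ->
  [forall e in [set f @: (e : {set V}) | e in E], #|e| == 2].
Proof.
move=> injf /edges2P hE; apply/edges2P => _ /imsetP[e eE ->].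
by rewrite card_imset // hE.
Qed.

Definition dunion_edges (G : graph V) (H : graph W) : {set {set (V + W)%type}} :=
  [set inl @: (e : {set V}) | e in edges G]
  :|: [set inr @: (e : {set W}) | e in edges H].

Lemma dunion2 (G : graph V) (H : graph W) :
  [forall e in dunion_edges G H, #|e| == 2].
Proof.
apply/edges2P => e /setUP[] /imsetP[d dG ->].
  by rewrite card_imset ?(edges2P _ (edges2 G)) // => x y [].
by rewrite card_imset ?(edges2P _ (edges2 H)) // => x y [].
Qed.

Definition dunion (G : graph V) (H : graph W) : graph (V + W)%type :=
  Graph (dunion2 G H).

Lemma induced2 (G : graph V) (U : {set V}) :
  [forall e in [set e : {set {x : V | x \in U}} | val @: e \in edges G],
     #|e| == 2].
Proof.
apply/edges2P => e; rewrite inE => /(edges2P _ (edges2 G)).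
by rewrite card_imset //; exact: val_inj.
Qed.

Definition induced (G : graph V) (U : {set V}) : graph {x : V | x \in U} :=
  Graph (induced2 G U).

End GraphOperations.

Section Aut.
Variable V : finType.
Variable G : graph V.

Definition aut_set : {set {perm V}} :=
  [set s : {perm V} | [set s @: (e : {set V}) | e in edges G] == edges G].

Lemma aut_group_set : group_set aut_set.
Proof.
apply/group_setP; split=> [|s t]; rewrite !inE.
  have e1 : (fun e : {set V} => (1%g : {perm V}) @: e) =1 id.
    move=> e; rewrite -[RHS]imset_id; apply: eq_imset => x /=.
    by rewrite perm1.
  by rewrite (eq_imset _ e1) imset_id.
move=> /eqP hs /eqP ht; rewrite -[X in _ == X]ht -{2}hs -imset_comp.
apply/eqP/eq_imset => e /=; rewrite -imset_comp.
by apply: eq_imset => x /=; rewrite permM.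
Qed.

Definition graph_aut : {group {perm V}} := Group aut_group_set.

Definition aut_stab (U : {set V}) : {group {perm V}} := 'N_(graph_aut)(U | 'P)%G.

Lemma aut_stab_sub (U : {set V}) : aut_stab U \subset graph_aut.
Proof. exact: subsetIl. Qed.

End Aut.

(* w |-> w^-1 s w, from permutations of W to permutations of V. In mathcomp the
   product of permutations is (s * t) x = t (s x). *)
Section Transport.
Variables (V W : finType) (G : graph V) (H : graph W) (w : graph_iso G H).

Lemma transport_inj (s : {perm W}) :
  injective (fun v => iso_inv w (s (w v))).
Proof.
move=> x y /(can_inj (iso_invK w)) /perm_inj; exact: (can_inj (iso_funK w)).
Qed.

Definition transport (s : {perm W}) : {perm V} := perm (transport_inj (s := s)).

Lemma transportM : {in graph_aut H &, {morph transport : s t / (s * t)%g}}.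
Proof.
move=> s t _ _; apply/permP => v.
by rewrite permM !(permE (@transport_inj _)) iso_invK permM.
Qed.

Lemma transport_aut s : s \in graph_aut H -> transport s \in graph_aut G.
Proof.
rewrite !inE => /eqP hs; apply/eqP.
have inj_w : injective (fun e : {set V} => w @: e).
  exact: imset_inj (can_inj (iso_funK w)).
apply: (imset_inj inj_w); rewrite iso_edges -[RHS]hs -{1}(iso_edges w).
rewrite -!imset_comp; apply: eq_imset => e /=; rewrite -!imset_comp.
by apply: eq_imset => x /=; rewrite permE iso_invK.
Qed.

End Transport.

Section Standard.
Variables (V : finType) (G : graph V).

Definition std_graph : graph 'I_#|V| :=
  Graph (image2 (@enum_rank_inj V) (edges2 G)).

Definition std_iso : graph_iso G std_graph :=
  @GraphIso _ _ G std_graph enum_rank enum_val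
    enum_rankK enum_valK (erefl (edges std_graph)).

End Standard.


(* Representations act on row vectors on the right, while the product of
   permutations in mathcomp is the opposite of composition; together these are
   the left representations of groups of permutations under composition. *)

Section Rep.
Variable k : closedFieldType.

Section Constructions.
Variables (aT rT : finGroupType) (H : {group aT}) (G : {group rT}).

Section Pullback.
Variables (f : aT -> rT) (n : nat) (rG : mx_representation k G n).
Hypothesis fG : forall x, x \in H -> f x \in G.
Hypothesis fM : {in H &, {morph f : x y / (x * y)%g}}.

Lemma pullback_mx_repr : mx_repr H (fun x => rG (f x)).
Proof.
have f1 : f 1%g = 1%g by apply: (mulgI (f 1%g)); rewrite -fM ?mulg1.
split=> [|x y Hx Hy]; first by rewrite f1 repr_mx1.
by rewrite fM // repr_mxM // fG.
Qed.

Definition pullback_repr : mx_representation k H n :=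
  MxRepresentation pullback_mx_repr.

End Pullback.

(* The representation induced from H to G along f : H -> G, realized on the
   space of functions phi : G -> k^n such that phi (g * f h) = phi g *m rH h,
   with x in G acting by (phi x) g = phi (x * g).  A function phi is the matrix
   whose rows are its values in the order of [enum G], flattened by mxvec. *)
Section Induction.
Variables (f : aT -> rT) (n : nat) (rH : mx_representation k H n).

Definition ltrans_mx (x : rT) : 'M[k]_#|G| :=
  \matrix_(i, j) (enum_val j == x * enum_val i :> rT)%g%:R.

Definition rtrans_mx (x : rT) : 'M[k]_#|G| :=
  \matrix_(i, j) (enum_val j == enum_val i * x :> rT)%g%:R.

Lemma ltrans_mx_repr :
  mx_repr G (fun x => lin_mulmx (ltrans_mx x) : 'M[k]_(#|G| * n)).
Proof.
split=> [|x y Gx Gy].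
  have -> : ltrans_mx 1%g = 1%:M.
    apply/matrixP => i j; rewrite !mxE mul1g (inj_eq enum_val_inj).
    by rewrite eq_sym.
  apply/row_matrixP => i; rewrite !rowE mulmx1 mul_rV_lin /= mul1mx.
  by rewrite vec_mxK.
have -> : ltrans_mx (x * y)%g = ltrans_mx y *m ltrans_mx x.
  apply/matrixP => i j; rewrite !mxE.
  have Gyi : (y * enum_val i)%g \in G by rewrite groupM ?enum_valP.
  rewrite (bigD1 (enum_rank_in Gyi (y * enum_val i)%g)) //= !mxE.
  rewrite enum_rankK_in // eqxx mul1r mulgA big1 ?addr0 // => l ne_l.
  rewrite !mxE; case: eqP => [el|_]; last by rewrite mul0r.
  by case/eqP: ne_l; apply: enum_val_inj; rewrite enum_rankK_in.
apply/row_matrixP => i; rewrite !rowE mulmxA !mul_rV_lin /= mxvecK.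
by rewrite mulmxA.
Qed.

Definition ltrans_repr := MxRepresentation ltrans_mx_repr.

Definition equivariant_mx : 'M[k]_(#|G| * n) :=
  (\bigcap_(h in H)
     kermx (lin_mulmx (rtrans_mx (f h)) - lin_mulmxr (rH h)))%MS.

Lemma equivariantP (u : 'rV[k]_(#|G| * n)) :
  reflect (forall h, h \in H ->
             rtrans_mx (f h) *m vec_mx u = vec_mx u *m rH h)
          (u <= equivariant_mx)%MS.
Proof.
apply: (iffP sub_bigcapmxP) => hu h Hh; have := hu h Hh.
  move/sub_kermxP; rewrite mulmxBr !mul_rV_lin /= => /eqP.
  by rewrite subr_eq0 => /eqP /(can_inj mxvecK).
by move=> e; apply/sub_kermxP; rewrite mulmxBr !mul_rV_lin /= e subrr.
Qed.

Lemma equivariant_module : mxmodule ltrans_repr equivariant_mx.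
Proof.
apply/mxmoduleP => x Gx; apply/row_subP => i; rewrite row_mul.
have /equivariantP hu := row_sub i equivariant_mx.
apply/equivariantP => h Hh; rewrite mul_rV_lin /= mxvecK -mulmxA -hu //.
rewrite !mulmxA; congr (_ *m _); apply/matrixP => a b; rewrite !mxE.
have Gxa : (x * enum_val a)%g \in G by rewrite groupM ?enum_valP.
rewrite [RHS](bigD1 (enum_rank_in Gxa (x * enum_val a)%g)) //= !mxE.
rewrite enum_rankK_in // eqxx mul1r [X in _ + X]big1 ?addr0; last first.
  move=> l ne_l; rewrite !mxE; case: eqP => [el|_]; last by rewrite mul0r.
  by case/eqP: ne_l; apply: enum_val_inj; rewrite enum_rankK_in.
have [Gaf|nGaf] := boolP ((enum_val a * f h)%g \in G).
  rewrite (bigD1 (enum_rank_in Gaf (enum_val a * f h)%g)) //= !mxE.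
  rewrite enum_rankK_in // eqxx mul1r mulgA big1 ?addr0 // => l ne_l.
  rewrite !mxE; case: eqP => [el|_]; last by rewrite mul0r.
  by case/eqP: ne_l; apply: enum_val_inj; rewrite enum_rankK_in.
rewrite big1 => [|l _]; last first.
  rewrite !mxE; case: eqP => [el|_]; last by rewrite mul0r.
  by case/negP: nGaf; rewrite -el enum_valP.
case: eqP => // eb; case/negP: nGaf.
by rewrite -(groupMl _ Gx) mulgA -eb enum_valP.
Qed.

Definition ind_repr : mx_representation k G (\rank equivariant_mx) :=
  submod_repr equivariant_module.

End Induction.
End Constructions.

Section OneGroup.
Variables (gT : finGroupType) (G : {group gT}).

(* In characteristic 0 the components of the regular representation are in
   bijection with the isomorphism classes of irreducible representations. *)
Definition Irr : irrType k G := DecSocleType (regular_repr k G).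

Definition rep_group : zmodType := {ffun Irr -> int}.

Definition multiplicity n (rG : mx_representation k G n) (i : Irr) : nat :=
  \sum_(W : DecSocleType rG | irr_comp Irr (socle_repr W) == i) socle_mult W.

Definition rep_class n (rG : mx_representation k G n) : rep_group :=
  [ffun i => (multiplicity rG i)%:Z].

Lemma triv_mx_repr : mx_repr G (fun _ : gT => 1%:M : 'M[k]_1).
Proof. by split=> // x y _ _; rewrite mulmx1. Qed.

Definition triv_repr : mx_representation k G 1 := MxRepresentation triv_mx_repr.

Definition is_triv (i : Irr) : bool := `[< mx_rsim (irr_repr i) triv_repr >].

Definition dim_Hom m n (rV : mx_representation k G m)
    (rW : mx_representation k G n) : nat :=
  \rank (\bigcap_(g in G) kermx (lin_mulmx (rV g) - lin_mulmxr (rW g)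
                                 : 'M[k]_(m * n)))%MS.

End OneGroup.

Section ExternalTensor.
Variables (aT bT : finGroupType) (A : {group aT}) (B : {group bT}).

Lemma fst_setX (x : aT * bT) : x \in setX A B -> x.1 \in A.
Proof. by rewrite inE => /andP[]. Qed.

Lemma snd_setX (x : aT * bT) : x \in setX A B -> x.2 \in B.
Proof. by rewrite inE => /andP[]. Qed.

Definition box_repr m n (rA : mx_representation k A m)
    (rB : mx_representation k B n) : mx_representation k (setX A B) (m * n) :=
  prod_repr (pullback_repr rA fst_setX (fun _ _ _ _ => erefl))
            (pullback_repr rB snd_setX (fun _ _ _ _ => erefl)).

End ExternalTensor.

Definition Ad (V W : finType) (G : graph V) (H : graph W) (w : graph_iso G H)
    n (rG : mx_representation k (graph_aut G) n) : mx_representation k (graph_aut H) n :=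
  pullback_repr rG (@transport_aut V W G H w) (@transportM V W G H w).


Record irr_label := IrrLabel {
  lab_order : nat;
  lab_graph : graph 'I_lab_order;
  lab_irr : Irr (graph_aut lab_graph) }.

HB.instance Definition _ := gen_eqMixin irr_label.
HB.instance Definition _ := gen_choiceMixin irr_label.

(* The direct sum of the R(Aut G) over all graphs G on the sets ['I_n]; since
   isomorphic graphs are identified below, these graphs suffice. *)
Definition rep_sum : zmodType := {freeg irr_label / int}.

Definition rep_incl n (G : graph 'I_n) (r : rep_group (graph_aut G)) : rep_sum :=
  \sum_i fgen (IrrLabel i) *~ r i.

Inductive Ad_rel : rep_sum -> Prop :=
| AdRel n m (G : graph 'I_n) (H : graph 'I_m) (w : graph_iso G H)
    d (rG : mx_representation k (graph_aut G) d) :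
    Ad_rel (rep_incl (rep_class rG) - rep_incl (rep_class (Ad w rG))).

Definition Arep : zmodType := zquot Ad_rel.

Definition aclass (V : finType) (G : graph V) n
    (rG : mx_representation k (graph_aut G) n) : Arep :=
  zpi Ad_rel (rep_incl (rep_class (Ad (std_iso G) rG))).

(* Additive and biadditive extensions of maps given on the classes of
   irreducible representations, evaluated on chosen representatives in rep_sum;
   the choice is immaterial for maps F that are invariant under graph
   isomorphisms, as are all those used below. *)
Definition Alift (M : zmodType) (F : irr_label -> M) (x : Arep) : M :=
  flift F (zrepr x).

Definition Alift2 (M : zmodType) (F : irr_label -> irr_label -> M)
    (x y : Arep) : M :=
  Alift (fun a => Alift (F a) y) x.

(* insubd only serves to package the function, which is a permutation. *)
Definition dunion_perm (V W : finType) (s : {perm V} * {perm W}) :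
    {perm (V + W)%type} :=
  insubd (1%g : {perm (V + W)%type})
    [ffun x => match x with inl v => inl (s.1 v) | inr w => inr (s.2 w) end].

Definition Amul_irr (a b : irr_label) : Arep :=
  aclass (G := dunion (lab_graph a) (lab_graph b))
    (ind_repr (graph_aut (dunion (lab_graph a) (lab_graph b)))
       (@dunion_perm 'I_(lab_order a) 'I_(lab_order b))
       (box_repr (irr_repr (lab_irr a)) (irr_repr (lab_irr b)))).

Definition Aone : Arep := aclass (triv_repr (graph_aut empty_graph)).

(* The restriction of s to U if s(U) = U (and a default permutation if not). *)
Definition restr_perm_sub (V : finType) (U : {set V}) (s : {perm V}) :
    {perm {x : V | x \in U}} :=
  insubd (1%g : {perm {x : V | x \in U}})
    [ffun x : {x : V | x \in U} => insubd x (s (val x))].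

Definition split_perm (V : finType) (U : {set V}) (s : {perm V}) :
    {perm {x : V | x \in U}} * {perm {x : V | x \in ~: U}} :=
  (restr_perm_sub U s, restr_perm_sub (~: U) s).

(* The image of the class of r under the inverse of the canonical isomorphism
   from R(Aut G) (x) R(Aut H) to R(Aut G x Aut H), which maps the basis of the
   i (x) j to the basis of the classes of their external tensor products. *)
Definition box_split (V W : finType) (G : graph V) (H : graph W) n
    (r : mx_representation k (setX (graph_aut G) (graph_aut H)) n) : tensor Arep Arep :=
  \sum_(i : Irr (graph_aut G)) \sum_(j : Irr (graph_aut H))
    tens (aclass (irr_repr i)) (aclass (irr_repr j))
      *+ multiplicity r (irr_comp _ (box_repr (irr_repr i) (irr_repr j))).

Definition Acomul_rep (V : finType) (G : graph V) n
    (rG : mx_representation k (graph_aut G) n) : tensor Arep Arep :=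
  \sum_(U in orbit_transversal ('P^*)%act (graph_aut G) [set: {set V}])
    box_split (ind_repr (setX (graph_aut (induced G U)) (graph_aut (induced G (~: U))))
                 (split_perm U) (subg_repr rG (aut_stab_sub G U))).

Definition Acomul : Arep -> tensor Arep Arep :=
  Alift (fun a => Acomul_rep (irr_repr (lab_irr a))).

Definition Acounit : Arep -> int :=
  Alift (fun a => ((lab_order a == 0%N) && is_triv (lab_irr a))%:Z).

Definition Azeta : Arep -> int :=
  Alift (fun a => ((edges (lab_graph a) == set0)
                   && is_triv (lab_irr a))%:Z).

Definition Agrade (n : nat) (x : Arep) : Prop :=
  exists2 y : rep_sum, x = zpi Ad_rel y &
    forall a, a \in dom y -> lab_order a = n.

Definition rep_hopf : hopf_data :=
  HopfData (Alift2 Amul_irr) Aone Acomul Acounit Agrade.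

End Rep.


Record std_graph_of := StdGraph { sg_order : nat; sg_graph : graph 'I_sg_order }.

HB.instance Definition _ := gen_eqMixin std_graph_of.
HB.instance Definition _ := gen_choiceMixin std_graph_of.

Definition isomorphic (G H : std_graph_of) : bool :=
  `[< inhabited (graph_iso (sg_graph G) (sg_graph H)) >].

Lemma isomorphic_equiv : equiv_class_of isomorphic.
Proof.
have hrefl : reflexive isomorphic.
  move=> G; apply/asboolP; constructor.
  apply: (@GraphIso _ _ _ _ id id) => //.
  by rewrite -[RHS]imset_id; apply: eq_imset => e; rewrite imset_id.
have hsym G H : isomorphic G H -> isomorphic H G.
  move=> /asboolP[w]; apply/asboolP; constructor.
  apply: (@GraphIso _ _ _ _ (iso_inv w) w).
  - exact: iso_invK.
  - exact: iso_funK.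
  rewrite -(iso_edges w) -imset_comp -[RHS]imset_id; apply: eq_imset => e /=.
  rewrite -imset_comp -[RHS]imset_id; apply: eq_imset => x /=.
  exact: iso_funK.
split=> //; first by move=> G H; apply/idP/idP; exact: hsym.
move=> H G K /asboolP[w] /asboolP[w']; apply/asboolP; constructor.
apply: (@GraphIso _ _ _ _ (w' \o w) (iso_inv w \o iso_inv w')).
- by move=> x /=; rewrite !iso_funK.
- by move=> x /=; rewrite !iso_invK.
rewrite -(iso_edges w') -(iso_edges w) -imset_comp; apply: eq_imset => e /=.
by rewrite -imset_comp.
Qed.

Canonical isomorphic_equiv_rel := EquivRelPack isomorphic_equiv.

Definition graph_class : choiceType := {eq_quot isomorphic}%qT.

Definition graph_class_of (V : finType) (G : graph V) : graph_class :=
  (\pi_({eq_quot isomorphic}) (StdGraph (std_graph G)))%qT.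

Definition class_graph (c : graph_class) : graph 'I_(sg_order _) :=
  sg_graph (generic_quotient.repr (c : {eq_quot isomorphic}%qT)).

Definition class_order (c : graph_class) : nat :=
  sg_order (generic_quotient.repr (c : {eq_quot isomorphic}%qT)).

Definition Ggroup : zmodType := {freeg graph_class / int}.

Definition gclass (V : finType) (G : graph V) : Ggroup :=
  fgen (graph_class_of G).

Definition Gmul (x y : Ggroup) : Ggroup :=
  flift (fun c => flift (fun d =>
    gclass (dunion (class_graph c) (class_graph d))) y) x.

Definition Gcomul : Ggroup -> tensor Ggroup Ggroup :=
  flift (fun c => \sum_(U : {set 'I_(class_order c)})
    tens (gclass (induced (class_graph c) U))
         (gclass (induced (class_graph c) (~: U)))).

Definition Gcounit : Ggroup -> int :=
  flift (fun c => (class_order c == 0%N)%:Z).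

Definition Ggrade (n : nat) (x : Ggroup) : Prop :=
  forall c, c \in dom x -> class_order c = n.

Definition graph_hopf : hopf_data :=
  HopfData Gmul (gclass empty_graph) Gcomul Gcounit Ggrade.

Definition reg_map (k : closedFieldType) : Ggroup -> Arep k :=
  flift (fun c => aclass (regular_repr k (graph_aut (class_graph c)))).


(* Not imported earlier because classical_sets shadows names of finset. *)
From mathcomp Require Import classical_sets functions cardinality fsbigop.
From mathcomp.multinomials Require Import monalg.

(* Monomials in the variables x_0, x_1, x_2, ... *)
Notation mono := {cmonom nat}.

(* Formal power series, given by their coefficients. *)
Definition power_series : zmodType := mono -> int.

Definition bounded_degree (f : power_series) : Prop :=
  exists N, forall m, f m != 0 -> (mdeg m <= N)%N.

Definition symmetric_series (f : power_series) : Prop :=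
  forall (s : nat -> nat) (m m' : mono),
    bijective s -> (forall i, m' (s i) = m i) -> f m' = f m.

Definition Sym_pred : {pred power_series} :=
  fun f => `[< bounded_degree f /\ symmetric_series f >].

Lemma Sym_zmod_closed : zmod_closed Sym_pred.
Proof.
split=> [|f g /asboolP[[N hN] sf] /asboolP[[M hM] sg]].
  by apply/asboolP; split=> //; exists 0%N => m; rewrite eqxx.
apply/asboolP; split=> [|s m m' sb e]; last first.
  rewrite -[LHS]/(f m' - g m') -[RHS]/(f m - g m).
  by rewrite (sf s m m') // (sg s m m').
exists (maxn N M) => m; rewrite -[(f - g) m]/(f m - g m) leq_max.
have [-> | /hN ->] := eqVneq (f m) 0; last by [].
by rewrite sub0r oppr_eq0 => /hM ->; rewrite orbT.
Qed.

HB.instance Definition _ :=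
  GRing.isAddClosed.Build power_series Sym_pred (GRing.zmod_closedD Sym_zmod_closed).
HB.instance Definition _ :=
  GRing.isOppClosed.Build power_series Sym_pred (GRing.zmod_closedN Sym_zmod_closed).

Record Sym_type := SymFun {
  sym_val :> power_series;
  sym_valP : sym_val \in Sym_pred }.

HB.instance Definition _ := [isSub for sym_val].
HB.instance Definition _ := [Choice of Sym_type by <:].
HB.instance Definition _ := [SubChoice_isSubZmodule of Sym_type by <:].

Definition SymZ : zmodType := Sym_type.

Definition psmul (f g : power_series) : power_series := fun m =>
  \sum_(p \in [set p : mono * mono | mmul p.1 p.2 = m]%classic) f p.1 * g p.2.

Definition psone : power_series := fun m => (m == mone)%:Z.

(* The monomial obtained by renaming each variable x_i to x_(s i). *)
Definition mrename (s : nat -> nat) (m : mono) : mono :=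
  \big[mmul/mone]_(i <- finsupp m) expcmn (ucm (s i)) (m i).

Lemma monoP (m m' : mono) : (forall i, m i = m' i) -> m = m'.
Proof. by move=> e; apply/eqP/cmP. Qed.

Lemma expcmnE (m : mono) n i : expcmn m n i = (n * m i)%N.
Proof.
rewrite /expcmn; case: n => [|n]; first by rewrite onecmE.
by rewrite iteropS; elim: n => [|n IH] /=; rewrite ?mul1n // mulcmE IH -mulSn.
Qed.

Lemma mono_bigE (J : Type) (r : seq J) (F : J -> mono) i :
  (\big[mmul/mone]_(j <- r) F j) i = (\sum_(j <- r) F j i)%N.
Proof. by apply: (big_morph (fun m : mono => m i)) => [m m'|]; rewrite ?cmM ?cm1. Qed.

Lemma mrenameE (s : nat -> nat) (m : mono) i :
  injective s -> mrename s m (s i) = m i.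
Proof.
move=> inj_s; rewrite /mrename mono_bigE.
under eq_bigr => j _ do rewrite expcmnE cmU (inj_eq inj_s).
have [im|/[dup] im] := boolP (i \in finsupp m); last first.
  rewrite -cmE_eq0 => /eqP ->; rewrite big_seq big1 // => j jm.
  by case: eqP => [ji|_]; rewrite ?muln0 //; rewrite -ji jm in im.
rewrite (bigD1_seq i) ?fset_uniq //= eqxx muln1 big1 ?addn0 // => j /negbTE ->.
by rewrite muln0.
Qed.

Lemma Sym_mul_closed (f g : power_series) :
  f \in Sym_pred -> g \in Sym_pred -> psmul f g \in Sym_pred.
Proof.
move=> /asboolP[[N hN] sf] /asboolP[[M hM] sg]; apply/asboolP; split.
  exists (N + M)%N => m; apply: contraNT => lt_NM; apply/eqP.
  apply: fsbig1 => -[p q] /= pq; apply/eqP; rewrite mulf_eq0.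
  apply: contraNT lt_NM; rewrite negb_or => /andP[/hN hp /hM hq].
  by rewrite -pq mdegM leq_add.
move=> s m m' sb e; have [t sK tK] := sb; have inj_s := can_inj sK.
pose h (p : mono * mono) := (mrename s p.1, mrename s p.2).
have m'E i : m' i = m (t i) by rewrite -e tK.
rewrite /psmul (@reindex_fsbig _ _ _ _ _ h [set p | mmul p.1 p.2 = m]%classic).
  apply: eq_fsbigr => -[p q] _ /=.
  by congr (_ * _); [apply: (sf s) | apply: (sg s)] => // i; rewrite mrenameE.
split=> [[p q] /= pq | [p q] [p' q'] _ _ /= [ep eq] | [p q] /= pq].
- apply: monoP => i; rewrite cmM m'E -pq cmM -{1 2}[i]tK.
  by rewrite !mrenameE.
- congr (_, _); apply: monoP => i.
    by rewrite -(mrenameE p i inj_s) ep mrenameE.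
  by rewrite -(mrenameE q i inj_s) eq mrenameE.
have inj_t := can_inj tK.
have rK r : mrename s (mrename t r) = r.
  by apply: monoP => i; rewrite -{1}[i]tK mrenameE // mrenameE.
exists (mrename t p, mrename t q); last by rewrite /h /= !rK.
by apply: monoP => i; rewrite cmM -e -pq cmM -{1 2}[i]sK !mrenameE.
Qed.

Lemma Sym_one_closed : psone \in Sym_pred.
Proof.
apply/asboolP; split.
  by exists 0%N => m; rewrite /psone; case: (m =P mone) => [->|]; rewrite ?mdeg1.
move=> s m m' [t sK tK] e; rewrite /psone; congr (nat_of_bool _)%:Z.
apply/eqP/eqP => em; apply: monoP => i.
  by rewrite -e em !cm1.
by rewrite -[i]tK e em !cm1.
Qed.

Definition Sym_mul (f g : SymZ) : SymZ :=
  SymFun (Sym_mul_closed (sym_valP f) (sym_valP g)).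

Definition Sym_one : SymZ := SymFun Sym_one_closed.

(* f(x_0, x_1, ...; y_0, y_1, ...), as its coefficients on the products of a
   monomial m in the x_i and a monomial m' in the y_i: by symmetry f may be
   evaluated at the sequence x_0, y_0, x_1, y_1, ... *)
Definition two_alphabets (f : SymZ) : mono -> mono -> int := fun m m' =>
  sym_val f (mmul (mrename (fun i => i.*2) m) (mrename (fun i => i.*2.+1) m')).

(* f (x) g |-> f(x) g(y) *)
Definition tensor_series : tensor SymZ SymZ -> (mono -> mono -> int) :=
  tlift (fun f g : SymZ => (fun m m' => sym_val f m * sym_val g m') : mono -> mono -> int).

(* The unique t in SymZ (x) SymZ representing f(x; y). *)
Definition Sym_comul (f : SymZ) : tensor SymZ SymZ :=
  xget 0 [set t | tensor_series t = two_alphabets f]%classic.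

Definition Sym_counit (f : SymZ) : int := sym_val f mone.

Definition Sym_grade (n : nat) (f : SymZ) : Prop :=
  forall m, sym_val f m != 0 -> mdeg m = n.

Definition Sym_hopf : hopf_data :=
  HopfData Sym_mul Sym_one Sym_comul Sym_counit Sym_grade.

(* f(1, 0, 0, ...) *)
Definition eval100 (f : power_series) : int :=
  \sum_(m \in [set m : mono | forall i, (0 < i)%N -> m i = 0%N]%classic) f m.


Definition Comp (n : nat) : set (seq nat) :=
  [set alpha | all (ltn 0) alpha /\ sumn alpha = n]%classic.

(* The monomial quasisymmetric function: each strictly increasing sequence of
   indices contributes its monomial with coefficient 1. *)
Definition Mqsym (alpha : seq nat) : power_series := fun m =>
  \sum_(i \in [set i : seq nat | [/\ sorted ltn i, size i = size alpha &
      \big[mmul/mone]_(j < size alpha)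
        expcmn (ucm (nth 0%N i j)) (nth 0%N alpha j) = m]]%classic) (1 : int).

Section Chromatic.
Variables (k : closedFieldType) (V : finType) (G : graph V).

Definition Col (alpha : seq nat) : {set {ffun V -> 'I_(size alpha)}} :=
  [set kappa : {ffun V -> 'I_(size alpha)} |
    [forall i, #|[set v | kappa v == i]| == nth 0%N alpha i] &&
    [forall v, forall w, ([set v; w]%SET \in edges G) ==> (kappa v != kappa w)]].

Definition recolor (l : nat) (w : {perm V}) (kappa : {ffun V -> 'I_l}) :
    {ffun V -> 'I_l} :=
  [ffun v => kappa (w^-1%g v)].

Lemma recolor_Col alpha (w : {perm V}) (kappa : {ffun V -> 'I_(size alpha)}) :
  w \in graph_aut G -> (recolor w kappa \in Col alpha) = (kappa \in Col alpha).
Proof.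
move=> wG; rewrite !inE; congr andb.
  apply: eq_forallb => i; congr (_ == _).
  rewrite -(card_imset [set v | kappa v == i] (@perm_inj _ w)); apply: eq_card.
  move=> v; apply/idP/imsetP => [|[u]]; rewrite !inE ffunE.
    by move=> e; exists (w^-1%g v); rewrite ?inE ?permKV.
  by move=> e ->; rewrite permK.
have edgeE v u : ([set w v; w u]%SET \in edges G) = ([set v; u]%SET \in edges G).
  have /eqP {1}<- : [set w @: (e : {set V}) | e in edges G] == edges G.
    by move: wG; rewrite inE.
  have -> : [set w v; w u]%SET = w @: [set v; u]%SET.
    by rewrite imsetU !imset_set1.
  by rewrite mem_imset //; exact: imset_inj (@perm_inj _ w).
apply/forallP/forallP => h v; apply/forallP => u.
  have /forallP/(_ (w u)) := h (w v).
  by rewrite edgeE !ffunE !permK.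
have /forallP/(_ (w^-1%g u)) := h (w^-1%g v).
by rewrite -edgeE !permKV !ffunE.
Qed.

Definition coloring_mx (alpha : seq nat) (w : {perm V}) : 'M[k]_#|Col alpha| :=
  \matrix_(i, j) (enum_val j == recolor w (enum_val i))%:R.

Lemma coloring_mx_repr alpha : mx_repr (graph_aut G) (coloring_mx alpha).
Proof.
split=> [|w u wG uG].
  apply/matrixP => i j; rewrite !mxE eq_sym -(inj_eq enum_val_inj).
  congr (_ == _)%:R; apply/ffunP => v.
  by rewrite ffunE invg1 perm1.
apply/matrixP => i j; rewrite !mxE.
have wi : recolor w (enum_val i) \in Col alpha by rewrite recolor_Col ?enum_valP.
rewrite (bigD1 (enum_rank_in wi (recolor w (enum_val i)))) //= !mxE.
rewrite enum_rankK_in // eqxx mul1r big1 ?addr0 => [|l ne_l].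
  congr (_ == _)%:R; apply/ffunP => v.
  by rewrite !ffunE invMg permM.
rewrite !mxE; case: eqP => [el|_]; last by rewrite mul0r.
by case/eqP: ne_l; apply: enum_val_inj; rewrite enum_rankK_in.
Qed.

Definition coloring_repr (alpha : seq nat) :
    mx_representation k (graph_aut G) #|Col alpha| :=
  MxRepresentation (coloring_mx_repr alpha).

Definition Xrep n (rG : mx_representation k (graph_aut G) n) : power_series := fun m =>
  \sum_(alpha \in Comp #|V|)
    (dim_Hom (coloring_repr alpha) rG)%:Z * Mqsym alpha m.

End Chromatic.

Definition Xstanley (V : finType) (G : graph V) : power_series := fun m =>
  \sum_(alpha \in Comp #|V|) (#|Col G alpha|)%:Z * Mqsym alpha m.

Definition induced_by (H : hopf_data) (zeta : H -> int) (Psi : H -> SymZ) : Prop :=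
  @graded_hopf_morphism H Sym_hopf Psi /\
  forall x, eval100 (sym_val (Psi x)) = zeta x.

(* Main.v *)
Require Import Defs.
From HB Require Import structures.
From mathcomp Require Import all_boot all_order all_fingroup all_algebra.
From mathcomp Require Import all_solvable all_field all_character finmap.
From mathcomp Require Import boolp.
From mathcomp.multinomials Require Import freeg.

Set Implicit Arguments.
Unset Strict Implicit.
Unset Printing Implicit Defensive.

Import GRing.Theory.
Local Open Scope ring_scope.

(** The elements of A are studied through their pairings with families.  A family
    assigns a scalar to a set [E] of edges on [V], a permutation [t] of [V] and a
    set [T] of vertices; it is natural if it vanishes unless [T] is stable under
    [t] and depends only on the graph and the permutation that [E] and [t] induce
    on [T].  Such a family [psi] gives a functional on A, which sends a
    representation of Aut G to the average over [s] in Aut G of its character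
    times the value of [psi] at G, [s] and the set of all vertices.  Natural
    families separate the elements of A and of its tensor powers ([Arep_eq],
    [Arep2_eq], [Arep3_eq]): counting the isomorphisms from a given graph,
    weighted by an irreducible character, gives a nonzero multiple of one coordinate.

    Under the pairing the structure maps become elementary.  The product is
    induced from a product of groups, so by Frobenius reciprocity it is dual to
    the evaluation of families at disjoint unions ([pair_mul]).  The coproduct is
    dual to the convolution [fconv], the sum over [S] of [psi S * phi (T - S)]
    ([pair2_comul]): Frobenius reciprocity gives sums over the stabilisers of the
    vertex sets [U], and a sum over orbit representatives weighted by stabilisers
    is a sum over all [U].  The counit and [zeta] are the pairings with the
    indicators of the empty set and of the stable edgeless sets ([counitE],
    [zetaE]).  The axioms of a commutative and cocommutative bialgebra then say
    that convolution and disjoint union are associative, commutative and unital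
    and that a subset of a disjoint union is a pair of subsets.  The antipode
    exists in every graded connected bialgebra ([antipode_exists]).  A regular
    representation pairs with [psi] to the value of [psi] at the identity
    permutation, so [reg] is a Hopf morphism because both coproducts run over the
    same vertex sets, and it is injective because the number of isomorphisms from
    a graph extracts the coefficient of that graph.

    For part (3), let [fclass n] be the indicator of the stable edgeless sets of
    size [n].  The convolution of the [fclass (m i)] over the variables of a
    monomial [m] is a sum over colorings, and its value is the number of proper
    colorings with color counts [m] that are fixed by the permutation, that is, the
    character of the coloring representation ([fcolor_trace]).  Pairing with it
    gives the coefficient of [m] in the chromatic symmetric function ([XrepE]),
    which is therefore additive, symmetric because convolution is commutative,
    multiplicative because a coloring of a disjoint union is a pair of colorings
    ([fmono_slice]), and comultiplicative because the family of the product of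
    two monomials in disjoint sets of variables is the convolution of their
    families ([fmono_interleave]).  For uniqueness, the coproduct determines the
    coefficient at such a product of monomials from the coefficients at the two
    factors; by symmetry and induction on the number of variables only the powers of [x_0]
    remain, where [zeta] gives the coefficient ([induced_by_unique]).

    For part (4), the coloring character at the identity is the number of
    colorings, and the regular representation contains every irreducible with
    multiplicity equal to its degree. *)

(** * Additive maps, tensor products and modules with a basis *)

Section AdditiveMaps.
Variables (A B : zmodType) (f : A -> B) (fD : additive_map f).

Lemma additive_map0 : f 0 = 0.
Proof. by apply: (addrI (f 0)); rewrite -fD !addr0. Qed.

Lemma additive_mapN x : f (- x) = - f x.
Proof. by apply: (addrI (f x)); rewrite -fD !subrr additive_map0. Qed.

Lemma additive_mapB x y : f (x - y) = f x - f y.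
Proof. by rewrite fD additive_mapN. Qed.

Lemma additive_map_sum (I : Type) (r : seq I) (P : pred I) (F : I -> A) :
  f (\sum_(i <- r | P i) F i) = \sum_(i <- r | P i) f (F i).
Proof. exact: (big_morph f fD additive_map0). Qed.

Lemma additive_mapMn n x : f (x *+ n) = f x *+ n.
Proof. by elim: n => [|n IH]; rewrite ?additive_map0 // !mulrS fD IH. Qed.

Lemma additive_mapMz (z : int) x : f (x *~ z) = f x *~ z.
Proof.
by case: z => n; rewrite ?NegzE ?mulrNz ?additive_mapN -!pmulrn additive_mapMn.
Qed.

End AdditiveMaps.

Lemma gen_subgroup_mem (M : zmodType) (P : M -> Prop) x : P x -> x \in gen_subgroup P.
Proof. by move=> Px; apply/asboolP => S; exact. Qed.

Lemma gen_subgroup_ind (M : zmodType) (P Q : M -> Prop) :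
    (forall x, P x -> Q x) -> Q 0 -> (forall x y, Q x -> Q y -> Q (x - y)) ->
  forall x, x \in gen_subgroup P -> Q x.
Proof.
move=> PQ Q0 QB x /asboolP hx; pose K : {pred M} := fun z => `[< Q z >].
have Kz : zmod_closed K.
  split=> [|u v]; first exact/asboolP.
  by move=> /asboolP Qu /asboolP Qv; apply/asboolP/QB.
pose KS : zmodClosed M :=
  HB.pack_for (zmodClosed M) K (GRing.isZmodClosed.Build M K Kz).
by have /asboolP := hx KS (fun y Py => asboolT (PQ y Py)).
Qed.

Lemma freeg_sum_fgen (T : choiceType) (x : {freeg T / int}) :
  x = \sum_(t <- dom x) fgen t *~ coeff t x.
Proof.
rewrite -[LHS]freeg_sumE /fgen; apply: eq_bigr => t _.
by rewrite freeg_mulz intz.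
Qed.

Lemma flift_sum (T : choiceType) (M : zmodType) (f : T -> M) (x : {freeg T / int}) :
  flift f x = \sum_(t <- dom x) f t *~ coeff t x.
Proof.
rewrite {1}[x]freeg_sum_fgen raddf_sum; apply: eq_bigr => t _.
by rewrite raddfMz /= flift_fgen.
Qed.

Lemma zpi_mem (M : zmodType) (P : M -> Prop) y : P y -> zpi P y = 0.
Proof.
by move=> Py; rewrite -(raddf0 (zpi P)); apply/zpi_eq; rewrite subr0 gen_subgroup_mem.
Qed.

Section Tensor.
Variables A B : zmodType.

Lemma tens_bilinear : bilinear2 (@tens A B).
Proof.
split=> [b a a'|a b b']; apply/eqP; rewrite -subr_eq0 /tens -raddfD -raddfB;
  by apply/eqP/zpi_mem; constructor.
Qed.

Lemma tensor_ind (P : tensor A B -> Prop) :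
    (forall a b, P (tens a b)) -> (forall s t, P s -> P t -> P (s - t)) ->
  forall t, P t.
Proof.
move=> Ptens PB t; have P0 : P 0 by rewrite -(subrr (tens 0 0)); exact: PB.
have PD s u : P s -> P u -> P (s + u).
  by move=> Ps Pu; rewrite -[u]opprK -[- u]sub0r; apply/PB/PB.
have PMz (z : int) s : P s -> P (s *~ z).
  move=> Ps; have PMn n : P (s *+ n) by elim: n => // n; rewrite mulrS; exact: PD.
  by case: z => n; rewrite -?pmulrn // NegzE mulrNz -pmulrn -[- _]sub0r; exact: PB.
rewrite -[t]zreprK [zrepr t]freeg_sum_fgen raddf_sum; apply: big_rec => // -[a b] s _ Ps.
by apply: PD => //; rewrite raddfMz; apply/PMz/Ptens.
Qed.

Lemma tlift_additive (C : zmodType) (f : A -> B -> C) :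
  bilinear2 f -> additive_map (tlift f).
Proof.
move=> [fl fr] s t; rewrite -[s]zreprK -[t]zreprK -raddfD /tlift.
have f0 y : tensor_rel y -> flift (fun p : A * B => f p.1 p.2) y = 0.
  by case=> *; rewrite raddfB raddfD /= !flift_fgen /= ?fl ?fr subrr.
by rewrite !zquot_lift // raddfD.
Qed.

Lemma tensor_additive_eq (C : zmodType) (f g : tensor A B -> C) :
    additive_map f -> additive_map g ->
  (forall a b, f (tens a b) = g (tens a b)) -> f =1 g.
Proof.
move=> fD gD fg; apply: tensor_ind => // s t.
by rewrite (additive_mapB fD) (additive_mapB gD) => -> ->.
Qed.

Lemma tens_additive_l b : additive_map (fun a : A => tens a b : tensor A B).
Proof. exact: (tens_bilinear.1 b). Qed.

Lemma tens_additive_r a : additive_map (fun b : B => tens a b : tensor A B).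
Proof. exact: (tens_bilinear.2 a). Qed.

End Tensor.

Section TensorMaps.
Variables A B C D : zmodType.

Lemma tmap_bilinear (f : A -> B) (g : C -> D) :
  additive_map f -> additive_map g -> bilinear2 (fun a b => tens (f a) (g b)).
Proof.
move=> fD gD; split=> [c a a'|a c c'].
  by rewrite /= fD (tens_bilinear _ _).1.
by rewrite gD (tens_bilinear _ _).2.
Qed.

Lemma tmap_tens (f : A -> B) (g : C -> D) a c :
  additive_map f -> additive_map g -> tmap f g (tens a c) = tens (f a) (g c).
Proof. by move=> fD gD; rewrite /tmap tliftE //; exact: tmap_bilinear. Qed.

Lemma tmap_additive (f : A -> B) (g : C -> D) :
  additive_map f -> additive_map g -> additive_map (tmap f g).
Proof. by move=> fD gD; apply/tlift_additive/tmap_bilinear. Qed.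

Lemma tswap_bilinear : bilinear2 (fun (a : A) (b : B) => tens b a : tensor B A).
Proof.
by split=> [b a a'|a b b'] /=; rewrite ((tens_bilinear _ _).2, (tens_bilinear _ _).1).
Qed.

Lemma tassoc_bilinear_in (c : C) :
  bilinear2 (fun (a : A) (b : B) => tens a (tens b c) : tensor A (tensor B C)).
Proof.
split=> [b a a'|a b b'] /=; rewrite ?(tens_bilinear _ _).1 //.
by rewrite (tens_bilinear _ _).2.
Qed.

Lemma tassoc_bilinear :
  bilinear2 (fun (t : tensor A B) (c : C) =>
    tlift (fun a b => tens a (tens b c)) t : tensor A (tensor B C)).
Proof.
split=> [c|t c c']; first exact/tlift_additive/tassoc_bilinear_in.
move: t; apply: tensor_additive_eq.
- exact/tlift_additive/tassoc_bilinear_in.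
- move=> s t; rewrite !(tlift_additive (tassoc_bilinear_in _)).
  by rewrite addrACA.
move=> a b; rewrite !tliftE ?tassoc_bilinear_in //; try exact: tassoc_bilinear_in.
by rewrite !(tens_bilinear _ _).2.
Qed.

Lemma tassoc_tens a b c :
  tassoc (tens (tens a b) c) = tens a (tens b c) :> tensor A (tensor B C).
Proof.
rewrite /tassoc tliftE; last exact: tassoc_bilinear.
by rewrite tliftE //; exact: tassoc_bilinear_in.
Qed.

Lemma tassoc_additive : additive_map (@tassoc A B C).
Proof. exact/tlift_additive/tassoc_bilinear. Qed.

End TensorMaps.

Section Basis.
Variable K : comNzRingType.
Hypothesis K0 : injective (fun z : int => z%:~R : K).

(** Indices are allowed to repeat basis vectors: the labels of graph
    representations determine a basis vector only up to graph isomorphism, so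
    the coordinate dual to [b i] is indexed by [i] but only depends on [b i]. *)
Definition dual_basis (A : zmodType) (I : Type) (b : I -> A) (c : I -> A -> K) :=
  [/\ forall i, additive_map (c i),
      forall i j, c i (b j) = (b j == b i)%:R
    & forall x, x \in gen_subgroup (fun y => exists i, y = b i)].

(** The element is expanded over distinct basis vectors, since one basis vector may
    have several indices. *)
Lemma dual_basis_eq0 (A : zmodType) I (b : I -> A) c x :
  dual_basis b c -> (forall i, c i x = 0) -> x = 0.
Proof.
move=> [cD cb span] cx0.
pose Q z := exists2 y : {freeg A / int},
  forall a, a \in dom y -> exists i, a = b i & z = flift id y.
have [y yb xE] : Q x.
  apply: (@gen_subgroup_ind _ _ Q _ _ _ x (span x)) => [z [i ->]||z1 z2].
  - exists (fgen (b i)); last by rewrite flift_fgen.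
    by move=> a; rewrite domU1 inE => /eqP ->; exists i.
  - by exists 0; rewrite ?raddf0 // => a; rewrite dom0.
  move=> [y1 y1b ->] [y2 y2b ->]; exists (y1 - y2); last by rewrite raddfB.
  by move=> a /domB; rewrite mem_cat => /orP[/y1b|/y2b].
suff y0 : y = 0 by rewrite xE y0 raddf0.
apply/eqP; rewrite -dom_eq0; apply/eqP.
case E: (dom y) => [|a r] //; have ay : a \in dom y by rewrite E mem_head.
have := cx0; rewrite xE => cy0; have [i ai] := yb a ay.
have := mem_dom y a; rewrite ay; suff -> : coeff a y = 0 by rewrite eqxx.
apply: K0; rewrite /= -[RHS](cy0 i) flift_sum (additive_map_sum (cD i)).
rewrite (bigD1_seq a) ?uniq_dom //= (additive_mapMz (cD i)) {2}ai cb eqxx.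
rewrite big_seq_cond big1 ?addr0 // => a' /andP[a'y /negbTE ne].
have [j a'j] := yb a' a'y.
by rewrite (additive_mapMz (cD i)) a'j cb -a'j -ai ne mul0rz.
Qed.

Lemma mul_bilinear (A B : zmodType) (f : A -> K) (g : B -> K) :
  additive_map f -> additive_map g -> bilinear2 (fun a b => f a * g b).
Proof. by move=> fD gD; split=> [b a a'|a b b'] /=; rewrite ?fD ?gD (mulrDl, mulrDr). Qed.

(** Hence identities in tensor powers can be checked on coordinates. *)
Lemma dual_basis_tensor (A B : zmodType) I J (b : I -> A) (b' : J -> B) c c' :
    dual_basis b c -> dual_basis b' c' ->
  dual_basis (fun p => tens (b p.1) (b' p.2))
             (fun p => tlift (fun x y => c p.1 x * c' p.2 y)).
Proof.
move=> [cD cb span] [cD' cb' span'].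
have bil p := mul_bilinear (cD p.1) (cD' p.2).
have cE i j : tlift (fun x y => c i.1 x * c' i.2 y) (tens (b j.1) (b' j.2))
            = ((b j.1 == b i.1) && (b' j.2 == b' i.2))%:R.
  by rewrite tliftE // cb cb' -natrM mulnb.
split=> [i|i j|t]; first exact: tlift_additive.
  (* Equal pure tensors of basis vectors have equal coordinates, hence equal factors. *)
  rewrite cE; congr (nat_of_bool _)%:R; apply/andP/eqP => [[/eqP-> /eqP->] //|e].
  by apply/andP; move: (cE i j); rewrite e cE !eqxx; case: (X in _ = (nat_of_bool X)%:R -> _) => // h;
     case/eqP: (oner_neq0 K); exact: h.
move: t; apply: tensor_ind => [x y|s t hs ht]; last exact: rpredB.
apply: (@gen_subgroup_ind _ _ (fun x => tens x y \in _) _ _ _ _ (span x)).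
- move=> _ [i ->].
  apply: (@gen_subgroup_ind _ _ (fun y => tens (b i) y \in _) _ _ _ _ (span' y)).
  + by move=> _ [j ->]; apply: gen_subgroup_mem; exists (i, j).
  + by rewrite (additive_map0 (tens_additive_r _)) rpred0.
  by move=> z z' hz hz'; rewrite (additive_mapB (tens_additive_r _)) rpredB.
- by rewrite (additive_map0 (tens_additive_l _)) rpred0.
by move=> z z' hz hz'; rewrite (additive_mapB (tens_additive_l _)) rpredB.
Qed.

End Basis.

(** * The antipode of a graded connected bialgebra *)

Section Antipode.
Variable H : hopf_data.
Hypothesis alg : algebra_axioms H.
Hypothesis coalg : coalgebra_axioms H.
Hypothesis bialg : bialgebra_axioms H.
Hypothesis gr : grading_axioms H.
Hypothesis grS : graded_structure H.
Hypothesis conn : connected_hopf H.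

Definition convolution (f g : H -> H) (x : H) : H :=
  tlift (fun a b => hmul (f a) (g b)) (hcomul x).

Definition unit_counit (x : H) : H := hone *~ hcounit x.

Lemma hmul_bilinear (f g : H -> H) :
  additive_map f -> additive_map g -> bilinear2 (fun a b => hmul (f a) (g b)).
Proof.
case: alg => [[ml mr] _ _ _] fD gD.
by split=> [b a a'|a b b'] /=; rewrite ?fD ?gD ?ml ?mr.
Qed.

Lemma convolution_additive f g :
  additive_map f -> additive_map g -> additive_map (convolution f g).
Proof.
case: coalg => cD _ _ _ _ fD gD x y; rewrite /convolution cD.
exact/tlift_additive/hmul_bilinear.
Qed.

Lemma unit_counit_additive : additive_map unit_counit.
Proof. by case: coalg => _ eD _ _ _ x y; rewrite /unit_counit eD mulrzDr. Qed.

Lemma unit_counit_mul x y : hmul x (unit_counit y) = x *~ hcounit y.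
Proof.
case: alg => [[ml mr] _ _ m1]; rewrite /unit_counit.
by rewrite (additive_mapMz (mr x)) m1.
Qed.

Lemma mul_unit_counit x y : hmul (unit_counit x) y = y *~ hcounit x.
Proof.
case: alg => [[ml mr] _ m1 _]; rewrite /unit_counit.
by rewrite (additive_mapMz (ml y)) m1.
Qed.

Lemma eq_tlift (A B C : zmodType) (f g : A -> B -> C) t :
  f =2 g -> tlift f t = tlift g t.
Proof.
move=> fg; rewrite /tlift; congr (flift _ _).
by apply/funext => -[a b]; rewrite fg.
Qed.

Lemma convolution_unitr f : additive_map f -> convolution f unit_counit =1 f.
Proof.
move=> fD x; case: coalg => _ _ _ _ /(_ x) {2}<-; rewrite /convolution.
rewrite (eq_tlift _ (fun a b => unit_counit_mul (f a) b)).
move: (hcomul x) => t; move: t; have eD := let: And5 _ eD _ _ _ := coalg in eD.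
have bil : bilinear2 (fun a b : H => a *~ hcounit b).
  by split=> [b a a'|a b b'] /=; rewrite ?mulrzDl ?eD ?mulrzDr.
apply: tensor_additive_eq.
- by apply: tlift_additive; split=> [b a a'|a b b'] /=; rewrite ?fD ?mulrzDl ?eD ?mulrzDr.
- by move=> s t; rewrite (tlift_additive bil) fD.
move=> a b; rewrite !tliftE // ?(additive_mapMz fD) //.
by split=> [b' a' a''|a' b' b''] /=; rewrite ?fD ?mulrzDl ?eD ?mulrzDr.
Qed.

Lemma convolution_unitl f : additive_map f -> convolution unit_counit f =1 f.
Proof.
move=> fD x; case: coalg => _ _ _ /(_ x) {2}<- _; rewrite /convolution.
rewrite (eq_tlift _ (fun a b => mul_unit_counit a (f b))).
move: (hcomul x) => t; move: t; have eD := let: And5 _ eD _ _ _ := coalg in eD.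
have bil : bilinear2 (fun a b : H => b *~ hcounit a).
  by split=> [b a a'|a b b'] /=; rewrite ?mulrzDl ?eD ?mulrzDr.
apply: tensor_additive_eq.
- by apply: tlift_additive; split=> [b a a'|a b b'] /=; rewrite ?fD ?mulrzDl ?eD ?mulrzDr.
- by move=> s t; rewrite (tlift_additive bil) fD.
move=> a b; rewrite !tliftE // ?(additive_mapMz fD) //.
by split=> [b' a' a''|a' b' b''] /=; rewrite ?fD ?mulrzDl ?eD ?mulrzDr.
Qed.

Lemma convolution_assoc f g h :
    additive_map f -> additive_map g -> additive_map h ->
  convolution (convolution f g) h =1 convolution f (convolution g h).
Proof.
move=> fD gD hD x.
case: coalg => cD _ cA _ _; have [[ml mr] mA _ _] := alg.
(* Both sides are the value of one trilinear map at a side of coassociativity. *)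
pose T3 (t : tensor H (tensor H H)) : H :=
  tlift (fun a u => hmul (f a) (tlift (fun b c => hmul (g b) (h c)) u)) t.
have bgh := hmul_bilinear gD hD.
have b3 : bilinear2 (fun a u => hmul (f a) (tlift (fun b c => hmul (g b) (h c)) u)).
  split=> [u a a'|a u u'] /=; first by rewrite fD ml.
  by rewrite (tlift_additive bgh) mr.
have eR : convolution f (convolution g h) x = T3 (tmap id (@hcomul H) (hcomul x)).
  rewrite /convolution; move: (hcomul x); apply: tensor_additive_eq.
  - exact/tlift_additive/hmul_bilinear/convolution_additive.
  - move=> s t; rewrite (tmap_additive (fun _ _ => erefl) cD).
    exact: (tlift_additive b3).
  move=> a b; rewrite tmap_tens // /T3 !tliftE //.
  exact/hmul_bilinear/convolution_additive.
have eL : convolution (convolution f g) h x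
        = T3 (tassoc (tmap (@hcomul H) id (hcomul x))).
  rewrite /convolution; move: (hcomul x); apply: tensor_additive_eq.
  - exact/tlift_additive/hmul_bilinear/hD/convolution_additive.
  - move=> s t; rewrite (tmap_additive cD (fun _ _ => erefl)) tassoc_additive.
    exact: (tlift_additive b3).
  move=> a c; rewrite tmap_tens // tliftE; last first.
    exact/hmul_bilinear/hD/convolution_additive.
  rewrite /convolution; move: (hcomul a); apply: tensor_additive_eq.
  - by move=> s t; rewrite (tlift_additive (hmul_bilinear fD gD)) ml.
  - move=> s t; rewrite (tens_bilinear _ _).1 tassoc_additive.
    exact: (tlift_additive b3).
  move=> a' b'; rewrite tliftE; last exact: hmul_bilinear.
  by rewrite tassoc_tens /T3 !tliftE // mA.
by rewrite eL eR cA.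
Qed.

(** With this sign the geometric series for the antipode has no signs. *)
Definition reduced_id (x : H) : H := unit_counit x - x.

Lemma reduced_id_additive : additive_map reduced_id.
Proof. by move=> x y; rewrite /reduced_id unit_counit_additive opprD addrACA. Qed.

Fixpoint conv_power (n : nat) : H -> H :=
  if n is m.+1 then convolution (conv_power m) reduced_id else unit_counit.

Lemma conv_power_additive n : additive_map (conv_power n).
Proof.
elim: n => [|n IH]; first exact: unit_counit_additive.
exact: convolution_additive IH reduced_id_additive.
Qed.

Lemma conv_powerSl n : conv_power n.+1 =1 convolution reduced_id (conv_power n).
Proof.
elim: n => [|n IH] x.
  by rewrite convolution_unitr /= ?convolution_unitl //; exact: reduced_id_additive.
rewrite [conv_power n.+2]/= -[RHS]convolution_assoc;
  try exact: reduced_id_additive; try exact: conv_power_additive.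
by apply: eq_tlift => a b; rewrite -IH.
Qed.

Lemma reduced_id0 x : hgrade 0 x -> reduced_id x = 0.
Proof.
move=> x0; have [z [xz _]] := conn x0; case: bialg => _ _ _ e1.
have eD := let: And5 _ eD _ _ _ := coalg in eD.
rewrite /reduced_id /unit_counit xz (additive_mapMz eD) e1.
by rewrite intz subrr.
Qed.

Lemma homogeneous_comul_ind n x (P : tensor H H -> Prop) : hgrade n x ->
    (forall i j a b, (i + j)%N = n -> hgrade i a -> hgrade j b -> P (tens a b)) ->
    P 0 -> (forall s t, P s -> P t -> P (s - t)) ->
  P (hcomul x).
Proof.
move=> nx Ptens P0 PB; have [_ _ /(_ n x nx) h _] := grS.
by apply: (@gen_subgroup_ind _ _ P _ _ _ _ h) => // t [i j a b]; exact: Ptens.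
Qed.

(** Each factor of the reduced identity uses up at least one degree. *)
Lemma conv_power_eq0 n m x : hgrade m x -> (m < n)%N -> conv_power n x = 0.
Proof.
elim: n m x => // n IH m x mx lt_mn.
have cP := conv_power_additive n; have rP := reduced_id_additive.
rewrite conv_powerSl /convolution.
pattern (hcomul x); refine (homogeneous_comul_ind mx _ _ _) => [i j a b ij ia jb||s t].
- rewrite tliftE; last exact: hmul_bilinear.
  have [[ml mr] _ _ _] := alg.
  case: i ij ia => [_ a0|i ij ia].
    by rewrite reduced_id0 // (additive_map0 (ml _)).
  by rewrite (IH j) ?(additive_map0 (mr _)) // -ltnS (leq_trans _ lt_mn) // -ij ltnS addSn ltnS leq_addl.
- exact/additive_map0/tlift_additive/hmul_bilinear.
move=> hs ht; rewrite (additive_mapB (tlift_additive (hmul_bilinear rP cP))).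
by rewrite hs ht subrr.
Qed.

Definition antipode_sum (n : nat) (x : H) : H := \sum_(i < n) conv_power i x.

Lemma antipode_sum_additive n : additive_map (antipode_sum n).
Proof.
move=> x y; rewrite -big_split; apply: eq_bigr => i _ /=.
by rewrite conv_power_additive.
Qed.

Lemma antipode_sum_stable n m x :
  hgrade m x -> (m < n)%N -> antipode_sum n x = antipode_sum m.+1 x.
Proof.
move=> mx lt_mn; rewrite /antipode_sum -!(big_mkord xpredT (fun i => conv_power i x)).
rewrite (big_cat_nat (leq0n _) lt_mn) /= [X in _ + X]big_nat [X in _ + X]big1 ?addr0 // => i.
by case/andP=> lt_mi _; rewrite (conv_power_eq0 mx).
Qed.

Lemma convolution_subl f f' g x :
    additive_map f -> additive_map f' -> additive_map g ->
  convolution (fun a => f a - f' a) g x = convolution f g x - convolution f' g x.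
Proof.
move=> fD fD' gD; have [[ml mr] _ _ _] := alg.
have ffD : additive_map (fun a => f a - f' a).
  by move=> a b; rewrite fD fD' opprD addrACA.
rewrite /convolution; move: (hcomul x); apply: tensor_additive_eq.
- exact/tlift_additive/hmul_bilinear.
- by move=> s t; rewrite !(tlift_additive (hmul_bilinear _ _)) // opprD addrACA.
move=> a b; rewrite !tliftE; try exact: hmul_bilinear.
exact: (additive_mapB (ml _)).
Qed.

Lemma convolution_subr f f' g x :
    additive_map f -> additive_map f' -> additive_map g ->
  convolution g (fun a => f a - f' a) x = convolution g f x - convolution g f' x.
Proof.
move=> fD fD' gD; have [[ml mr] _ _ _] := alg.
have ffD : additive_map (fun a => f a - f' a).
  by move=> a b; rewrite fD fD' opprD addrACA.
rewrite /convolution; move: (hcomul x); apply: tensor_additive_eq.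
- exact/tlift_additive/hmul_bilinear.
- by move=> s t; rewrite !(tlift_additive (hmul_bilinear _ _)) // opprD addrACA.
move=> a b; rewrite !tliftE; try exact: hmul_bilinear.
exact: (additive_mapB (mr _)).
Qed.

Lemma idE x : x = unit_counit x - reduced_id x.
Proof. by rewrite opprB addrC subrK. Qed.

(** The series telescopes, as [id = unit_counit - reduced_id]. *)
Lemma antipode_sum_convl n x :
  convolution (antipode_sum n) id x = unit_counit x - conv_power n x.
Proof.
have uD := unit_counit_additive; have rD := reduced_id_additive.
have step m : convolution (conv_power m) id x = conv_power m x - conv_power m.+1 x.
  have mD := conv_power_additive m; rewrite -[in RHS](convolution_unitr mD).
  by rewrite -convolution_subr //; apply: eq_tlift => a b; rewrite -idE.
elim: n => [|n IH].
  rewrite subrr /convolution; move: (hcomul x); apply: tensor_additive_eq.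
  - exact/tlift_additive/hmul_bilinear/(fun _ _ => erefl)/antipode_sum_additive.
  - by move=> *; rewrite addr0.
  move=> a b; rewrite tliftE; last first.
    exact/hmul_bilinear/(fun _ _ => erefl)/antipode_sum_additive.
  have [[ml mr] _ _ _] := alg.
  by rewrite /antipode_sum big_ord0 (additive_map0 (ml _)).
have e : convolution (antipode_sum n.+1) id x - convolution (conv_power n) id x
       = convolution (antipode_sum n) id x.
  rewrite -convolution_subl //; try exact: antipode_sum_additive; last exact: conv_power_additive.
  apply: eq_tlift => a b; congr (hmul _ _).
  by rewrite /antipode_sum big_ord_recr /= addrK.
by rewrite -[LHS](subrK (convolution (conv_power n) id x)) e IH step addrA subrK.
Qed.

Lemma antipode_sum_convr n x :
  convolution id (antipode_sum n) x = unit_counit x - conv_power n x.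
Proof.
have uD := unit_counit_additive; have rD := reduced_id_additive.
have step m : convolution id (conv_power m) x = conv_power m x - conv_power m.+1 x.
  have mD := conv_power_additive m; rewrite conv_powerSl -[in RHS](convolution_unitl mD).
  by rewrite -convolution_subl //; apply: eq_tlift => a b; rewrite -idE.
elim: n => [|n IH].
  rewrite subrr /convolution; move: (hcomul x); apply: tensor_additive_eq.
  - exact/tlift_additive/hmul_bilinear/antipode_sum_additive.
  - by move=> *; rewrite addr0.
  move=> a b; rewrite tliftE; last first.
    exact/hmul_bilinear/antipode_sum_additive.
  have [[ml mr] _ _ _] := alg.
  by rewrite /antipode_sum big_ord0 (additive_map0 (mr _)).
have e : convolution id (antipode_sum n.+1) x - convolution id (conv_power n) x
       = convolution id (antipode_sum n) x.
  rewrite -convolution_subr //; try exact: antipode_sum_additive; last exact: conv_power_additive.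
  apply: eq_tlift => a b; congr (hmul _ _).
  by rewrite /antipode_sum big_ord_recr /= addrK.
by rewrite -[LHS](subrK (convolution id (conv_power n) x)) e IH step addrA subrK.
Qed.

Lemma homogeneous_eq (B : zmodType) (f g : H -> B) :
    additive_map f -> additive_map g ->
  (forall n x, hgrade n x -> f x = g x) -> f =1 g.
Proof.
move=> fD gD fg x; case: gr => _ /(_ x)[N [c [cn ->]]] _.
rewrite (additive_map_sum fD) (additive_map_sum gD); apply: eq_bigr => i _.
exact: fg (cn i).
Qed.

(** The convolution inverse of [id = unit_counit - reduced_id] is the geometric series
    in [reduced_id], which is a finite sum on each element. *)
Lemma antipode_exists : exists S, @antipode_axioms H S.
Proof.
(* The degrees of the homogeneous components of [x] bound the number of terms. *)
have cofinal x : exists N, forall n, (N <= n)%N -> antipode_sum n x = antipode_sum N x.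
  case: gr => _ /(_ x)[N [c [cn ->]]] _; exists N => n le_Nn.
  rewrite !(additive_map_sum (antipode_sum_additive _)); apply: eq_bigr => i _.
  by rewrite !(antipode_sum_stable (cn i)) // (leq_trans (ltn_ord i)).
have [N hN] := choice cofinal; pose S x := antipode_sum (N x) x.
have SE n x : (N x <= n)%N -> S x = antipode_sum n x by move=> h; rewrite (hN x n).
have SD : additive_map S.
  move=> x y; set xy := x + y; pose M := (N xy + (N x + N y))%N.
  have lex : (N x <= M)%N by rewrite /M addnCA leq_addr.
  have ley : (N y <= M)%N by rewrite /M addnA leq_addl.
  by rewrite (SE M xy) ?leq_addr // (SE M x) // (SE M y) // antipode_sum_additive.
have Sh n i a : hgrade i a -> (i <= n)%N -> S a = antipode_sum n.+1 a.
  move=> ia le_in; rewrite (SE (N a + n.+1)%N) ?leq_addr //.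
  by rewrite !(antipode_sum_stable ia) // ?ltn_addl.
have [D e] : additive_map (convolution S id) /\ additive_map (convolution id S).
  by split; exact: convolution_additive.
exists S; split=> //.
  apply: (homogeneous_eq D unit_counit_additive) => n x nx.
  transitivity (convolution (antipode_sum n.+1) id x); last first.
    by rewrite antipode_sum_convl (conv_power_eq0 nx) ?subr0.
  have b1 : bilinear2 (fun a b => hmul (S a) (id b)) by exact: hmul_bilinear.
  have b2 : bilinear2 (fun a b => hmul (antipode_sum n.+1 a) (id b)).
    exact/hmul_bilinear/(fun _ _ => erefl)/antipode_sum_additive.
  rewrite /convolution; pattern (hcomul x); refine (homogeneous_comul_ind nx _ _ _).
  - by move=> i j a b ij ia jb; rewrite !tliftE // (Sh n i) // -ij leq_addr.
  - by rewrite !(additive_map0 (tlift_additive _)).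
  by move=> s t hs ht; rewrite !(additive_mapB (tlift_additive _)) // hs ht.
apply: (homogeneous_eq e unit_counit_additive) => n x nx.
transitivity (convolution id (antipode_sum n.+1) x); last first.
  by rewrite antipode_sum_convr (conv_power_eq0 nx) ?subr0.
have b1 : bilinear2 (fun a b => hmul (id a) (S b)) by exact: hmul_bilinear.
have b2 : bilinear2 (fun a b => hmul (id a) (antipode_sum n.+1 b)).
  exact/hmul_bilinear/antipode_sum_additive.
rewrite /convolution; pattern (hcomul x); refine (homogeneous_comul_ind nx _ _ _).
- by move=> i j a b ij ia jb; rewrite !tliftE // (Sh n j) // -ij leq_addl.
- by rewrite !(additive_map0 (tlift_additive _)).
by move=> s t hs ht; rewrite !(additive_mapB (tlift_additive _)) // hs ht.
Qed.

End Antipode.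

(** * Characters of finite groups over an algebraically closed field *)

Lemma mxtrace_lin_mul (k : fieldType) m n (A : 'M[k]_m) (B : 'M[k]_n) :
  \tr (lin_mulmx A *m lin_mulmxr B) = \tr A * \tr B.
Proof.
rewrite /mxtrace (reindex _ (curry_mxvec_bij _ _)) /= big_distrlr /=.
rewrite pair_bigA; apply: eq_bigr => -[i j] _ /=.
have -> (M : 'M[k]_(m * n)) a : M a a = ((delta_mx 0 a : 'rV_(m * n)) *m M) 0 a.
  by rewrite -rowE mxE.
rewrite mulmxA -mxvec_delta !mul_vec_lin mxvecE /=.
by rewrite -(mul_delta_mx (0 : 'I_1)) mulmxA -colE -mulmxA -rowE !mxE big_ord1 !mxE.
Qed.

Section Trace.
Variables (k : fieldType) (n : nat).

Lemma idempotent_factor (P : 'M[k]_n) m (U : 'M_(m, n)) :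
    (P :=: U)%MS -> P *m P = P ->
  exists2 C, P = C *m row_base U & row_base U *m C = 1%:M.
Proof.
move=> PU PP; have sPB : (P <= row_base U)%MS by rewrite eq_row_base PU.
exists (P *m pinvmx (row_base U)); first by rewrite mulmxKpV.
have : (row_base U <= P)%MS by rewrite eq_row_base PU.
case/submxP => D e; apply: (row_free_inj (row_base_free U)).
by rewrite mul1mx -mulmxA mulmxKpV // {1}e -mulmxA PP -e.
Qed.

Lemma mxtrace_idempotent (P : 'M[k]_n) m (U : 'M_(m, n)) :
  (P :=: U)%MS -> P *m P = P -> \tr P = (\rank U)%:R.
Proof.
by move=> PU PP; have [C -> BC] := idempotent_factor PU PP; rewrite mxtrace_mulC BC mxtrace1.
Qed.

Lemma mxtrace_submod (gT : finGroupType) (G : {group gT})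
    (rG : mx_representation k G n) (U : 'M_n) (modU : mxmodule rG U) P x :
    (P :=: U)%MS -> P *m P = P -> x \in G ->
  \tr (submod_repr modU x) = \tr (P *m rG x).
Proof.
move=> PU PP Gx; have [C -> BC] := idempotent_factor PU PP.
have e : row_base U *m rG x = submod_repr modU x *m row_base U.
  rewrite -[RHS]/(val_submod (submod_repr modU x)) -[submod_repr modU x]mul1mx.
  by rewrite val_submodJ // /val_submod /= mul1mx.
move: e; rewrite -mulmxA; move: (submod_repr _ _) => S ->.
by rewrite mxtrace_mulC -mulmxA BC mulmx1.
Qed.

End Trace.

Section HomSpace.
Variables (k : fieldType) (gT : finGroupType) (G : {group gT}) (m n : nat).
Variables (rV : mx_representation k G m) (rW : mx_representation k G n).
Hypothesis G0 : (#|G|%:R : k) != 0.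

Definition hom_space : 'M[k]_(m * n) :=
  (\bigcap_(g in G) kermx (lin_mulmx (rV g) - lin_mulmxr (rW g)))%MS.

Lemma hom_spaceP (u : 'rV[k]_(m * n)) :
  reflect (forall g, g \in G -> rV g *m vec_mx u = vec_mx u *m rW g) (u <= hom_space)%MS.
Proof.
apply: (iffP sub_bigcapmxP) => hu g Gg; have := hu g Gg.
  move/sub_kermxP; rewrite mulmxBr !mul_rV_lin /= => /eqP.
  by rewrite subr_eq0 => /eqP /(can_inj mxvecK).
by move=> e; apply/sub_kermxP; rewrite mulmxBr !mul_rV_lin /= e subrr.
Qed.

(** Averaging over the group projects onto [hom_space], so the dimension of
    [hom_space] is the trace of this matrix. *)
Definition hom_proj : 'M[k]_(m * n) :=
  #|G|%:R^-1 *: \sum_(g in G) lin_mulmx (rV g^-1%g) *m lin_mulmxr (rW g).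

Lemma hom_projE (u : 'rV[k]_(m * n)) : vec_mx (u *m hom_proj)
  = #|G|%:R^-1 *: \sum_(g in G) rV g^-1%g *m vec_mx u *m rW g.
Proof.
rewrite -scalemxAr linearZ mulmx_sumr linear_sum /=; congr (_ *: _).
by apply: eq_bigr => g _; rewrite mulmxA !mul_rV_lin /= !mxvecK.
Qed.

Lemma hom_proj_id (u : 'rV[k]_(m * n)) : (u <= hom_space)%MS -> u *m hom_proj = u.
Proof.
move/hom_spaceP => hu; apply: (can_inj vec_mxK); rewrite hom_projE.
rewrite (eq_bigr (fun _ => vec_mx u)) => [|g Gg]; last first.
  by rewrite -mulmxA -hu // mulmxA -repr_mxM ?groupV // mulVg repr_mx1 mul1mx.
by rewrite sumr_const -scaler_nat scalerA mulVf // scale1r.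
Qed.

Lemma hom_proj_sub (u : 'rV[k]_(m * n)) : (u *m hom_proj <= hom_space)%MS.
Proof.
apply/hom_spaceP => g Gg; rewrite hom_projE -scalemxAl -scalemxAr; congr (_ *: _).
rewrite mulmx_sumr mulmx_suml (reindex_inj (mulIg g)) /=.
apply: eq_big => [x|x]; rewrite groupMr // => Gx.
rewrite !mulmxA -repr_mxM ?groupV ?groupM // invMg mulKVg.
by rewrite repr_mxM // mulmxA.
Qed.

Lemma hom_proj_eqmx : (hom_proj :=: hom_space)%MS.
Proof.
apply/eqmxP/andP; split; apply/row_subP => i.
  by rewrite rowE; exact: hom_proj_sub.
by rewrite -(hom_proj_id (row_sub i _)) submxMl.
Qed.

Lemma hom_proj_idem : hom_proj *m hom_proj = hom_proj.
Proof.
apply/row_matrixP => i; rewrite row_mul hom_proj_id //.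
by rewrite rowE hom_proj_sub.
Qed.

Lemma mxtrace_hom_proj :
  \tr hom_proj = #|G|%:R^-1 * \sum_(g in G) \tr (rV g^-1%g) * \tr (rW g).
Proof.
rewrite linearZ /= raddf_sum /=; congr (_ * _).
by apply: eq_bigr => g _; rewrite mxtrace_lin_mul.
Qed.

Lemma rank_hom_space :
  (\rank hom_space)%:R = #|G|%:R^-1 * \sum_(g in G) \tr (rV g^-1%g) * \tr (rW g).
Proof. by rewrite -mxtrace_hom_proj (mxtrace_idempotent hom_proj_eqmx hom_proj_idem). Qed.

End HomSpace.

Section Characters.
Variable k : closedFieldType.
Hypothesis char0 : [pchar k] =i pred0.

Lemma natr_neq0 n : (n%:R == 0 :> k) = (n == 0)%N.
Proof. by move/pcharf0P: char0 => ->. Qed.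

Lemma cardG_neq0 (gT : finGroupType) (G : {group gT}) : (#|G|%:R : k) != 0.
Proof. by rewrite natr_neq0 -lt0n cardG_gt0. Qed.

Lemma pchar'_group (gT : finGroupType) (G : {group gT}) : [pchar k]^'.-group%g G.
Proof. by rewrite /pgroup /pnat cardG_gt0; apply/allP => p _; rewrite inE /= char0. Qed.

Lemma intr_inj_char0 : injective (fun z : int => z%:~R : k).
Proof.
have z0 (z : int) : z%:~R = 0 :> k -> z = 0.
  by case: z => n; rewrite ?NegzE ?mulrNz ?oppr0 -?pmulrn => /eqP;
     rewrite ?oppr_eq0 natr_neq0 // => /eqP ->.
by move=> x y /eqP; rewrite -subr_eq0 -mulrzBr => /eqP/z0/eqP; rewrite subr_eq0 => /eqP.
Qed.

Section OneGroup.
Variables (gT : finGroupType) (G : {group gT}).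

(** The inner product of characters; inversion in the group replaces complex
    conjugation, which is not available over [k]. *)
Definition cfdot (phi psi : gT -> k) : k :=
  #|G|%:R^-1 * \sum_(g in G) phi g^-1%g * psi g.

Lemma dim_Hom_cfdot m n (rV : mx_representation k G m) (rW : mx_representation k G n) :
  (dim_Hom rV rW)%:R = cfdot (fun g => \tr (rV g)) (fun g => \tr (rW g)).
Proof. exact: (rank_hom_space rV rW (cardG_neq0 G)). Qed.

(** Schur's lemma: the kernel and the image of a map between irreducibles are
    submodules, and over an algebraically closed field the commutant is scalar. *)
Lemma dim_Hom_irr (i j : Irr k G) : dim_Hom (irr_repr i) (irr_repr j) = (i == j).
Proof.
have [simi simj] := (socle_irr i, socle_irr j).
rewrite /dim_Hom -/(hom_space _ _); have [<-|neq_ij] := eqVneq i j; last first.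
  apply/eqP; rewrite mxrank_eq0 -submx0; apply/rV_subP => u /hom_spaceP.
  rewrite submx0 -[u == 0](inj_eq (can_inj (@vec_mxK _ _ _))) linear0 => homM.
  apply: contraNT neq_ij => nzM; set M := vec_mx u in homM nzM.
  have freeM : row_free M.
    rewrite -kermx_eq0; apply: contraNT nzM => nz_ker.
    have [_ /(_ (kermx M)) full] := (mx_irrP _).1 simi.
    suff : row_full (kermx M).
      by rewrite -sub1mx => /sub_kermxP; rewrite mul1mx => ->.
    apply: full => //; apply/mxmoduleP => g Gg; apply/sub_kermxP.
    by rewrite -mulmxA homM // mulmxA mulmx_ker mul0mx.
  have fullM : row_full M.
    have [_ /(_ <<M>>%MS) full] := (mx_irrP _).1 simj.
    suff : row_full <<M>>%MS by rewrite -!sub1mx genmxE.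
    apply: full; last by rewrite -submx0 genmxE submx0.
    by apply/mxmoduleP => g Gg; rewrite (eqmxMr _ (genmxE M)) genmxE -homM // submxMl.
  have eq_n : irr_degree i = irr_degree j.
    exact: etrans (esym (eqP freeM)) (eqP fullM).
  by rewrite -[i](irr_reprK (pchar'_group G)) -[j](irr_reprK (pchar'_group G));
     apply/eqP/(irr_comp_rsim _ (pchar'_group G))/(MxReprSim eq_n freeM).
have [_ nz1 _] := simi.
have e : (mxvec 1%:M <= hom_space (irr_repr i) (irr_repr i))%MS.
  by apply/hom_spaceP => g Gg; rewrite mxvecK mulmx1 mul1mx.
have rk1 : \rank (mxvec (1%:M : 'M[k]_(irr_degree i))) = 1%N.
  apply/eqP; rewrite eqn_leq rank_leq_row lt0n mxrank_eq0 mxvec_eq0.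
  by rewrite -mxrank_eq0 mxrank1 -lt0n irr_degree_gt0.
apply: etrans rk1; apply/eqmx_rank/andP; split=> //; apply/rV_subP => u /hom_spaceP homM.
have /mx_abs_irr_cent_scalar : mx_absolutely_irreducible (irr_repr i).
  exact: group_closure_closed_field.
move=> /(_ (vec_mx u)) h; have /is_scalar_mxP[a ea] : is_scalar_mx (vec_mx u).
  by apply: h; apply/centgmxP => g Gg; rewrite homM.
by rewrite -[u]vec_mxK ea -[a%:M]scalemx1 linearZ /= scalemx_sub.
Qed.

Lemma cfdot_irr (i j : Irr k G) :
  cfdot (fun g => \tr (irr_repr i g)) (fun g => \tr (irr_repr j g)) = (i == j)%:R.
Proof. by rewrite -dim_Hom_cfdot dim_Hom_irr. Qed.

Lemma cfdot_sumr (phi : gT -> k) (I : finType) (P : pred I) (psi : I -> gT -> k) :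
  cfdot phi (fun g => \sum_(i | P i) psi i g) = \sum_(i | P i) cfdot phi (psi i).
Proof.
rewrite /cfdot -mulr_sumr exchange_big /=; congr (_ * _); apply: eq_bigr => g _.
by rewrite mulr_sumr.
Qed.

Lemma cfdotZr (phi psi : gT -> k) a : cfdot phi (fun g => a * psi g) = a * cfdot phi psi.
Proof.
rewrite /cfdot [RHS]mulrCA; congr (_ * _); rewrite mulr_sumr.
by apply: eq_bigr => g _; rewrite mulrCA.
Qed.

Lemma eq_cfdot (phi phi' psi psi' : gT -> k) :
  {in G, phi =1 phi'} -> {in G, psi =1 psi'} -> cfdot phi psi = cfdot phi' psi'.
Proof.
move=> e e'; congr (_ * _); apply: eq_bigr => g Gg.
by rewrite e ?groupV // e'.
Qed.

Lemma mxtrace_multiplicity n (r : mx_representation k G n) g : g \in G ->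
  \tr (r g) = \sum_(i : Irr k G) (multiplicity r i)%:R * \tr (irr_repr i g).
Proof.
move=> Gg; pose sG := DecSocleType r.
have soc1 : (Socle sG :=: 1%:M)%MS.
  by rewrite reducible_Socle1 //; exact/mx_Maschke/pchar'_group.
rewrite -(mxtrace_submod1 (Socle_module sG) soc1) // mxtrace_Socle //.
rewrite (partition_big (fun W => irr_comp (Irr k G) (socle_repr W)) xpredT) //=.
apply: eq_bigr => i _; rewrite natr_sum mulr_suml.
apply: eq_bigr => W /eqP <-; rewrite mulr_natl; congr (_ *+ _).
by apply: mxtrace_rsim Gg; apply: (rsim_irr_comp _ (pchar'_group G)); exact: socle_irr.
Qed.

Lemma multiplicity_cfdot n (r : mx_representation k G n) i :
  (multiplicity r i)%:R = cfdot (fun g => \tr (irr_repr i g)) (fun g => \tr (r g)).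
Proof.
rewrite (eq_cfdot (fun _ _ => erefl _) (mxtrace_multiplicity r)) cfdot_sumr (bigD1 i) //=.
rewrite cfdotZr cfdot_irr eqxx mulr1 big1 ?addr0 // => j /negbTE ne.
by rewrite cfdotZr cfdot_irr eq_sym ne mulr0.
Qed.

Lemma natr_inj : injective (fun n : nat => n%:R : k).
Proof. by move=> m n e; have [] : Posz m = Posz n by apply: intr_inj_char0. Qed.

Lemma eq_multiplicity m n (r : mx_representation k G m) (r' : mx_representation k G n) :
  {in G, forall g, \tr (r g) = \tr (r' g)} -> multiplicity r =1 multiplicity r'.
Proof.
move=> e i; apply: natr_inj; rewrite /= !multiplicity_cfdot.
by apply: eq_cfdot => // g Gg; exact: e.
Qed.

Lemma irr_comp_trace n (r : mx_representation k G n) g :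
  mx_irreducible r -> g \in G -> \tr (irr_repr (irr_comp (Irr k G) r) g) = \tr (r g).
Proof.
move=> irr_r Gg.
by rewrite -(mxtrace_rsim (rsim_irr_comp (Irr k G) (pchar'_group G) irr_r) Gg).
Qed.

(** The commutant is one-dimensional.  By Maschke's theorem a submodule is the image
    of a projection in the commutant, which is then a scalar. *)
Lemma cfdot1_irr n (r : mx_representation k G n) :
  cfdot (fun g => \tr (r g)) (fun g => \tr (r g)) = 1 -> mx_irreducible r.
Proof.
rewrite -dim_Hom_cfdot => /(@natr_inj _ 1%N); rewrite /dim_Hom -/(hom_space _ _) => rk1.
have n_gt0 : (0 < n)%N.
  rewrite lt0n; apply/eqP => n0; have := rank_leq_col (hom_space r r).
  by rewrite rk1 {1}n0.
have e1 : (mxvec 1%:M <= hom_space r r)%MS.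
  by apply/hom_spaceP => g Gg; rewrite mxvecK mulmx1 mul1mx.
have E1 : (hom_space r r <= mxvec 1%:M)%MS.
  rewrite -(mxrank_leqif_sup e1) rk1 eqn_leq rank_leq_row lt0n mxrank_eq0 mxvec_eq0.
  by rewrite -mxrank_eq0 mxrank1 -lt0n.
apply/mx_irrP; split=> // U modU nzU.
have [V modV UV] := mx_Maschke r (pchar'_group G) modU (submx1 U).
move=> /mxdirect_addsP dxUV; pose p := proj_mx U V.
have : (mxvec p <= hom_space r r)%MS.
  apply/hom_spaceP => g Gg; rewrite mxvecK.
  have homp : (1%:M <= dom_hom_mx r p)%MS by rewrite -UV proj_mx_hom.
  by have /hom_mxP/(_ g Gg) := homp; rewrite !mul1mx.
move=> /submx_trans/(_ E1)/sub_rVP[a]; rewrite -linearZ => /(can_inj mxvecK) pa.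
have Up : U *m p = U by exact: proj_mx_id.
have nza : a != 0.
  by apply: contraNneq nzU => a0; rewrite -Up pa a0 scale0r mulmx0.
rewrite -sub1mx -(eqmx_scale 1%:M nza) -pa -[p]mul1mx.
exact: proj_mx_sub.
Qed.

Lemma mxtrace_regular g : g \in G ->
  \tr (regular_repr k G g) = (if g == 1%g then #|G|%:R else 0).
Proof.
move=> Gg; have [->|ne] := eqVneq; first by rewrite repr_mx1 mxtrace1.
rewrite /mxtrace big1 // => i _; rewrite !mxE /= -(inj_eq enum_val_inj).
by rewrite gring_indexK ?groupM ?enum_valP // -{1}[enum_val i]mulg1
  (inj_eq (mulgI _)) eq_sym (negbTE ne).
Qed.

End OneGroup.

Section Box.
Variables (aT bT : finGroupType) (A : {group aT}) (B : {group bT}).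

Lemma card_setX : #|setX A B| = (#|A| * #|B|)%N.
Proof. by rewrite cardsX. Qed.

Lemma mxtrace_box m n (rA : mx_representation k A m) (rB : mx_representation k B n) x :
  \tr (box_repr rA rB x) = \tr (rA x.1) * \tr (rB x.2).
Proof. by rewrite /= mxtrace_prod. Qed.

Lemma sum_setX (F : aT -> bT -> k) :
  \sum_(x in setX A B) F x.1 x.2 = \sum_(a in A) \sum_(b in B) F a b.
Proof. by rewrite pair_big /=; apply: eq_bigl => -[a b]; rewrite inE. Qed.

Lemma cfdot_setX (phi psi : aT -> k) (phi' psi' : bT -> k) :
  cfdot (setX A B) (fun x => phi x.1 * phi' x.2) (fun x => psi x.1 * psi' x.2)
  = cfdot A phi psi * cfdot B phi' psi'.
Proof.
rewrite /cfdot card_setX natrM invfM mulrACA; congr (_ * _).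
rewrite (sum_setX (fun a b => phi a^-1%g * phi' b^-1%g * (psi a * psi' b))).
rewrite big_distrlr /=; apply: eq_bigr => a _; apply: eq_bigr => b _.
by rewrite mulrACA.
Qed.

(** The norm of an outer product is the product of the norms. *)
Lemma box_irr (i : Irr k A) (j : Irr k B) :
  mx_irreducible (box_repr (irr_repr i) (irr_repr j)).
Proof.
apply: cfdot1_irr.
rewrite (eq_cfdot (phi' := fun x => \tr (irr_repr i x.1) * \tr (irr_repr j x.2))
  (psi' := fun x => \tr (irr_repr i x.1) * \tr (irr_repr j x.2))).
- rewrite (cfdot_setX (fun a => \tr (irr_repr i a)) (fun a => \tr (irr_repr i a))
    (fun b => \tr (irr_repr j b)) (fun b => \tr (irr_repr j b))).
  by rewrite !cfdot_irr !eqxx mulr1.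
- by move=> x _; rewrite mxtrace_box.
by move=> x _; rewrite mxtrace_box.
Qed.

End Box.
End Characters.

(** * Representations of product groups and induction *)

Section BoxSplit.
Variable k : closedFieldType.
Hypothesis char0 : [pchar k] =i pred0.
Variables (aT bT : finGroupType) (A : {group aT}) (B : {group bT}).

Definition box_comp (p : Irr k A * Irr k B) : Irr k (setX A B) :=
  irr_comp (Irr k (setX A B)) (box_repr (irr_repr p.1) (irr_repr p.2)).

Lemma mxtrace_box_comp p x : x \in setX A B ->
  \tr (irr_repr (box_comp p) x) = \tr (irr_repr p.1 x.1) * \tr (irr_repr p.2 x.2).
Proof. by move=> ABx; rewrite irr_comp_trace ?mxtrace_box //; exact: box_irr. Qed.

Lemma box_comp_inj : injective box_comp.
Proof.
move=> [i j] [i' j'] e; apply/eqP.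
have : cfdot (setX A B) (fun x => \tr (irr_repr i x.1) * \tr (irr_repr j x.2))
    (fun x => \tr (irr_repr i' x.1) * \tr (irr_repr j' x.2)) = 1 :> k.
  rewrite -[RHS]/(true%:R) -(eqxx (box_comp (i, j))) {2}e -(cfdot_irr char0).
  by apply: eq_cfdot => x ABx; rewrite mxtrace_box_comp ?groupV.
rewrite (cfdot_setX A B (fun a => \tr (irr_repr i a)) (fun a => \tr (irr_repr i' a))
  (fun a => \tr (irr_repr j a)) (fun a => \tr (irr_repr j' a))).
rewrite !cfdot_irr // -natrM mulnb => h; rewrite xpair_eqE.
by case: (_ && _) h => // h; case/eqP: (oner_neq0 k); exact: esym h.
Qed.

(** The squares of the degrees of the products already add up to the order of
    the product group, so nothing is left for further irreducibles. *)
Lemma box_comp_surj : box_comp @: [set: Irr k A * Irr k B] = [set: Irr k (setX A B)].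
Proof.
have split (gT : finGroupType) (K : {group gT}) : group_splitting_field k K.
  exact: group_closure_closed_field.
have degE p : irr_degree (box_comp p) = (irr_degree p.1 * irr_degree p.2)%N.
  by have [->] := mxrank_rsim (rsim_irr_comp (Irr k _) (pchar'_group char0 _) (box_irr char0 p.1 p.2)).
have := sum_irr_degree (Irr k (setX A B)) (pchar'_group char0 _) (@split _ _).
rewrite card_setX -(sum_irr_degree (Irr k A) (pchar'_group char0 _) (@split _ _)).
rewrite -(sum_irr_degree (Irr k B) (pchar'_group char0 _) (@split _ _)).
rewrite big_distrlr pair_bigA /= => sumE.
apply/setP => l; rewrite inE; apply/idPn => nl; move: sumE.
rewrite (bigID (mem (box_comp @: setT))) /= big_imset /=; last by move=> p q _ _; exact: box_comp_inj.
rewrite [X in (X + _)%N = _](eq_big xpredT (fun p => irr_degree p.1 ^ 2 * irr_degree p.2 ^ 2)%N).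
- move/eqP; rewrite -[X in _ == X]addn0 eqn_add2l (bigD1 l) //= addn_eq0 expn_eq0.
  by rewrite eqn0Ngt irr_degree_gt0.
- by move=> p; rewrite inE.
by move=> p _; rewrite degE expnMn.
Qed.

Lemma mxtrace_box_split n (r : mx_representation k (setX A B) n) x : x \in setX A B ->
  \tr (r x) = \sum_i \sum_j (multiplicity r (box_comp (i, j)))%:R
                 * (\tr (irr_repr i x.1) * \tr (irr_repr j x.2)).
Proof.
move=> ABx; rewrite (mxtrace_multiplicity char0) //.
rewrite (eq_bigl _ _ (fun l : Irr k (setX A B) => esym (in_setT l))).
rewrite -box_comp_surj (big_imset _ (in2W box_comp_inj)) /=.
rewrite (eq_bigl _ _ (fun p : Irr k A * Irr k B => in_setT p)).
by rewrite pair_bigA; apply: eq_bigr => -[i j] _ /=; rewrite mxtrace_box_comp.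
Qed.

End BoxSplit.

Section Induced.
Variable k : closedFieldType.
Hypothesis char0 : [pchar k] =i pred0.
Variables (aT rT : finGroupType) (H : {group aT}) (G : {group rT}).
Variables (f : aT -> rT) (n : nat) (rH : mx_representation k H n).
Hypothesis fG : forall h, h \in H -> f h \in G.
Hypothesis fM : {in H &, {morph f : x y / (x * y)%g}}.

Lemma rtrans_mxM x y : x \in G -> y \in G ->
  rtrans_mx k G (x * y)%g = rtrans_mx k G x *m rtrans_mx k G y.
Proof.
move=> Gx Gy; apply/matrixP => i j; rewrite !mxE.
have Gix : (enum_val i * x)%g \in G by rewrite groupM ?enum_valP.
rewrite (bigD1 (enum_rank_in Gix (enum_val i * x)%g)) //= !mxE.
rewrite enum_rankK_in // eqxx mul1r mulgA big1 ?addr0 // => l ne_l.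
rewrite !mxE; case: eqP => [el|_]; last by rewrite mul0r.
by case/eqP: ne_l; apply: enum_val_inj; rewrite enum_rankK_in.
Qed.

Lemma rtrans_pullback_repr : mx_repr H (fun h => rtrans_mx k G (f h)).
Proof.
have f1 : f 1%g = 1%g by apply: (mulgI (f 1%g)); rewrite -fM ?mulg1.
split=> [|x y Hx Hy]; last by rewrite fM // rtrans_mxM ?fG.
rewrite f1; apply/matrixP => i j; rewrite !mxE mulg1 (inj_eq enum_val_inj).
by rewrite eq_sym.
Qed.

Lemma mxtrace_ltrans_rtrans x y : x \in G ->
  \tr (ltrans_mx k G x *m rtrans_mx k G y) = \sum_(g in G) (g == x * g * y)%g%:R.
Proof.
move=> Gx; rewrite /mxtrace [RHS]big_enum_val; apply: eq_bigr => i _; rewrite mxE.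
have Gxi : (x * enum_val i)%g \in G by rewrite groupM ?enum_valP.
rewrite (bigD1 (enum_rank_in Gxi (x * enum_val i)%g)) //= !mxE.
rewrite enum_rankK_in // eqxx mul1r big1 ?addr0 // => l ne_l.
rewrite !mxE; case: eqP => [el|_]; last by rewrite mul0r.
by case/eqP: ne_l; apply: enum_val_inj; rewrite enum_rankK_in.
Qed.

(** The space of the induced representation is the space of [H]-equivariant
    functions on [G], a [hom_space]; the trace of [x] on it is the trace of [x] on all
    functions composed with the averaging projection. *)
Lemma mxtrace_ind x : x \in G ->
  \tr (ind_repr G f rH x)
  = #|H|%:R^-1 * \sum_(h in H) \sum_(g in G | (g * f h == x * g)%g) \tr (rH h).
Proof.
move=> Gx; pose rV := MxRepresentation rtrans_pullback_repr.
have H0 := cardG_neq0 char0 H.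
have PU : (hom_proj rV rH :=: equivariant_mx G f rH)%MS := hom_proj_eqmx rV rH H0.
rewrite (mxtrace_submod (equivariant_module G f rH) PU (hom_proj_idem rV rH H0) Gx).
rewrite -scalemxAl linearZ mulmx_suml; congr (_ * _); rewrite raddf_sum.
apply: eq_bigr => h Hh; rewrite -[LHS]/(\tr _) [rV _]/= [ltrans_repr _ _ _ _]/=.
have -> : lin_mulmx (rtrans_mx k G (f h^-1%g)) *m lin_mulmxr (rH h)
    *m lin_mulmx (ltrans_mx k G x)
  = lin_mulmx (ltrans_mx k G x *m rtrans_mx k G (f h^-1%g)) *m lin_mulmxr (rH h).
  apply/row_matrixP => i; rewrite !rowE !mulmxA !mul_rV_lin /= !mxvecK.
  by rewrite !mulmxA.
rewrite mxtrace_lin_mul mxtrace_ltrans_rtrans // mulr_suml big_mkcondr /=.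
apply: eq_bigr => g _; have -> : f h^-1%g = (f h)^-1%g.
  by apply: (mulgI (f h)); rewrite -fM ?groupV // !mulgV; apply: (mulgI (f 1%g));
     rewrite -fM ?mulg1.
rewrite -(inj_eq (mulIg (f h))) mulgKV; case: eqP; rewrite ?mul1r ?mul0r //.
Qed.
End Induced.

(** * Natural families and their convolution *)

Lemma big_set_interval (R : nmodType) (V : finType) (S T : {set V}) (F : {set V} -> R) :
    S \subset T ->
  \sum_(Q : {set V} | (Q \subset T) && (S \subset Q)) F Q
  = \sum_(U : {set V} | U \subset T :\: S) F (S :|: U).
Proof.
move=> sST; rewrite (reindex_onto (fun U => S :|: U) (fun Q => Q :\: S)) /=; last first.
  by move=> Q /andP[_ sSQ]; rewrite -{1}(setIidPr sSQ) setID.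
apply: eq_bigl => U; rewrite subUset sST subsetUl andbT /= setDUl setDv set0U.
by rewrite subsetD (sameP eqP setDidPl).
Qed.

Section Families.
Variable k : closedFieldType.

(** A family assigns a scalar to a set [T] of vertices, relative to a set of
    edges and a permutation of the ambient vertex set.  Working with subsets of
    a fixed vertex set, instead of with induced subgraphs, makes the convolution
    strictly associative. *)
Definition family := forall V : finType, {set {set V}} -> {perm V} -> {set V} -> k.

Implicit Types f g h psi : family.

Lemma familyP f g : (forall V E t T, f V E t T = g V E t T) -> f = g.
Proof.
move=> e; apply: functional_extensionality_dep => V; apply/funext => E.
by apply/funext => t; apply/funext => T.
Qed.

Definition fconv f g : family := fun V E t T =>
  \sum_(S : {set V} | S \subset T) f V E t S * g V E t (T :\: S).

Definition fone : family := fun V E t T => (T == set0)%:R.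

Lemma fconvC : commutative fconv.
Proof.
move=> f g; apply: familyP => V E t T; rewrite /fconv.
rewrite (reindex_onto (fun S => T :\: S) (fun S => T :\: S)) /=; last first.
  by move=> S sST; rewrite setDDr setDv set0U; apply/setIidPr.
apply: eq_big => [S|S /andP[_ /eqP ->]]; last by rewrite mulrC.
by rewrite subsetDl setDDr setDv set0U; apply/eqP/idP => /setIidPr.
Qed.

(** Both sides are sums over the ordered partitions of [T] into three sets. *)
Lemma fconvA : associative fconv.
Proof.
move=> f g h; apply: familyP => V E t T; rewrite /fconv.
rewrite [RHS](eq_bigr (fun Q : {set V} => \sum_(S : {set V} | S \subset Q)
    f V E t S * g V E t (Q :\: S) * h V E t (T :\: Q))); last first.
  by move=> Q _; rewrite mulr_suml.
rewrite [RHS](exchange_big_dep (fun S : {set V} => S \subset T)) /=; last first.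
  by move=> Q S sQT /subset_trans->.
apply: eq_bigr => S sST; rewrite mulr_sumr.
rewrite big_set_interval //; apply: eq_bigr => R; rewrite subsetD => /andP[_ dRS].
by rewrite -mulrA setDUl setDv set0U setDDl (setDidPl dRS).
Qed.

Lemma fconv1 : left_id fone fconv.
Proof.
move=> f; apply: familyP => V E t T; rewrite /fconv /fone.
rewrite (bigD1 set0) ?sub0set //= eqxx mul1r setD0 big1 ?addr0 // => S /andP[_ /negbTE ->].
by rewrite mul0r.
Qed.

HB.instance Definition _ := Monoid.isComLaw.Build family fone fconv fconvA fconvC fconv1.

(** Transport along an injection covers both the isomorphisms of graphs and the
    passage to an induced subgraph. *)
Definition natural psi := 
  (forall V E t T, psi V E t T != 0 -> t @: T = T) /\
  (forall (V W : finType) (j : V -> W) (E : {set {set V}}) (F : {set {set W}}) (s : {perm V}) (t : {perm W}) (T : {set V}),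
     injective j -> {in T, forall v, j (s v) = t (j v)} ->
     (forall e : {set V}, e \subset T -> (j @: e \in F) = (e \in E)) ->
   psi W F t (j @: T) = psi V E s T).

Lemma natural_one : natural fone.
Proof.
split=> [V E t T|V W j E F s t T injj _ _]; rewrite /fone.
  by have [-> _|_] := eqVneq T set0; rewrite ?imset0 ?eqxx.
by rewrite imset_eq0.
Qed.

Lemma imsetD_inj (V W : finType) (j : V -> W) (S T : {set V}) :
  injective j -> j @: (T :\: S) = j @: T :\: j @: S.
Proof.
move=> injj; apply/setP => w; apply/imsetP/setDP => [[v /setDP[vT vS] ->]|].
  by rewrite !mem_imset //.
by move=> [/imsetP[v vT ->]]; rewrite mem_imset // => vS; exists v; rewrite ?inE ?vS.
Qed.

Lemma natural_conv psi phi : natural psi -> natural phi -> natural (fconv psi phi).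
Proof.
move=> [ps pn] [qs qn]; split=> [V E t T|V W j E F s t T injj js jE].
  move=> nz; have [S /andP[sST]] : exists S : {set V}, (S \subset T) && (psi V E t S * phi V E t (T :\: S) != 0).
    apply/existsP; apply: contraNT nz; rewrite negb_exists => /forallP h.
    apply/eqP/big1 => S sST; apply/eqP; move: (h S); rewrite sST /= negbK.
    by [].
  rewrite mulf_eq0 negb_or => /andP[/ps tS /qs tTS].
  by rewrite -(setID T S) (setIidPr sST) imsetU tS tTS.
(* The subsets of [j @: T] are the images of the subsets of [T]. *)
rewrite /fconv [LHS](_ : _ = \sum_(S in [set j @: (U : {set V}) | U in powerset T])
    psi W F t S * phi W F t (j @: T :\: S)); last first.
  apply: eq_bigl => S; apply/idP/imsetP => [sS|[U]].
    exists (j @^-1: S).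
      rewrite inE; apply/subsetP => v; rewrite inE => /(subsetP sS) /imsetP[u uT].
      by move/injj => ->.
    apply/setP => w; apply/idP/imsetP => [wS|[v]]; last by rewrite inE => vS ->.
    by have /imsetP[v _ e] := subsetP sS w wS; exists v; rewrite // inE -e.
  by rewrite inE => sUT ->; rewrite imsetS.
rewrite big_imset /=; last by move=> U U' _ _; exact: imset_inj.
apply: eq_big => [U|U]; rewrite inE // => sUT.
rewrite -imsetD_inj // (pn _ _ j E F s) //; last 2 first.
- by move=> v /(subsetP sUT); exact: js.
- by move=> e /subset_trans/(_ sUT); exact: jE.
rewrite (qn _ _ j E F s) //.
- by move=> v /setDP[vT _]; exact: js.
- by move=> e /subset_trans/(_ (subsetDl _ _)); exact: jE.
Qed.

End Families.

(** * Pairing representations with natural families *)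

Section GraphIso.
Variables (V W : finType).

Lemma edges_iso (G : graph V) (H : graph W) (w : graph_iso G H) (e : {set V}) :
  (w @: e \in edges H) = (e \in edges G).
Proof.
rewrite -(iso_edges w) mem_imset //.
exact: imset_inj (can_inj (iso_funK w)).
Qed.

Lemma iso_fun_setT (G : graph V) (H : graph W) (w : graph_iso G H) : w @: setT = setT.
Proof.
apply/setP => v; rewrite inE; apply/imsetP; exists (iso_inv w v) => //.
by rewrite iso_invK.
Qed.

Lemma graph_iso_of_fun (G : graph V) (H : graph W) (w : V -> W) :
    injective w -> w @: setT = setT ->
    (forall e : {set V}, (w @: e \in edges H) = (e \in edges G)) ->
  exists i : graph_iso G H, iso_fun i =1 w.
Proof.
move=> injw wT wE.
have /fin_all_exists[u uK] x : exists v, w v = x.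
  by have : x \in w @: setT by [rewrite wT inE]; case/imsetP => v _ ->; exists v.
have wK : cancel w u by move=> v; apply: injw; rewrite uK.
suff e : [set w @: (e : {set V}) | e in edges G] = edges H.
  by exists (GraphIso wK uK e).
apply/setP => d; apply/imsetP/idP => [[e eG ->]|dH]; first by rewrite wE.
have dE : d = w @: (u @: d).
  by rewrite -imset_comp -[LHS]imset_id; apply: eq_imset => x /=; rewrite uK.
by exists (u @: d); rewrite // -wE -dE.
Qed.

End GraphIso.

Definition iso_sym (V W : finType) (G : graph V) (H : graph W) (w : graph_iso G H) :
  graph_iso H G.
Proof.
apply: (@GraphIso _ _ H G (iso_inv w) w (iso_invK w) (iso_funK w)).
rewrite -(iso_edges w) -imset_comp -[RHS]imset_id; apply: eq_imset => e /=.
by rewrite -imset_comp -[RHS]imset_id; apply: eq_imset => x /=; rewrite iso_funK.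
Defined.

Section TransportSum.
Variables (V W : finType) (G : graph V) (H : graph W) (w : graph_iso G H).

Lemma transportE (s : {perm W}) v : w (transport w s v) = s (w v).
Proof. by rewrite permE iso_invK. Qed.

Lemma transport_symK : cancel (transport w) (transport (iso_sym w)).
Proof. by move=> s; apply/permP => x; rewrite !permE /= !iso_invK. Qed.

Lemma transport_symKV : cancel (transport (iso_sym w)) (transport w).
Proof. by move=> s; apply/permP => x; rewrite !permE /= !iso_funK. Qed.

Lemma mem_transport s : (transport w s \in graph_aut G) = (s \in graph_aut H).
Proof.
apply/idP/idP; last exact: transport_aut.
by move/(transport_aut (iso_sym w)); rewrite transport_symK.
Qed.

Lemma sum_transport (R : nmodType) (F : {perm V} -> R) :
  \sum_(s in graph_aut G) F s = \sum_(s in graph_aut H) F (transport w s).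
Proof.
rewrite (reindex (transport w)) /=.
  by apply: eq_bigl => s; rewrite mem_transport.
exact/onW_bij/(Bijective transport_symK transport_symKV).
Qed.

Lemma card_aut_iso : #|graph_aut G| = #|graph_aut H|.
Proof. by have := sum_transport (fun=> 1%N); rewrite !sum1_card. Qed.

End TransportSum.

Lemma aut_edges (V : finType) (G : graph V) s (e : {set V}) :
  s \in graph_aut G -> (s @: e \in edges G) = (e \in edges G).
Proof.
rewrite inE => /eqP {1}<-; rewrite mem_imset //.
exact: imset_inj (@perm_inj _ s).
Qed.

Section Pairing.
Variable k : closedFieldType.
Hypothesis char0 : [pchar k] =i pred0.
Implicit Type psi : family k.

Definition rep_pair psi (V : finType) (G : graph V) n
    (r : mx_representation k (graph_aut G) n) : k :=
  #|graph_aut G|%:R^-1 * \sum_(s in graph_aut G) \tr (r s) * psi V (edges G) s setT.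

Definition irr_pair psi (a : irr_label k) : k := rep_pair psi (irr_repr (lab_irr a)).

(** [psi] as a functional on A, evaluated on a chosen representative; the choice is
    immaterial when [psi] is natural (see [pair_zpi]). *)
Definition pair psi (x : Arep k) : k := Alift (irr_pair psi) x.

Lemma natural_iso psi (V W : finType) (G : graph V) (H : graph W) (w : graph_iso G H) s :
  natural psi -> psi V (edges G) (transport w s) setT = psi W (edges H) s setT.
Proof.
move=> [_ inv]; rewrite -(iso_fun_setT w); symmetry; apply: inv.
- exact: can_inj (iso_funK w).
- by move=> v _; rewrite transportE.
by move=> e _; exact: edges_iso.
Qed.

Lemma natural_conj psi (V : finType) (G : graph V) s g : natural psi -> g \in graph_aut G ->
  psi V (edges G) (g * s * g^-1)%g setT = psi V (edges G) s setT.
Proof.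
move=> [_ inv] Gg; have {2}<- : g @: [set: V] = setT.
  by apply/setP => v; rewrite inE; apply/imsetP; exists (g^-1 v)%g; rewrite ?inE ?permKV.
symmetry; apply: inv; first exact: perm_inj.
  by move=> v _; rewrite !permM permKV.
by move=> e _; exact: aut_edges.
Qed.

Lemma rep_pair_multiplicity psi (V : finType) (G : graph V) n
    (r : mx_representation k (graph_aut G) n) :
  rep_pair psi r = \sum_i (multiplicity r i)%:R * rep_pair psi (irr_repr i).
Proof.
rewrite [RHS](eq_bigr (fun i => #|graph_aut G|%:R^-1 * \sum_(s in graph_aut G)
   (multiplicity r i)%:R * \tr (irr_repr i s) * psi V (edges G) s setT)); last first.
  move=> i _; rewrite mulrCA; congr (_ * _); rewrite mulr_sumr.
  by apply: eq_bigr => s _; rewrite mulrA.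
rewrite -mulr_sumr exchange_big /=; congr (_ * _); apply: eq_bigr => s Gs.
by rewrite (mxtrace_multiplicity char0) // mulr_suml.
Qed.

Lemma rep_pair_Ad psi (V W : finType) (G : graph V) (H : graph W) (w : graph_iso G H) n
    (r : mx_representation k (graph_aut G) n) :
  natural psi -> rep_pair psi (Ad w r) = rep_pair psi r.
Proof.
move=> npsi; rewrite /rep_pair (card_aut_iso w) (sum_transport w).
by congr (_ * _); apply: eq_bigr => s _; rewrite (natural_iso w s npsi).
Qed.

Lemma flift_rep_incl (M : zmodType) (F : irr_label k -> M) n (G : graph 'I_n)
    (c : rep_group k (graph_aut G)) :
  flift F (rep_incl c) = \sum_i F (IrrLabel i) *~ c i.
Proof.
by rewrite raddf_sum; apply: eq_bigr => i _; rewrite raddfMz /= flift_fgen.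
Qed.

Lemma flift_rep_class psi n (G : graph 'I_n) m (r : mx_representation k (graph_aut G) m) :
  flift (irr_pair psi) (rep_incl (rep_class r)) = rep_pair psi r.
Proof.
rewrite flift_rep_incl rep_pair_multiplicity; apply: eq_bigr => i _.
by rewrite ffunE -pmulrn mulr_natl.
Qed.

Lemma pair_zpi psi y : natural psi -> pair psi (zpi _ y) = flift (irr_pair psi) y.
Proof.
move=> npsi; apply: zquot_lift => _ [n m G H w d r].
by rewrite raddfB /= !flift_rep_class rep_pair_Ad // subrr.
Qed.

Lemma pair_additive psi : natural psi -> additive_map (pair psi).
Proof.
move=> npsi x y; rewrite -[x]zreprK -[y]zreprK -raddfD !pair_zpi //.
by rewrite raddfD.
Qed.

Lemma pair_aclass psi (V : finType) (G : graph V) n (r : mx_representation k (graph_aut G) n) :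
  natural psi -> pair psi (aclass r) = rep_pair psi r.
Proof. by move=> npsi; rewrite pair_zpi // flift_rep_class rep_pair_Ad. Qed.

Lemma irr_class_incl n (G : graph 'I_n) (i : Irr k (graph_aut G)) :
  rep_incl (rep_class (irr_repr i)) = fgen (IrrLabel i).
Proof.
rewrite /rep_incl (bigD1 i) //= big1 ?addr0 => [|j /negbTE ne]; rewrite ffunE.
  suff -> : multiplicity (irr_repr i) i = 1%N by rewrite mulr1z.
  by apply: (natr_inj char0); rewrite /= (multiplicity_cfdot char0) (cfdot_irr char0) eqxx.
suff -> : multiplicity (irr_repr i) j = 0%N by rewrite mulr0z.
by apply: (natr_inj char0); rewrite /= (multiplicity_cfdot char0) (cfdot_irr char0) ne.
Qed.

Lemma aclass_ord n (G : graph 'I_n) m (r : mx_representation k (graph_aut G) m) :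
  aclass r = zpi _ (rep_incl (rep_class r)).
Proof.
apply/esym/eqP; rewrite -subr_eq0 -raddfB; apply/eqP/zpi_mem; exact: AdRel.
Qed.

Definition lab_class (a : irr_label k) : Arep k := aclass (irr_repr (lab_irr a)).

Lemma zpi_fgen a : zpi _ (fgen a) = lab_class a.
Proof. by case: a => n G i; rewrite /lab_class aclass_ord irr_class_incl. Qed.

Lemma Arep_span (x : Arep k) : x \in gen_subgroup (fun y => exists a, y = lab_class a).
Proof.
rewrite -[x]zreprK (freeg_sum_fgen (zrepr x)) raddf_sum; apply: rpred_sum => a _.
by rewrite raddfMz rpredMz //= zpi_fgen; apply: gen_subgroup_mem; exists a.
Qed.

Lemma eq_aclass (V : finType) (G : graph V) n n'
    (r : mx_representation k (graph_aut G) n) (r' : mx_representation k (graph_aut G) n') :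
  {in graph_aut G, forall s, \tr (r s) = \tr (r' s)} -> aclass r = aclass r'.
Proof.
move=> e; congr (zpi _ (rep_incl _)); apply/ffunP => i; rewrite !ffunE.
congr (Posz _); apply: (eq_multiplicity char0) => s Hs; exact: e (transport_aut _ Hs).
Qed.

Lemma aclass_Ad n m (G : graph 'I_n) (H : graph 'I_m) (w : graph_iso G H) d
    (r : mx_representation k (graph_aut G) d) : aclass (Ad w r) = aclass r.
Proof.
rewrite !aclass_ord; apply/esym/eqP; rewrite -subr_eq0 -raddfB; apply/eqP/zpi_mem.
exact: AdRel.
Qed.

Definition embeddings n (G : graph 'I_n) (V : finType) (E : {set {set V}}) (T : {set V}) :
    {set {ffun 'I_n -> V}} :=
  [set w : {ffun 'I_n -> V} | [&& injectiveb w, w @: setT == T &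
     [forall e : {set 'I_n}, (w @: e \in E) == (e \in edges G)]]].

(** [test_family b] counts the embeddings of the graph of [b] that conjugate a
    given permutation to [s], weighted by the value at [s] of the character dual
    to [b]; up to a nonzero factor, pairing with it gives the coefficient of the
    class of [b]. *)
Definition test_family (b : irr_label k) : family k := fun V E t T =>
  \sum_(w in embeddings (lab_graph b) E T)
    \sum_(s in graph_aut (lab_graph b) | [forall v, w (s v) == t (w v)])
      \tr (irr_repr (lab_irr b) s^-1%g).

Lemma embeddingsP n (G : graph 'I_n) (V : finType) (E : {set {set V}}) (T : {set V})
    (w : {ffun 'I_n -> V}) :
  reflect [/\ injective w, w @: setT = T & forall e : {set 'I_n}, (w @: e \in E) = (e \in edges G)]
          (w \in embeddings G E T).
Proof.
rewrite inE; apply: (iffP and3P) => -[].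
  by move=> /injectiveP injw /eqP wT /forallP wE; split=> // e; apply/eqP.
by move=> injw wT wE; split; [exact/injectiveP | exact/eqP | apply/forallP => e; rewrite wE].
Qed.

Lemma embeddings_imset n (G : graph 'I_n) (V W : finType) (j : V -> W)
    (E : {set {set V}}) (F : {set {set W}}) (T : {set V}) : injective j ->
    (forall e : {set V}, e \subset T -> (j @: e \in F) = (e \in E)) ->
  embeddings G F (j @: T) = [set [ffun v => j (w v)] | w : {ffun 'I_n -> V} in embeddings G E T].
Proof.
move=> injj jE; apply/setP => w'; apply/embeddingsP/imsetP.
  move=> [injw w'T w'E].
  have /fin_all_exists[u uE] v : exists x, w' v = j x.
    have : w' v \in j @: T by rewrite -w'T imset_f.
    by case/imsetP => x _ ->; exists x.
  have w'j (e : {set 'I_n}) : w' @: e = j @: (u @: e).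
    by rewrite -imset_comp; apply: eq_imset => v /=; rewrite uE.
  have uT : u @: setT = T by apply: (imset_inj injj); rewrite -w'j.
  exists [ffun v => u v]; last by apply/ffunP => v; rewrite !ffunE.
  have fu (e : {set 'I_n}) : [ffun v => u v] @: e = u @: e.
    by apply: eq_imset => v; rewrite ffunE.
  apply/embeddingsP; split; rewrite ?fu //.
    by move=> v v'; rewrite !ffunE => e; apply: injw; rewrite !uE e.
  by move=> e; rewrite fu -jE -?w'j // -uT imsetS // subsetT.
move=> [w /embeddingsP[injw wT wE] ->].
have jw (e : {set 'I_n}) : [ffun v => j (w v)] @: e = j @: (w @: e).
  by rewrite -imset_comp; apply: eq_imset => v; rewrite ffunE.
split; rewrite ?jw ?wT //.
  by move=> v v'; rewrite !ffunE => /injj/injw.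
by move=> e; rewrite jw jE // -wT imsetS // subsetT.
Qed.

Lemma natural_test b : natural (test_family b).
Proof.
split=> [V E t T|V W j E F s t T injj js jE].
  move=> nz.
  have [w /andP[/embeddingsP[_ wT _] nz']] : exists w, (w \in embeddings (lab_graph b) E T) &&
      (\sum_(s in graph_aut (lab_graph b) | [forall v, w (s v) == t (w v)])
      \tr (irr_repr (lab_irr b) s^-1%g) != 0).
    apply/existsP; apply: contraNT nz; rewrite negb_exists => /forallP h.
    by apply/eqP/big1 => w wE; apply/eqP; move: (h w); rewrite wE /= negbK.
  have [s /forallP ws] : exists s : {perm 'I_(lab_order b)}, [forall v, w (s v) == t (w v)].
    apply/existsP; apply: contraNT nz'; rewrite negb_exists => /forallP h.
    by apply/eqP/big1 => s /andP[_]; rewrite (negbTE (h s)).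
  rewrite -wT -imset_comp -[in RHS](_ : s @: setT = setT).
    by rewrite -imset_comp; apply: eq_imset => v /=; rewrite (eqP (ws v)).
  by apply/setP => v; rewrite inE; apply/imsetP; exists (s^-1 v)%g; rewrite ?inE ?permKV.
rewrite /test_family (embeddings_imset _ injj jE) big_imset /=; last first.
  by move=> w w' _ _ /ffunP e; apply/ffunP => v; apply: injj; have := e v; rewrite !ffunE.
apply: eq_bigr => w /embeddingsP[_ wT _]; apply: eq_bigl => u; congr (_ && _).
apply: eq_forallb => v; rewrite !ffunE -js ?(inj_eq injj) //.
by rewrite -wT imset_f.
Qed.

End Pairing.

Section Separation.
Variable k : closedFieldType.
Hypothesis char0 : [pchar k] =i pred0.
Implicit Types psi phi theta : family k.

Lemma Ad_irr (V W : finType) (G : graph V) (H : graph W) (w : graph_iso G H)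
    (i : Irr k (graph_aut G)) : mx_irreducible (Ad w (irr_repr i)).
Proof.
apply: (cfdot1_irr char0); rewrite -[RHS]/(true%:R) -(eqxx i) -(cfdot_irr char0 i i).
rewrite /cfdot (card_aut_iso w) [in RHS](sum_transport w).
congr (_ * _); apply: eq_bigr => s Hs; congr (_ * _); congr (\tr (irr_repr i _)).
apply: (mulgI (transport w s)); rewrite -(transportM w) ?groupV // mulgV.
by apply/permP => v; rewrite permE /= perm1 iso_funK mulgV perm1.
Qed.

Definition embedding_term (a b : irr_label k) (w : 'I_(lab_order b) -> 'I_(lab_order a)) : k :=
  #|graph_aut (lab_graph a)|%:R^-1 * \sum_(t in graph_aut (lab_graph a))
    \tr (irr_repr (lab_irr a) t) *
    \sum_(s in graph_aut (lab_graph b) | [forall v, w (s v) == t (w v)])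
      \tr (irr_repr (lab_irr b) s^-1%g).

(** The term of an isomorphism [w] is the inner product of the irreducible
    character of [b] with the transport along [w] of that of [a]. *)
Lemma embedding_term01 a b (w : {ffun 'I_(lab_order b) -> 'I_(lab_order a)}) :
    w \in embeddings (lab_graph b) (edges (lab_graph a)) setT ->
  embedding_term w = 0 \/ embedding_term w = 1 /\ lab_class a = lab_class b.
Proof.
case/embeddingsP => injw wT wE; have [i iw] := graph_iso_of_fun injw wT wE.
pose r := Ad (iso_sym i) (irr_repr (lab_irr a)).
have irr_r : mx_irreducible r := Ad_irr (iso_sym i) (lab_irr a).
have -> : embedding_term w = (lab_irr b == irr_comp (Irr k _) r)%:R.
  rewrite -(cfdot_irr char0) /embedding_term (sum_transport (iso_sym i)).
  rewrite (card_aut_iso (iso_sym i)); congr (_ * _); apply: eq_bigr => s Gs.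
  rewrite irr_comp_trace // mulrC; congr (_ * _).
  rewrite (bigD1 s) /=; last first.
    by rewrite Gs; apply/forallP => v; rewrite -!iw -transportE transport_symKV.
  (* As [w] is injective, a permutation has at most one conjugate under it. *)
  rewrite big1 ?addr0 // => s' /andP[/andP[_ /forallP h] /eqP[]].
  apply/permP => v; apply: injw; rewrite (eqP (h v)) -!iw.
  by rewrite -transportE transport_symKV.
case: eqP => [e|_]; [right; split=> // | by left].
rewrite /lab_class -(aclass_Ad (iso_sym i)) -/r e.
by apply: eq_aclass => // s Gs; rewrite irr_comp_trace.
Qed.

Lemma embedding_term_id (b : irr_label k) : @embedding_term b b id = 1.
Proof.
rewrite -[RHS]/(true%:R) -(eqxx (lab_irr b)) -(cfdot_irr char0).
congr (_ * _); apply: eq_bigr => t Gt; rewrite mulrC; congr (_ * _).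
rewrite (bigD1 t) /=; last by rewrite Gt; apply/forallP.
rewrite big1 ?addr0 // => s' /andP[/andP[_ /forallP h] /eqP[]].
by apply/permP => v; rewrite (eqP (h v)).
Qed.

Lemma pair_test (a b : irr_label k) : pair (test_family b) (lab_class a) =
  \sum_(w in embeddings (lab_graph b) (edges (lab_graph a)) setT) embedding_term w.
Proof.
rewrite (pair_aclass char0) /rep_pair; last exact: natural_test.
rewrite -mulr_sumr exchange_big /=; congr (_ * _); apply: eq_bigr => t _.
by rewrite /test_family mulr_sumr.
Qed.

(** All terms are 0 or 1 and the identity contributes 1; in characteristic 0 there is
    no cancellation. *)
Lemma pair_test_neq0 (b : irr_label k) : pair (test_family b) (lab_class b) != 0.
Proof.
rewrite pair_test.
set D := embeddings _ _ _; pose c (w : {ffun 'I_(lab_order b) -> 'I_(lab_order b)}) : nat :=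
  embedding_term w == 1.
have -> : \sum_(w in D) embedding_term w = (\sum_(w in D) c w)%:R.
  rewrite natr_sum; apply: eq_bigr => w /embedding_term01; rewrite /c.
  by case=> [->|[-> _]]; rewrite ?eqxx // eq_sym oner_eq0.
have idD : [ffun v => v] \in D.
  have fid (e : {set 'I_(lab_order b)}) : [ffun v => v] @: e = e.
    by rewrite -[RHS]imset_id; apply: eq_imset => v; rewrite ffunE.
  apply/embeddingsP; split=> [v v'||e]; by rewrite ?ffunE ?fid.
rewrite natr_neq0 // (bigD1 [ffun v => v]) //= addn_eq0 negb_and; apply/orP; left.
rewrite /c (_ : embedding_term _ = 1) ?eqxx // -[RHS](embedding_term_id b).
congr (_ * _); apply: eq_bigr => t _; congr (_ * _); apply: eq_bigl => s; congr (_ && _).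
by apply: eq_forallb => v; rewrite !ffunE.
Qed.

Definition coordinate (b : irr_label k) (x : Arep k) : k :=
  (pair (test_family b) (lab_class b))^-1 * pair (test_family b) x.

Lemma Arep_dual_basis : dual_basis (@lab_class k) coordinate.
Proof.
split; last exact: Arep_span.
  move=> b x y; rewrite /coordinate (pair_additive char0 (natural_test b)).
  by rewrite mulrDr.
move=> b a; rewrite /coordinate; have [->|ne] := eqVneq.
  by rewrite mulVf // pair_test_neq0.
rewrite [X in _ * X]pair_test big1 ?mulr0 // => w /embedding_term01[//|[_ e]].
by rewrite e eqxx in ne.
Qed.

Lemma Arep_eq0 x : (forall psi, natural psi -> pair psi x = 0) -> x = 0.
Proof.
move=> h; apply: (dual_basis_eq0 (intr_inj_char0 char0) Arep_dual_basis) => b.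
by rewrite /coordinate h ?mulr0 //; exact: natural_test.
Qed.

(** The identities between elements of A are verified by means of this lemma and its
    analogues for tensors. *)
Lemma Arep_eq x y : (forall psi, natural psi -> pair psi x = pair psi y) -> x = y.
Proof.
move=> h; apply/eqP; rewrite -subr_eq0; apply/eqP/Arep_eq0 => psi npsi.
by rewrite (additive_mapB (pair_additive char0 npsi)) h // subrr.
Qed.

Definition pair2 psi phi (t : tensor (Arep k) (Arep k)) : k :=
  tlift (fun x y => pair psi x * pair phi y) t.

Lemma pair2_bilinear psi phi : natural psi -> natural phi ->
  bilinear2 (fun x y => pair psi x * pair phi y).
Proof. by move=> np nq; apply: mul_bilinear; exact: (pair_additive char0). Qed.

Lemma pair2_additive psi phi : natural psi -> natural phi -> additive_map (pair2 psi phi).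
Proof. by move=> np nq; apply/tlift_additive/pair2_bilinear. Qed.

Lemma pair2_tens psi phi x y : natural psi -> natural phi ->
  pair2 psi phi (tens x y) = pair psi x * pair phi y.
Proof. by move=> np nq; rewrite /pair2 tliftE //; exact: pair2_bilinear. Qed.

Lemma Arep2_eq s t :
  (forall psi phi, natural psi -> natural phi -> pair2 psi phi s = pair2 psi phi t) -> s = t.
Proof.
move=> h; apply/eqP; rewrite -subr_eq0; apply/eqP.
apply: (dual_basis_eq0 (intr_inj_char0 char0)
  (dual_basis_tensor Arep_dual_basis Arep_dual_basis)) => -[a b] /=.
have [np nq] := (natural_test a, natural_test b).
set c := (pair (test_family a) (lab_class a))^-1 * (pair (test_family b) (lab_class b))^-1.
suff e u : tlift (fun x y => coordinate a x * coordinate b y) u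
         = c * pair2 (test_family a) (test_family b) u.
  by rewrite e (additive_mapB (pair2_additive np nq)) h // subrr mulr0.
have cD i : additive_map (coordinate i) by case: Arep_dual_basis.
move: u; apply: tensor_additive_eq.
- exact/tlift_additive/mul_bilinear.
- by move=> u v; rewrite (pair2_additive np nq) mulrDr.
by move=> x y; rewrite (tliftE _ _ (mul_bilinear (cD a) (cD b))) pair2_tens // /coordinate mulrACA.
Qed.

Definition pair3 psi phi theta (t : tensor (Arep k) (tensor (Arep k) (Arep k))) : k :=
  tlift (fun x u => pair psi x * pair2 phi theta u) t.

Lemma pair3_additive psi phi theta : natural psi -> natural phi -> natural theta ->
  additive_map (pair3 psi phi theta).
Proof.
move=> np nq nr; apply/tlift_additive/mul_bilinear; first exact: pair_additive.
exact: pair2_additive.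
Qed.

Lemma pair3_tens psi phi theta x u : natural psi -> natural phi -> natural theta ->
  pair3 psi phi theta (tens x u) = pair psi x * pair2 phi theta u.
Proof.
move=> np nq nr; rewrite /pair3 tliftE //; apply: mul_bilinear; first exact: pair_additive.
exact: pair2_additive.
Qed.

Lemma Arep3_eq s t :
    (forall psi phi theta, natural psi -> natural phi -> natural theta ->
      pair3 psi phi theta s = pair3 psi phi theta t) ->
  s = t.
Proof.
move=> h; apply/eqP; rewrite -subr_eq0; apply/eqP.
apply: (dual_basis_eq0 (intr_inj_char0 char0) (dual_basis_tensor Arep_dual_basis
  (dual_basis_tensor Arep_dual_basis Arep_dual_basis))) => -[a [b d]] /=.
have [np nq nr] := And3 (natural_test a) (natural_test b) (natural_test d).
pose n (i : irr_label k) := (pair (test_family i) (lab_class i))^-1.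
have cD i : additive_map (coordinate i) by case: Arep_dual_basis.
have e2 u : tlift (fun x y => coordinate b x * coordinate d y) u
         = n b * n d * pair2 (test_family b) (test_family d) u.
  move: u; apply: tensor_additive_eq.
  - exact/tlift_additive/mul_bilinear.
  - by move=> u v; rewrite (pair2_additive nq nr) mulrDr.
  by move=> x y; rewrite (tliftE _ _ (mul_bilinear (cD b) (cD d))) pair2_tens // /coordinate mulrACA.
suff e u : tlift (fun x u => coordinate a x * tlift (fun x y => coordinate b x * coordinate d y) u) u
         = n a * (n b * n d) * pair3 (test_family a) (test_family b) (test_family d) u.
  by rewrite e (additive_mapB (pair3_additive np nq nr)) h // subrr mulr0.
have bil : bilinear2 (fun x u => coordinate a x * tlift (fun x y => coordinate b x * coordinate d y) u).
  by apply: mul_bilinear => //; apply/tlift_additive/mul_bilinear.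
move: u; apply: tensor_additive_eq.
- exact: tlift_additive.
- by move=> u v; rewrite (pair3_additive np nq nr) mulrDr.
by move=> x u; rewrite tliftE ?pair3_tens // e2 /coordinate mulrACA.
Qed.

Lemma pair_sum_family (I : finType) (P : pred I) (psi : I -> family k) phi x :
    (forall V E t T, phi V E t T = \sum_(i | P i) psi i V E t T) ->
  pair phi x = \sum_(i | P i) pair (psi i) x.
Proof.
move=> h; rewrite /pair /Alift flift_sum.
rewrite [RHS](eq_bigr (fun i => \sum_(a <- dom (zrepr x))
  irr_pair (psi i) a *~ coeff a (zrepr x))); last by move=> i _; rewrite flift_sum.
rewrite exchange_big /=; apply: eq_bigr => a _; rewrite -mulrz_suml.
congr (_ *~ _); rewrite /irr_pair /rep_pair -mulr_sumr exchange_big /=.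
by congr (_ * _); apply: eq_bigr => s _; rewrite h mulr_sumr.
Qed.

End Separation.

(** * Multiplication and comultiplication as operations on natural families *)

Lemma insubd_permE (T : finType) (f : {ffun T -> T}) :
  injective f -> insubd (1%g : {perm T}) f =1 f.
Proof.
move=> injf v; rewrite -pvalE -[pval _]/(val _) insubdK //.
exact/injectiveP.
Qed.

Section DisjointUnion.
Variables V W : finType.
Implicit Types (s : {perm V}) (t : {perm W}).

Lemma dunion_perm_spec s t :
  (forall v, dunion_perm (s, t) (inl v) = inl (s v)) /\
  (forall w, dunion_perm (s, t) (inr w) = inr (t w)).
Proof.
pose f : {ffun V + W -> V + W} :=
  [ffun x => match x with inl v => inl (s v) | inr w => inr (t w) end].
have inj : injective f.
  by move=> [v|w] [v'|w']; rewrite !ffunE // => -[] /perm_inj ->.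
by split=> v; rewrite /dunion_perm insubd_permE // ffunE.
Qed.

Lemma dunion_perm_inl s t v : dunion_perm (s, t) (inl v) = inl (s v).
Proof. exact: (dunion_perm_spec s t).1. Qed.

Lemma dunion_perm_inr s t w : dunion_perm (s, t) (inr w) = inr (t w).
Proof. exact: (dunion_perm_spec s t).2. Qed.

Lemma dunion_permM x y : dunion_perm (x * y)%g = (dunion_perm x * dunion_perm y)%g :> {perm V + W}.
Proof.
case: x y => [s t] [s' t']; apply/permP => -[v|w]; rewrite permM.
  by rewrite !dunion_perm_inl permM.
by rewrite !dunion_perm_inr permM.
Qed.

Lemma inl_inj : injective (@inl V W). Proof. by move=> ? ? []. Qed.
Lemma inr_inj : injective (@inr V W). Proof. by move=> ? ? []. Qed.

Definition dsum (E : {set {set V}}) (F : {set {set W}}) : {set {set (V + W)%type}} :=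
  [set inl @: (e : {set V}) | e in E] :|: [set inr @: (e : {set W}) | e in F].

Definition tsum (T : {set V}) (S : {set W}) : {set (V + W)%type} := inl @: T :|: inr @: S.

Lemma mem_tsum_inl T S v : (inl v \in tsum T S) = (v \in T).
Proof.
rewrite inE mem_imset ?orbF //; last exact: inl_inj.
by case: imsetP => [[]|]; rewrite ?orbF.
Qed.

Lemma mem_tsum_inr T S w : (inr w \in tsum T S) = (w \in S).
Proof.
rewrite inE orbC mem_imset ?orbF //; last exact: inr_inj.
by case: imsetP => [[]|]; rewrite ?orbF.
Qed.

Lemma tsum_setT : tsum setT setT = setT.
Proof. by apply/setP => -[v|w]; rewrite ?mem_tsum_inl ?mem_tsum_inr !inE. Qed.

Lemma dsumP (E : {set {set V}}) (F : {set {set W}}) (e : {set (V + W)%type}) :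
  reflect ((exists2 d, d \in E & e = inl @: d) \/ (exists2 d, d \in F & e = inr @: d))
          (e \in dsum E F).
Proof.
apply: (iffP setUP) => [[/imsetP[d dE ->]|/imsetP[d dE ->]]|[[d dE ->]|[d dE ->]]].
- by left; exists d.
- by right; exists d.
- by left; apply/imsetP; exists d.
by right; apply/imsetP; exists d.
Qed.

End DisjointUnion.

Lemma mem_graph_aut (V : finType) (G : graph V) (s : {perm V}) :
  (forall e : {set V}, e \in edges G -> s @: e \in edges G) -> s \in graph_aut G.
Proof.
move=> h; rewrite inE eqEcard card_imset ?leqnn ?andbT; last exact: imset_inj (@perm_inj _ s).
by apply/subsetP => _ /imsetP[e eG ->]; exact: h.
Qed.

Lemma dunion_perm_aut (V W : finType) (G : graph V) (H : graph W) x :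
  x \in setX (graph_aut G) (graph_aut H) -> dunion_perm x \in graph_aut (dunion G H).
Proof.
case: x => s t; rewrite inE => /andP[/= Gs Ht]; apply: mem_graph_aut => e /dsumP[][d dG ->].
  apply/dsumP; left; exists (s @: d); first by rewrite aut_edges.
  by rewrite -!imset_comp; apply: eq_imset => v /=; rewrite dunion_perm_inl.
apply/dsumP; right; exists (t @: d); first by rewrite aut_edges.
by rewrite -!imset_comp; apply: eq_imset => v /=; rewrite dunion_perm_inr.
Qed.

Section SumMap.
Variables (V V' W W' : finType) (i : V -> V') (j : W -> W').
Hypotheses (inji : injective i) (injj : injective j).

Definition sum_map (x : V + W) : V' + W' :=
  match x with inl v => inl (i v) | inr w => inr (j w) end.

Lemma sum_map_inj : injective sum_map.
Proof. by move=> [v|w] [v'|w'] //= [] => [/inji|/injj] ->. Qed.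

Lemma sum_map_inl (e : {set V}) : sum_map @: (inl @: e) = inl @: (i @: e).
Proof. by rewrite -!imset_comp; apply: eq_imset. Qed.

Lemma sum_map_inr (e : {set W}) : sum_map @: (inr @: e) = inr @: (j @: e).
Proof. by rewrite -!imset_comp; apply: eq_imset. Qed.

Lemma sum_map_tsum T S : sum_map @: tsum T S = tsum (i @: T) (j @: S).
Proof. by rewrite /tsum imsetU sum_map_inl sum_map_inr. Qed.

Lemma sum_map_dsum (E : {set {set V}}) (F : {set {set W}}) (E' : {set {set V'}})
    (F' : {set {set W'}}) (T : {set V}) (S : {set W}) (e : {set (V + W)%type}) :
    (forall d : {set V}, d \subset T -> (i @: d \in E') = (d \in E)) ->
    (forall d : {set W}, d \subset S -> (j @: d \in F') = (d \in F)) ->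
  e \subset tsum T S -> (sum_map @: e \in dsum E' F') = (e \in dsum E F).
Proof.
move=> hE hF sTS.
have injl := @inl_inj V' W'; have injr := @inr_inj V' W'.
have sT (d : {set V}) : e = inl @: d -> d \subset T.
  move=> de; apply/subsetP => v vd; rewrite -(mem_tsum_inl T S).
  by apply: (subsetP sTS); rewrite de imset_f.
have sS (d : {set W}) : e = inr @: d -> d \subset S.
  move=> de; apply/subsetP => v vd; rewrite -(mem_tsum_inr T S).
  by apply: (subsetP sTS); rewrite de imset_f.
apply/dsumP/dsumP => -[][d dE ed].
- have ed' : e = inl @: (inl @^-1: e : {set V}).
    apply/setP => x; apply/idP/imsetP => [xe|[v]]; last by rewrite inE => ve ->.
    have : sum_map x \in sum_map @: e by rewrite imset_f.
    rewrite ed => /imsetP[v' _]; case: x xe => // v ve _.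
    by exists v; rewrite ?inE.
  left; exists (inl @^-1: e : {set V}) => //; rewrite -hE ?sT //.
  suff -> : i @: (inl @^-1: e) = d by [].
  by apply: (imset_inj injl); rewrite -ed {2}ed' sum_map_inl.
- have ed' : e = inr @: (inr @^-1: e : {set W}).
    apply/setP => x; apply/idP/imsetP => [xe|[v]]; last by rewrite inE => ve ->.
    have : sum_map x \in sum_map @: e by rewrite imset_f.
    rewrite ed => /imsetP[v' _]; case: x xe => // v ve _.
    by exists v; rewrite ?inE.
  right; exists (inr @^-1: e : {set W}) => //; rewrite -hF ?sS //.
  suff -> : j @: (inr @^-1: e) = d by [].
  by apply: (imset_inj injr); rewrite -ed {2}ed' sum_map_inr.
- by left; exists (i @: d); rewrite ?hE ?sT // ed sum_map_inl.
by right; exists (j @: d); rewrite ?hF ?sS // ed sum_map_inr.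
Qed.

End SumMap.

Section Multiplication.
Variable k : closedFieldType.
Hypothesis char0 : [pchar k] =i pred0.
Implicit Types psi phi theta : family k.

(** [psi] at the disjoint unions with a fixed first summand. *)
Definition slice psi (V : finType) (E : {set {set V}}) (t : {perm V}) (T : {set V}) : family k :=
  fun W F s S => psi (V + W)%type (dsum E F) (dunion_perm (t, s)) (tsum T S).

(** The functional [x |-> pair psi (x * y)] is the pairing with this family (see
    [pair_mul]). *)
Definition slices psi (y : Arep k) : family k := fun V E t T => pair (slice psi E t T) y.

Lemma natural_sum psi (V V' W W' : finType) (i : V -> V') (j : W -> W')
    (E : {set {set V}}) (F : {set {set W}}) (E' : {set {set V'}}) (F' : {set {set W'}})
    (T : {set V}) (S : {set W}) (t : {perm V}) (s : {perm W}) (t' : {perm V'}) (s' : {perm W'}) :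
    natural psi -> injective i -> injective j ->
    (forall d : {set V}, d \subset T -> (i @: d \in E') = (d \in E)) ->
    (forall d : {set W}, d \subset S -> (j @: d \in F') = (d \in F)) ->
    {in T, forall v, i (t v) = t' (i v)} -> {in S, forall w, j (s w) = s' (j w)} ->
  slice psi E' t' (i @: T) F' s' (j @: S) = slice psi E t T F s S.
Proof.
move=> [_ inv] inji injj hE hF ht hs; rewrite /slice -sum_map_tsum; apply: inv.
- exact: sum_map_inj.
- move=> [v|w]; rewrite ?mem_tsum_inl ?mem_tsum_inr => h /=.
    by rewrite !dunion_perm_inl /= ht.
  by rewrite !dunion_perm_inr /= hs.
by move=> e; exact: sum_map_dsum.
Qed.

Lemma slice_stable psi (V W : finType) (E : {set {set V}}) t T (F : {set {set W}}) s S :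
  natural psi -> slice psi E t T F s S != 0 -> t @: T = T /\ s @: S = S.
Proof.
move=> [st _] /st e; split; apply/eqP; rewrite eqEcard card_imset ?leqnn ?andbT;
  try exact: perm_inj; apply/subsetP => _ /imsetP[v vT ->].
  by rewrite -(mem_tsum_inl _ S) -e -(dunion_perm_inl t s) imset_f // mem_tsum_inl.
by rewrite -(mem_tsum_inr T) -e -(dunion_perm_inr t s) imset_f // mem_tsum_inr.
Qed.

Lemma natural_slice psi (V : finType) (E : {set {set V}}) t T :
  natural psi -> natural (slice psi E t T).
Proof.
move=> np; split=> [W F s S /(slice_stable np)[]//|W W' j F F' s s' S injj js jF].
rewrite -{1}[T]imset_id; apply: natural_sum => //.
by move=> d _; rewrite imset_id.
Qed.

Lemma eq_pair psi phi x :
    (forall n (G : graph 'I_n) s, psi _ (edges G) s setT = phi _ (edges G) s setT) ->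
  pair psi x = pair phi x.
Proof.
move=> e; rewrite /pair /Alift; congr (flift _ _); apply/funext => a.
by congr (_ * _); apply: eq_bigr => s _; rewrite e.
Qed.

Lemma pair0 psi x : (forall n (G : graph 'I_n) s, psi _ (edges G) s setT = 0) -> pair psi x = 0.
Proof.
move=> e; rewrite /pair /Alift flift_sum big1 // => a _.
rewrite /irr_pair /rep_pair big1 ?mulr0 ?mul0rz // => s _.
by rewrite e mulr0.
Qed.

Lemma natural_slices psi y : natural psi -> natural (slices psi y).
Proof.
move=> np; split=> [V E t T nz|V V' i E E' t t' T inji it iE].
  apply/eqP; apply: contraNT nz => nT; apply/eqP/pair0 => n G s.
  by apply/eqP; apply: contraNT nT => /(slice_stable np)[-> _].
apply: eq_pair => n G s; rewrite -{1}[setT]imset_id.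
apply: natural_sum => //; by move=> d _; rewrite imset_id.
Qed.

(** Frobenius reciprocity, for the pairing with a class function. *)
Lemma frobenius (aT rT : finGroupType) (H : {group aT}) (G : {group rT}) (f : aT -> rT) n
    (rH : mx_representation k H n) (c : rT -> k) :
    (forall h, h \in H -> f h \in G) -> {in H &, {morph f : x y / (x * y)%g}} ->
    {in G &, forall g x, c (g * x * g^-1)%g = c x} ->
  #|G|%:R^-1 * \sum_(x in G) \tr (ind_repr G f rH x) * c x
  = #|H|%:R^-1 * \sum_(h in H) \tr (rH h) * c (f h).
Proof.
move=> fG fM cG.
transitivity (#|G|%:R^-1 * (#|H|%:R^-1 * \sum_(h in H) \sum_(g in G) \tr (rH h) * c (f h))).
  congr (_ * _).
  rewrite (eq_bigr (fun x => #|H|%:R^-1 * \sum_(h in H)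
     \sum_(g in G | (g * f h == x * g)%g) \tr (rH h) * c x)); last first.
    move=> x Gx; rewrite (mxtrace_ind char0) // -mulrA mulr_suml; congr (_ * _).
    by apply: eq_bigr => h _; rewrite mulr_suml.
  rewrite -mulr_sumr; congr (_ * _).
  rewrite exchange_big /=; apply: eq_bigr => h Hh.
  rewrite (exchange_big_dep (mem G)) /=; last by move=> x g _ /andP[].
  apply: eq_bigr => g Gg; rewrite (big_pred1 (g * f h * g^-1)%g) ?cG ?fG // => x.
  rewrite [RHS]inE; apply/and3P/eqP => [[_ _ /eqP ->]|->]; first by rewrite mulgK.
  split=> //; last by rewrite mulgKV.
  by rewrite groupM ?groupV // groupM // fG.
rewrite (eq_bigr (fun h => #|G|%:R * (\tr (rH h) * c (f h)))); last first.
  by move=> h _; rewrite sumr_const mulr_natl.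
rewrite -mulr_sumr mulrCA; congr (_ * _).
by rewrite mulrA mulVf ?mul1r // cardG_neq0.
Qed.

(** The product is an induced representation, and the values of [psi] at a disjoint
    union are a class function. *)
Lemma pair_Amul_irr psi a b : natural psi ->
  pair psi (Amul_irr a b) = #|graph_aut (lab_graph a)|%:R^-1 *
    \sum_(s in graph_aut (lab_graph a)) \tr (irr_repr (lab_irr a) s)
       * irr_pair (slice psi (edges (lab_graph a)) s setT) b.
Proof.
move=> np; rewrite (pair_aclass char0) // /rep_pair.
set G := lab_graph a; set H := lab_graph b.
rewrite (frobenius _ (c := fun x => psi _ (edges (dunion G H)) x setT)); first last.
- by move=> g x Gg _; exact: natural_conj.
- by move=> x y _ _; rewrite dunion_permM.
- by move=> x; exact: dunion_perm_aut.
rewrite card_setX natrM invfM -mulrA; congr (_ * _); rewrite mulr_sumr.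
rewrite (eq_bigr (fun x => #|graph_aut H|%:R^-1 * (\tr (irr_repr (lab_irr a) x.1) *
   \tr (irr_repr (lab_irr b) x.2) * psi _ (edges (dunion G H)) (dunion_perm (x.1, x.2)) setT))).
  rewrite (sum_setX _ _ (fun s t => #|graph_aut H|%:R^-1 * (\tr (irr_repr (lab_irr a) s) *
   \tr (irr_repr (lab_irr b) t) * psi _ (edges (dunion G H)) (dunion_perm (s, t)) setT))).
  apply: eq_bigr => s _; rewrite -mulr_sumr mulrCA; congr (_ * _); rewrite mulr_sumr.
  by apply: eq_bigr => t _; rewrite -mulrA /slice tsum_setT.
by move=> [s t] _; rewrite mxtrace_box.
Qed.

Lemma pair_mul psi (x y : Arep k) : natural psi ->
  pair psi (@hmul (rep_hopf k) x y) = pair (slices psi y) x.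
Proof.
move=> np; rewrite /= /Alift2 /Alift flift_sum (additive_map_sum (pair_additive char0 np)).
rewrite [RHS]flift_sum; apply: eq_bigr => a _; rewrite (additive_mapMz (pair_additive char0 np)).
congr (_ *~ _); rewrite flift_sum (additive_map_sum (pair_additive char0 np)).
rewrite (eq_bigr (fun b => #|graph_aut (lab_graph a)|%:R^-1 *
    \sum_(s in graph_aut (lab_graph a)) \tr (irr_repr (lab_irr a) s)
       * (irr_pair (slice psi (edges (lab_graph a)) s setT) b *~ coeff b (zrepr y)))); last first.
  move=> b _; rewrite (additive_mapMz (pair_additive char0 np)) pair_Amul_irr // -mulrzAr.
  by congr (_ * _); rewrite mulrz_suml; apply: eq_bigr => s _; rewrite mulrzAr.
rewrite -mulr_sumr exchange_big /=; congr (_ * _); apply: eq_bigr => s _.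
by rewrite -mulr_sumr /slices /pair /Alift flift_sum.
Qed.

End Multiplication.

Section OrbitSum.
Variables (aT : finGroupType) (rT : finType) (to : {action aT &-> rT}) (G : {group aT}).
Variable R : fieldType.
Hypothesis R0 : (#|G|%:R : R) != 0.

(** Orbit-stabiliser: a sum over all points is a sum over orbit representatives,
    weighted by the inverse orders of the stabilisers. *)
Lemma sum_orbit_transversal (g : rT -> R) :
    (forall a x, a \in G -> g (to x a) = g x) ->
  \sum_(x in orbit_transversal to G setT) #|'C_G[x | to]%g|%:R^-1 * g x
  = #|G|%:R^-1 * \sum_x g x.
Proof.
move=> gG; have actsG : [acts G, on setT | to].
  by apply/actsP => a _ x; rewrite !inE.
have [_ _ inX repX] := orbit_transversalP actsG.
set X := orbit_transversal to G setT in inX repX *.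
have -> : \sum_x g x = \sum_(y in X) \sum_(x in orbit to G y) g x.
  rewrite (exchange_big_dep xpredT) //=; apply: eq_bigr => x _.
  have [a Ga Xxa] := repX x (in_setT x).
  rewrite (big_pred1 (to x a)) // => y; rewrite [RHS]inE.
  apply/andP/eqP => [[Xy xy]|->]; last by rewrite Xxa orbit_sym mem_orbit.
  apply/eqP; rewrite -inX //; case/orbitP: xy => b Gb <-.
  by rewrite -actM mem_orbit ?groupM.
rewrite mulr_sumr; apply: eq_bigr => y _.
rewrite (eq_bigr (fun=> g y)) => [|x /orbitP[a Ga <-]]; last exact: gG.
rewrite sumr_const -(card_orbit_stab to G y) natrM invfM -[g y *+ _]mulr_natl.
have orb0 : #|orbit to G y|%:R != 0 :> R.
  by apply: contraNneq R0 => e; rewrite -(card_orbit_stab to G y) natrM e mul0r.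
by rewrite mulrACA mulVf // mul1r.
Qed.

End OrbitSum.

Section Split.
Variables (V : finType) (G : graph V) (U : {set V}).

Lemma restr_perm_subE (s : {perm V}) : (forall v, (s v \in U) = (v \in U)) ->
  forall x, val (restr_perm_sub U s x) = s (val x).
Proof.
move=> sU; pose f := [ffun x : {x : V | x \in U} => insubd x (s (val x))].
have fE x : val (f x) = s (val x).
  by rewrite ffunE val_insubd /= sU (valP x).
have injf : injective f.
  by move=> x y e; apply/val_inj/(@perm_inj _ s); rewrite -!fE e.
by move=> x; rewrite /restr_perm_sub insubd_permE // fE.
Qed.

Lemma aut_stabP s :
  reflect (s \in graph_aut G /\ forall v, (s v \in U) = (v \in U)) (s \in aut_stab G U).
Proof.
apply: (iffP setIP) => -[Gs]; first by move/astabsP.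
by move=> h; split=> //; apply/astabsP.
Qed.

Lemma restr_perm_sub_aut (s : {perm V}) : (forall v, (s v \in U) = (v \in U)) -> s \in graph_aut G ->
  restr_perm_sub U s \in graph_aut (induced G U).
Proof.
move=> sU Gs; apply: mem_graph_aut => e; rewrite !inE => h.
suff -> : val @: (restr_perm_sub U s @: e) = s @: (val @: e) by rewrite aut_edges.
by rewrite -!imset_comp; apply: eq_imset => x /=; rewrite restr_perm_subE.
Qed.

End Split.

Section SplitPerm.
Variables (V : finType) (G : graph V) (U : {set V}).

Lemma aut_stabC s : s \in aut_stab G U -> forall v, (s v \in ~: U) = (v \in ~: U).
Proof. by move=> /aut_stabP[_ sU] v; rewrite !inE sU. Qed.

Lemma split_perm_aut s : s \in aut_stab G U ->
  split_perm U s \in setX (graph_aut (induced G U)) (graph_aut (induced G (~: U))).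
Proof.
move=> Gs; have [Gs1 sU] := aut_stabP _ _ _ Gs; rewrite in_setX.
by rewrite (restr_perm_sub_aut sU) // (restr_perm_sub_aut (aut_stabC Gs)).
Qed.

Lemma split_permM : {in aut_stab G U &, {morph split_perm U : s t / (s * t)%g}}.
Proof.
move=> s t Gs Gt.
have [[_ sU] [_ tU]] := (aut_stabP _ _ _ Gs, aut_stabP _ _ _ Gt).
have [sC tC] := (aut_stabC Gs, aut_stabC Gt).
congr (_, _); apply/permP => x; apply: val_inj.
  by rewrite permM !restr_perm_subE ?permM // => v; rewrite permM tU sU.
by rewrite permM !restr_perm_subE ?permM // => v; rewrite permM tC sC.
Qed.

End SplitPerm.

Section Comultiplication.
Variable k : closedFieldType.
Hypothesis char0 : [pchar k] =i pred0.
Implicit Types psi phi theta : family k.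

(** Naturality for the inclusion of [U]. *)
Lemma natural_induced psi (V : finType) (G : graph V) (U : {set V})
    (s : {perm V}) : natural psi -> (forall v, (s v \in U) = (v \in U)) ->
  psi _ (edges (induced G U)) (restr_perm_sub U s) setT = psi V (edges G) s U.
Proof.
move=> [_ inv] sU; have valU : val @: [set: {x : V | x \in U}] = U.
  apply/setP => v; apply/imsetP/idP => [[x _ ->]|vU]; first exact: valP.
  by exists (Sub v vU).
rewrite -[in RHS]valU; symmetry; apply: inv; first exact: val_inj.
  by move=> x _; rewrite restr_perm_subE.
by move=> e _; rewrite inE.
Qed.

Lemma pair2_box_split psi phi (V W : finType) (G : graph V) (H : graph W) n
    (r : mx_representation k (setX (graph_aut G) (graph_aut H)) n) :
    natural psi -> natural phi ->
  pair2 psi phi (box_split r) = #|setX (graph_aut G) (graph_aut H)|%:R^-1 *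
    \sum_(x in setX (graph_aut G) (graph_aut H))
       \tr (r x) * (psi V (edges G) x.1 setT * phi W (edges H) x.2 setT).
Proof.
move=> np nq; rewrite /box_split !(additive_map_sum (pair2_additive char0 np nq)).
have e i j : pair2 psi phi (tens (aclass (irr_repr i)) (aclass (irr_repr j))
      *+ multiplicity r (box_comp (i, j)))
  = #|setX (graph_aut G) (graph_aut H)|%:R^-1 *
    \sum_(x in setX (graph_aut G) (graph_aut H))
      (multiplicity r (box_comp (i, j)))%:R * (\tr (irr_repr i x.1) * \tr (irr_repr j x.2)) *
        (psi V (edges G) x.1 setT * phi W (edges H) x.2 setT).
  rewrite (additive_mapMn (pair2_additive char0 np nq)) pair2_tens // !(pair_aclass char0) //.
  rewrite /rep_pair card_setX natrM invfM mulrACA -mulrnAr; congr (_ * _).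
  rewrite big_distrlr (sum_setX _ _ (fun s t => (multiplicity r (box_comp (i, j)))%:R *
    (\tr (irr_repr i s) * \tr (irr_repr j t)) *
        (psi V (edges G) s setT * phi W (edges H) t setT))).
  rewrite -mulr_natl mulr_sumr; apply: eq_bigr => s _; rewrite mulr_sumr.
  by apply: eq_bigr => t _; rewrite -mulrA [in RHS]mulrACA.
transitivity (\sum_i \sum_j (#|setX (graph_aut G) (graph_aut H)|%:R^-1 *
    \sum_(x in setX (graph_aut G) (graph_aut H))
      (multiplicity r (box_comp (i, j)))%:R * (\tr (irr_repr i x.1) * \tr (irr_repr j x.2)) *
        (psi V (edges G) x.1 setT * phi W (edges H) x.2 setT))).
  apply: eq_bigr => i _; rewrite (additive_map_sum (pair2_additive char0 np nq)).
  by apply: eq_bigr => j _; rewrite -e.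
under eq_bigr => i _ do rewrite -mulr_sumr exchange_big.
rewrite -mulr_sumr exchange_big; congr (_ * _); apply: eq_bigr => x Hx.
rewrite (mxtrace_box_split char0) // mulr_suml; apply: eq_bigr => i _.
by rewrite mulr_suml.
Qed.

(** Frobenius reciprocity turns the summand of [U] into a sum over the stabiliser of
    [U].  As families vanish off stable sets, it extends to a sum over Aut G; the
    sum over orbit representatives then becomes a sum over all [U], which is the
    convolution. *)
Lemma pair2_Acomul_rep psi phi (V : finType) (G : graph V) n
    (r : mx_representation k (graph_aut G) n) :
  natural psi -> natural phi -> pair2 psi phi (Acomul_rep r) = rep_pair (fconv psi phi) r.
Proof.
move=> np nq; rewrite /Acomul_rep (additive_map_sum (pair2_additive char0 np nq)).
pose F (U : {set V}) s := psi V (edges G) s U * phi V (edges G) s (~: U).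
transitivity (\sum_(U in orbit_transversal ('P^*)%act (graph_aut G) setT)
   #|'C_(graph_aut G)[U | 'P^*]%g|%:R^-1 * \sum_(s in graph_aut G) \tr (r s) * F U s).
  apply: eq_bigr => U _; rewrite pair2_box_split //.
  pose c x := psi _ (edges (induced G U)) x.1 setT * phi _ (edges (induced G (~: U))) x.2 setT.
  rewrite (frobenius char0 _ (c := c)); first last.
  - move=> [g1 g2] [x1 x2] /setXP[G1 G2] _; rewrite /c.
    by rewrite (natural_conj _ np G1) (natural_conj _ nq G2).
  - exact: split_permM.
  - exact: split_perm_aut.
  rewrite astab1_set; congr (_ * _).
  rewrite [RHS](bigID (mem (aut_stab G U))) /= [X in _ + X]big1 ?addr0.
    rewrite [RHS](eq_bigl (mem (aut_stab G U))) => [|s].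
      apply: eq_bigr => s Gs; rewrite /c /=.
      have [Gs1 sU] := aut_stabP _ _ _ Gs.
      by rewrite !natural_induced //; exact: aut_stabC Gs.
    by rewrite /=; case: aut_stabP => [[->]|]; rewrite ?andbF.
  (* A permutation that moves [U] contributes 0. *)
  move=> s /andP[Gs nGs]; rewrite /F.
  suff -> : psi V (edges G) s U = 0 by rewrite mul0r mulr0.
  apply/eqP; apply: contraNT nGs => /(np.1 _ _ _ _) sU; apply/aut_stabP; split=> // v.
  by rewrite -{1}sU mem_imset //; exact: perm_inj.
rewrite (sum_orbit_transversal (cardG_neq0 char0 _)); last first.
  move=> a U Ga; rewrite (reindex_inj (conjg_inj a)).
  apply: eq_big => [s|s]; rewrite groupJr // => Gs.
  have js v : a (s v) = (s ^ a)%g (a v) by rewrite conjgE !permM permK.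
  have aE (S : {set V}) : ('P^*)%act S a = a @: S by [].
  have aC : ~: (a @: U) = a @: (~: U).
    by rewrite -!setTD imsetD_inj ?imset_perm1 //; [congr (_ :\: _); apply/setP => v;
       rewrite inE; apply/esym/imsetP; exists (a^-1 v)%g; rewrite ?inE ?permKV | exact: perm_inj].
  rewrite /F aE aC (np.2 _ _ a (edges G) _ s) ?(nq.2 _ _ a (edges G) _ s) //;
    try exact: perm_inj; try by move=> e _; exact: aut_edges.
  congr (_ * _); rewrite conjgE !repr_mxM ?groupM ?groupV //.
  by rewrite mxtrace_mulC -mulmxA -repr_mxM ?groupV // mulgV repr_mx1 mulmx1.
rewrite exchange_big /=; congr (_ * _); apply: eq_bigr => s _.
rewrite -mulr_sumr; congr (_ * _); apply: eq_big => [U|U _]; first by rewrite subsetT.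
by rewrite /F setTD.
Qed.

Lemma pair2_comul psi phi (x : Arep k) : natural psi -> natural phi ->
  pair2 psi phi (@hcomul (rep_hopf k) x) = pair (fconv psi phi) x.
Proof.
move=> np nq; rewrite /= /Acomul /Alift flift_sum.
rewrite (additive_map_sum (pair2_additive char0 np nq)).
rewrite /pair /Alift flift_sum; apply: eq_bigr => a _.
by rewrite (additive_mapMz (pair2_additive char0 np nq)) pair2_Acomul_rep.
Qed.

End Comultiplication.

(** * The Hopf algebra of representations of graph automorphism groups *)

Section HopfAxioms.
Variable k : closedFieldType.
Hypothesis char0 : [pchar k] =i pred0.
Implicit Types psi phi theta : family k.
Local Notation H := (rep_hopf k).
Local Notation "x ** y" := (@hmul (rep_hopf k) x y) (at level 40).
Local Notation D := (@hcomul (rep_hopf k)).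

Lemma pair_addf psi phi theta x :
    (forall V E t T, theta V E t T = psi V E t T + phi V E t T) ->
  pair theta x = pair psi x + pair phi x.
Proof.
move=> e; rewrite (pair_sum_family (P := xpredT) (psi := fun b : bool => if b then psi else phi)).
  by rewrite big_bool.
by move=> V E t T; rewrite big_bool e.
Qed.

Lemma pair_scale psi phi c x : (forall V E t T, phi V E t T = c * psi V E t T) ->
  pair phi x = c * pair psi x.
Proof.
move=> e; rewrite /pair /Alift !flift_sum mulr_sumr; apply: eq_bigr => a _.
rewrite mulrzAr; congr (_ *~ _); rewrite /irr_pair /rep_pair mulrCA; congr (_ * _).
by rewrite mulr_sumr; apply: eq_bigr => s _; rewrite e mulrCA.
Qed.

Definition pair_weight (x : Arep k) (a : irr_label k) (s : {perm 'I_(lab_order a)}) : k :=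
  (#|graph_aut (lab_graph a)|%:R^-1 * \tr (irr_repr (lab_irr a) s)) *~ coeff a (zrepr x).

Lemma pairE psi x : pair psi x = \sum_(a <- dom (zrepr x)) \sum_(s in graph_aut (lab_graph a))
  pair_weight x s * psi _ (edges (lab_graph a)) s setT.
Proof.
rewrite /pair /Alift flift_sum; apply: eq_bigr => a _.
rewrite /irr_pair /rep_pair mulr_sumr mulrz_suml; apply: eq_bigr => s _.
by rewrite /pair_weight mulrzAl mulrA.
Qed.

(** Both pairings are finite weighted sums. *)
Lemma pair_exchange (f : forall V : finType, {set {set V}} -> {perm V} -> {set V} -> family k) x y :
  pair (fun V E t T => pair (f V E t T) y) x
  = pair (fun W F s S => pair (fun V E t T => f V E t T W F s S) x) y.
Proof.
rewrite !pairE.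
under eq_bigr => a _ do under eq_bigr => t _ do
  (rewrite pairE mulr_sumr; under eq_bigr => b _ do rewrite mulr_sumr).
under [RHS]eq_bigr => b _ do under eq_bigr => s _ do
  (rewrite pairE mulr_sumr; under eq_bigr => a _ do rewrite mulr_sumr).
rewrite (eq_bigr (fun a => \sum_(b <- dom (zrepr y)) \sum_(s in graph_aut (lab_graph b))
    \sum_(t in graph_aut (lab_graph a)) pair_weight x t *
      (pair_weight y s * f _ (edges (lab_graph a)) t setT _ (edges (lab_graph b)) s setT))).
  rewrite exchange_big; apply: eq_bigr => b _.
  rewrite exchange_big; apply: eq_bigr => s _.
  by apply: eq_bigr => a _; apply: eq_bigr => t _; rewrite mulrCA.
by move=> a _; rewrite exchange_big; apply: eq_bigr => b _; rewrite exchange_big.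
Qed.

(** By the isomorphism of [V + W] with [W + V]. *)
Lemma slice_swap psi (V W : finType) (E : {set {set V}}) t T (F : {set {set W}}) s S :
  natural psi -> slice psi E t T F s S = slice psi F s S E t T.
Proof.
move=> [_ inv].
pose j (x : V + W) : W + V := match x with inl v => inr v | inr w => inl w end.
have injj : injective j by move=> [v|w] [v'|w'] //= [] ->.
have jl (e : {set V}) : j @: (inl @: e) = inr @: e.
  by rewrite -imset_comp; apply: eq_imset.
have jr (e : {set W}) : j @: (inr @: e) = inl @: e.
  by rewrite -imset_comp; apply: eq_imset.
have jT : j @: tsum T S = tsum S T by rewrite /tsum imsetU jl jr setUC.
rewrite /slice -jT; symmetry; apply: inv => //.
  by move=> [v|w] _ /=; rewrite ?dunion_perm_inl ?dunion_perm_inr /= ?dunion_perm_inr ?dunion_perm_inl.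
move=> e _; apply/dsumP/dsumP => -[][d dF ed].
- right; exists d => //; apply: (imset_inj injj); by rewrite ed jr.
- left; exists d => //; apply: (imset_inj injj); by rewrite ed jl.
- by right; exists d; rewrite // ed jl.
by left; exists d; rewrite // ed jr.
Qed.

(** By the isomorphism of [(V + W) + X] with [V + (W + X)]. *)
Lemma slice_assoc psi (V W X : finType) (E : {set {set V}}) t T (F : {set {set W}}) s S
    (L : {set {set X}}) r R : natural psi ->
  slice psi (dsum E F) (dunion_perm (t, s)) (tsum T S) L r R
  = slice (slice psi E t T) F s S L r R.
Proof.
move=> [_ inv].
pose j (x : V + W + X) : V + (W + X) :=
  match x with inl (inl v) => inl v | inl (inr w) => inr (inl w) | inr x => inr (inr x) end.
have injj : injective j by move=> [[v|w]|x] [[v'|w']|x'] //= [] ->.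
have j1 (e : {set V}) : j @: (inl @: (inl @: e)) = inl @: e.
  by rewrite -!imset_comp; apply: eq_imset.
have j2 (e : {set W}) : j @: (inl @: (inr @: e)) = inr @: (inl @: e).
  by rewrite -!imset_comp; apply: eq_imset.
have j3 (e : {set X}) : j @: (inr @: e) = inr @: (inr @: e).
  by rewrite -!imset_comp; apply: eq_imset.
have jT : j @: tsum (tsum T S) R = tsum T (tsum S R).
  by rewrite /tsum !imsetU j1 j2 j3 -setUA.
rewrite /slice -jT; symmetry; apply: inv => //.
  by move=> [[v|w]|x] _ /=; rewrite !(dunion_perm_inl, dunion_perm_inr).
move=> e _; apply/dsumP/dsumP.
  case=> -[d dF ed].
    left; exists (inl @: d); last by apply: (imset_inj injj); rewrite ed j1.
    by apply/dsumP; left; exists d.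
  case/dsumP: dF => -[d' d'F dE].
    left; exists (inr @: d'); last by apply: (imset_inj injj); rewrite ed dE j2.
    by apply/dsumP; right; exists d'.
  by right; exists d'; last by apply: (imset_inj injj); rewrite ed dE j3.
case=> -[d dF ed].
  case/dsumP: dF => -[d' d'F dE].
    by left; exists d'; rewrite // ed dE j1.
  by right; exists (inl @: d'); [apply/dsumP; left; exists d' | rewrite ed dE j2].
by right; exists (inr @: d); [apply/dsumP; right; exists d | rewrite ed j3].
Qed.

Lemma Amul_comm (x y : Arep k) : x ** y = y ** x.
Proof.
apply: (Arep_eq char0) => psi np; rewrite !pair_mul // /slices pair_exchange.
apply: eq_pair => n G s; apply: eq_pair => m G' s'; exact: slice_swap.
Qed.

Lemma AmulDl (x x' y : Arep k) : (x + x') ** y = x ** y + x' ** y.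
Proof.
apply: (Arep_eq char0) => psi np.
by rewrite (pair_additive char0 np) !pair_mul // (pair_additive char0 (natural_slices _ np)).
Qed.

Lemma AmulDr (x y y' : Arep k) : x ** (y + y') = x ** y + x ** y'.
Proof. by rewrite Amul_comm AmulDl !(Amul_comm x). Qed.

Lemma Amul_assoc (x y z : Arep k) : x ** (y ** z) = (x ** y) ** z.
Proof.
apply: (Arep_eq char0) => psi np; rewrite !pair_mul //; last exact: natural_slices.
apply: eq_pair => n G s; rewrite /slices pair_mul //; last exact: natural_slice.
apply: eq_pair => m G' s'; rewrite /slices /slice; apply: eq_pair => d G'' s''.
by rewrite -[RHS]/(slice psi _ _ _ _ _ _) slice_assoc.
Qed.

Lemma card_aut_ord0 (G : graph 'I_0) : #|graph_aut G| = 1%N.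
Proof.
rewrite -(cards1 (1%g : {perm 'I_0})); apply: eq_card => s.
by rewrite (_ : s = 1%g) ?group1 ?set11 //; apply/permP => -[].
Qed.

Lemma set_ord0 (S T : {set 'I_0}) : S = T.
Proof. by apply/setP => -[]. Qed.

Lemma edges_ord0 (G : graph 'I_0) : edges G = set0.
Proof.
apply/setP => e; rewrite inE; apply/negP => /(edges2P _ (edges2 G)).
by rewrite (set_ord0 e set0) cards0.
Qed.

Lemma rep_pair_ord0 psi (G : graph 'I_0) n (r : mx_representation k (graph_aut G) n) :
  rep_pair psi r = n%:R * psi 'I_0 set0 1%g set0.
Proof.
rewrite /rep_pair card_aut_ord0 invr1 mul1r (big_pred1 1%g).
  by rewrite repr_mx1 mxtrace1 edges_ord0 (set_ord0 setT set0).
move=> s; have -> : s = 1%g by apply/permP => -[].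
by rewrite group1 /= eqxx.
Qed.

Lemma pair_one psi : natural psi -> pair psi (Aone k) = psi 'I_0 set0 1%g set0.
Proof. by move=> np; rewrite (pair_aclass char0) // rep_pair_ord0 mul1r. Qed.

Lemma Amul1 (x : Arep k) : Aone k ** x = x.
Proof.
apply: (Arep_eq char0) => psi np; rewrite pair_mul // pair_one; last exact: natural_slices.
apply: eq_pair => n G s; have [_ inv] := np.
rewrite /slice (_ : tsum _ _ = inr @: setT); last first.
  by rewrite /tsum imset0 set0U.
apply: inv; first exact: inr_inj.
  by move=> v _; rewrite dunion_perm_inr.
move=> e _; apply/dsumP/idP => [[[d]|[d dG /imset_inj->//]]|eG]; rewrite ?inE //.
  exact: inr_inj.
by right; exists e.
Qed.

Lemma rep_algebra : algebra_axioms H.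
Proof.
split.
- by split=> [y x x'|x y y']; [exact: AmulDl | exact: AmulDr].
- exact: Amul_assoc.
- exact: Amul1.
by move=> x; rewrite Amul_comm; exact: Amul1.
Qed.

Lemma AcomulD : additive_map D.
Proof.
move=> x y; apply: (Arep2_eq char0) => psi phi np nq.
rewrite (pair2_additive char0 np nq) !pair2_comul //.
exact/(pair_additive char0)/natural_conv.
Qed.

(** The multiplicity of the trivial representation is the average of the character. *)
Lemma rep_pair_triv (V : finType) (G : graph V) (i : Irr k (graph_aut G)) :
  #|graph_aut G|%:R^-1 * \sum_(s in graph_aut G) \tr (irr_repr i s) = (is_triv i)%:R.
Proof.
pose t := triv_repr k (graph_aut G); pose l := irr_comp (Irr k (graph_aut G)) t.
have irr_t : mx_irreducible t by apply/mx_abs_irrW/linear_mx_abs_irr.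
have -> : is_triv i = (l == i).
  apply/asboolP/eqP => [h|<-].
    rewrite -[RHS](irr_reprK (pchar'_group char0 (graph_aut G))); apply/esym.
    exact: (irr_comp_rsim _ (pchar'_group char0 (graph_aut G)) h).
  apply/mx_rsim_sym/(rsim_irr_comp _ (pchar'_group char0 (graph_aut G)) irr_t).
rewrite -(cfdot_irr char0); congr (_ * _); apply: eq_bigr => s Gs.
by rewrite irr_comp_trace ?groupV // mxtrace1 mul1r.
Qed.

Lemma counitE (x : Arep k) : (Acounit x)%:~R = pair (fone k) x.
Proof.
rewrite /Acounit /pair /Alift !flift_sum rmorph_sum; apply: eq_bigr => a _.
rewrite rmorphMz; congr (_ *~ _); rewrite /irr_pair /rep_pair /fone.
rewrite -cards_eq0 cardsT card_ord -mulr_suml mulrA rep_pair_triv.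
by rewrite -natrM mulnb andbC pmulrn.
Qed.

Lemma AcounitD : additive_map (@Acounit k).
Proof.
move=> x y; apply: (intr_inj_char0 char0); rewrite /= rmorphD /= !counitE.
exact/(pair_additive char0)/natural_one.
Qed.

Lemma pair_counit_l psi (t : tensor (Arep k) (Arep k)) : natural psi ->
  pair psi (tlift (fun a b => b *~ Acounit a) t) = pair2 (fone k) psi t.
Proof.
move=> np; have n1 := natural_one k; have pD := pair_additive char0 np.
have bil : bilinear2 (fun a b : Arep k => b *~ Acounit a).
  by split=> [b a a'|a b b'] /=; rewrite ?mulrzDl ?AcounitD ?mulrzDr.
move: t; apply: tensor_additive_eq.
- by move=> s t; rewrite (tlift_additive bil) pD.
- exact: pair2_additive.
by move=> a b; rewrite tliftE // (additive_mapMz pD) pair2_tens // -counitE mulrzl.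
Qed.

Lemma tswap_additive : additive_map (@tswap (Arep k) (Arep k)).
Proof. exact/tlift_additive/tswap_bilinear. Qed.

Lemma pair2_swap psi phi t : natural psi -> natural phi ->
  pair2 psi phi (tswap t) = pair2 phi psi t.
Proof.
move=> np nq; move: t; apply: tensor_additive_eq.
- by move=> s t; rewrite tswap_additive (pair2_additive char0 np nq).
- exact: pair2_additive.
move=> a b; rewrite /tswap tliftE; last exact: tswap_bilinear.
by rewrite !pair2_tens // mulrC.
Qed.

Lemma rep_cocommutative : cocommutative_hopf H.
Proof.
move=> x; apply: (Arep2_eq char0) => psi phi np nq.
by rewrite pair2_swap // !pair2_comul // fconvC.
Qed.

Lemma counit_l (x : Arep k) : tlift (fun a b => b *~ Acounit a) (D x) = x.
Proof.
apply: (Arep_eq char0) => psi np; rewrite pair_counit_l // pair2_comul ?fconv1 //.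
exact: natural_one.
Qed.

Lemma counit_r (x : Arep k) : tlift (fun a b => a *~ Acounit b) (D x) = x.
Proof.
rewrite -[RHS]counit_l -[in RHS](rep_cocommutative x).
move: (D x); apply: tensor_additive_eq => [||a b].
- by apply: tlift_additive; split=> [b a a'|a b b'] /=; rewrite ?mulrzDl ?AcounitD ?mulrzDr.
- move=> s t; rewrite tswap_additive; apply: tlift_additive.
  by split=> [b a a'|a b b'] /=; rewrite ?mulrzDl ?AcounitD ?mulrzDr.
rewrite /tswap !tliftE //; try exact: tswap_bilinear;
  by split=> [b' a' a''|a' b' b''] /=; rewrite ?mulrzDl ?AcounitD ?mulrzDr.
Qed.

Lemma pair3_coassoc_l psi phi theta t : natural psi -> natural phi -> natural theta ->
  pair3 psi phi theta (tassoc (tmap D id t)) = pair2 (fconv psi phi) theta t.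
Proof.
move=> np nq nr; have idD : additive_map (@id (Arep k)) by [].
have nc := natural_conv np nq; have p3 := pair3_additive char0 np nq nr.
move: t; apply: tensor_additive_eq.
- by move=> s t; rewrite (tmap_additive AcomulD idD) tassoc_additive p3.
- exact: pair2_additive.
move=> x z; rewrite (tmap_tens _ _ AcomulD idD) pair2_tens // -pair2_comul //.
move: (D x); apply: tensor_additive_eq.
- by move=> s t; rewrite (tens_bilinear _ _).1 tassoc_additive p3.
- by move=> s t; rewrite (pair2_additive char0 np nq) mulrDl.
by move=> a b; rewrite tassoc_tens pair3_tens // !pair2_tens // mulrA.
Qed.

Lemma pair3_coassoc_r psi phi theta t : natural psi -> natural phi -> natural theta ->
  pair3 psi phi theta (tmap id D t) = pair2 psi (fconv phi theta) t.
Proof.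
move=> np nq nr; have idD : additive_map (@id (Arep k)) by [].
have nc := natural_conv nq nr; have p3 := pair3_additive char0 np nq nr.
move: t; apply: tensor_additive_eq.
- by move=> s t; rewrite (tmap_additive idD AcomulD) p3.
- exact: pair2_additive.
by move=> x z; rewrite (tmap_tens _ _ idD AcomulD) pair3_tens // pair2_comul // pair2_tens.
Qed.

Lemma rep_coalgebra : coalgebra_axioms H.
Proof.
split.
- exact: AcomulD.
- exact: AcounitD.
- move=> x; apply: (Arep3_eq char0) => psi phi theta np nq nr.
  rewrite pair3_coassoc_l // pair3_coassoc_r // !pair2_comul ?fconvA //; exact: natural_conv.
- exact: counit_l.
exact: counit_r.
Qed.

End HopfAxioms.

Section Bialgebra.
Variable k : closedFieldType.
Hypothesis char0 : [pchar k] =i pred0.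
Implicit Types psi phi theta : family k.
Local Notation H := (rep_hopf k).
Local Notation "x ** y" := (@hmul (rep_hopf k) x y) (at level 40).
Local Notation D := (@hcomul (rep_hopf k)).

Lemma tmul_bilinear_in (a b : Arep k) :
  bilinear2 (fun c d : Arep k => tens (a ** c) (b ** d) : tensor (Arep k) (Arep k)).
Proof. by apply: tmap_bilinear; exact: AmulDr. Qed.

Lemma tmul_bilinear (t : tensor (Arep k) (Arep k)) : bilinear2 (fun a b : Arep k =>
  tlift (fun c d => tens (a ** c) (b ** d)) t : tensor (Arep k) (Arep k)).
Proof.
split=> [b a a'|a b b'] /=; move: t; apply: tensor_additive_eq.
- exact/tlift_additive/tmul_bilinear_in.
- by move=> s t; rewrite !(tlift_additive (tmul_bilinear_in _ _)) addrACA.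
- move=> c d; rewrite !tliftE; try exact: tmul_bilinear_in.
  by have /= -> := AmulDl char0 a a' c; rewrite (tens_bilinear _ _).1.
- exact/tlift_additive/tmul_bilinear_in.
- by move=> s t; rewrite !(tlift_additive (tmul_bilinear_in _ _)) addrACA.
move=> c d; rewrite !tliftE; try exact: tmul_bilinear_in.
by have /= -> := AmulDl char0 b b' d; rewrite (tens_bilinear _ _).2.
Qed.

Lemma tmulDl t : additive_map (fun s : tensor (Arep k) (Arep k) => @tmul H s t).
Proof. exact/tlift_additive/tmul_bilinear. Qed.

Lemma tmulDr s : additive_map (@tmul H s).
Proof.
move=> t t'; move: s; apply: tensor_additive_eq; first exact: tmulDl.
  by move=> s s'; rewrite !tmulDl addrACA.
move=> a b; rewrite /tmul !tliftE; try exact: tmul_bilinear.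
exact: (tlift_additive (tmul_bilinear_in _ _)).
Qed.

Lemma tmul_tens (a b c d : Arep k) :
  @tmul H (tens a b) (tens c d) = tens (a ** c) (b ** d).
Proof. by rewrite /tmul !tliftE //; [exact: tmul_bilinear_in|exact: tmul_bilinear]. Qed.

Lemma big_sub_tsum (R : nmodType) (V W : finType) (T : {set V}) (S : {set W})
    (F : {set (V + W)%type} -> R) :
  \sum_(Q : {set (V + W)%type} | Q \subset tsum T S) F Q
  = \sum_(U : {set V} | U \subset T) \sum_(U' : {set W} | U' \subset S) F (tsum U U').
Proof.
rewrite pair_big /= (reindex_onto (fun p => tsum p.1 p.2)
  (fun Q => (inl @^-1: Q : {set V}, inr @^-1: Q : {set W}))) /=; last first.
  move=> Q _; apply/setP => -[v|w]; by rewrite ?mem_tsum_inl ?mem_tsum_inr inE.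
apply: eq_bigl => -[U U'] /=.
have -> : (inl @^-1: tsum U U', inr @^-1: tsum U U') = (U, U').
  congr (_, _); apply/setP => v; by rewrite inE ?mem_tsum_inl ?mem_tsum_inr.
rewrite eqxx andbT; apply/subsetP/andP => [h|[/subsetP h /subsetP h'] [v|w]].
- split; apply/subsetP => v vU.
    by rewrite -(mem_tsum_inl _ S) h // mem_tsum_inl.
  by rewrite -(mem_tsum_inr T) h // mem_tsum_inr.
- by rewrite !mem_tsum_inl; exact: h.
by rewrite !mem_tsum_inr; exact: h'.
Qed.

Lemma tsumD (V W : finType) (T U : {set V}) (S U' : {set W}) :
  tsum T S :\: tsum U U' = tsum (T :\: U) (S :\: U').
Proof. by apply/setP => -[v|w]; rewrite inE ?mem_tsum_inl ?mem_tsum_inr inE. Qed.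

(** A subset of a disjoint union is a pair of subsets; this makes the coproduct
    multiplicative. *)
Lemma slice_conv psi phi (V W : finType) (E : {set {set V}}) t T (F : {set {set W}}) s S :
  slice (fconv psi phi) E t T F s S = \sum_(U : {set V} | U \subset T)
    fconv (slice psi E t U) (slice phi E t (T :\: U)) F s S.
Proof.
rewrite /slice /fconv big_sub_tsum; apply: eq_bigr => U _; apply: eq_bigr => U' _.
by rewrite tsumD.
Qed.

(** The functional [x |-> pair2 psi phi (D x * t)] is the pairing with this family (see
    [pair2_tmul]). *)
Definition slices2 psi phi t : family k := fun V E u T =>
  \sum_(S : {set V} | S \subset T) pair2 (slice psi E u S) (slice phi E u (T :\: S)) t.

Lemma pair2_tmul psi phi x t : natural psi -> natural phi ->
  pair2 psi phi (@tmul H (D x) t) = pair (slices2 psi phi t) x.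
Proof.
move=> np nq; have p2 := pair2_additive char0 np nq; move: t; apply: tensor_additive_eq.
- by move=> s t; rewrite tmulDr p2.
- move=> s t; apply: pair_addf => V E u T; rewrite /slices2 -big_split.
  apply: eq_bigr => S _ /=.
  by apply: (pair2_additive char0); exact: natural_slice.
move=> c d; transitivity (pair2 (slices psi c) (slices phi d) (D x)); last first.
  have [n1 n2] := (natural_slices c np, natural_slices d nq).
  rewrite pair2_comul //; apply: eq_pair => n G s; apply: eq_bigr => S _.
  by rewrite pair2_tens //; exact: natural_slice.
have [n1 n2] := (natural_slices c np, natural_slices d nq).
move: (D x); apply: tensor_additive_eq.
- by move=> s t; rewrite tmulDl p2.
- exact: pair2_additive.
by move=> a b; rewrite tmul_tens !pair2_tens // !pair_mul.
Qed.

Lemma AcomulM (x y : Arep k) : D (x ** y) = @tmul H (D x) (D y).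
Proof.
apply: (Arep2_eq char0) => psi phi np nq; have nc := natural_conv np nq.
rewrite pair2_tmul // pair2_comul // pair_mul //.
apply: eq_pair => n G s; rewrite /slices /slices2.
rewrite (pair_sum_family (P := fun S : {set 'I_n} => S \subset setT)
  (psi := fun S => fconv (slice psi (edges G) s S) (slice phi (edges G) s (setT :\: S)))).
  by apply: eq_bigr => S _; rewrite pair2_comul //; exact: natural_slice.
by move=> W F t T; rewrite slice_conv.
Qed.

(** This applies to the counit and to [zeta]. *)
Lemma pair_mul_char psi (x y : Arep k) : natural psi ->
    (forall (V W : finType) (E : {set {set V}}) t T (F : {set {set W}}) s S,
      slice psi E t T F s S = psi V E t T * psi W F s S) ->
  pair psi (x ** y) = pair psi x * pair psi y.
Proof.
move=> np e; rewrite pair_mul // mulrC; apply: pair_scale => V E t T.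
rewrite mulrC; apply: pair_scale => W F s S; exact: e.
Qed.

Lemma AcounitM (x y : Arep k) : Acounit (x ** y) = Acounit x * Acounit y.
Proof.
apply: (intr_inj_char0 char0); rewrite /= rmorphM /= !counitE //.
apply: pair_mul_char => [|V W E t T F s S]; first exact: natural_one.
rewrite /slice /fone -natrM mulnb; congr (nat_of_bool _)%:R.
apply/eqP/andP => [e|[/eqP-> /eqP->]]; last by rewrite /tsum !imset0 setU0.
split; apply/eqP/setP => v; rewrite inE.
  by rewrite -(mem_tsum_inl T S) e inE.
by rewrite -(mem_tsum_inr T S) e inE.
Qed.

Lemma rep_bialgebra : bialgebra_axioms H.
Proof.
split.
- exact: AcomulM.
- apply: (Arep2_eq char0) => psi phi np nq; have nc := natural_conv np nq.
  rewrite pair2_comul // pair2_tens // !pair_one // /fconv.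
  by rewrite (big_pred1 set0) ?setD0 // => S; rewrite /= subset0.
- exact: AcounitM.
apply: (intr_inj_char0 char0); rewrite /= counitE // pair_one //; last exact: natural_one.
by rewrite /fone eqxx.
Qed.

(** * The grading *)

Lemma Agrade0 n : Agrade n (0 : Arep k).
Proof. by exists 0; rewrite ?raddf0 // => a; rewrite dom0. Qed.

Lemma AgradeB n (x y : Arep k) : Agrade n x -> Agrade n y -> Agrade n (x - y).
Proof.
move=> [x' -> xn] [y' -> yn]; exists (x' - y'); first by rewrite raddfB.
by move=> a /domB; rewrite mem_cat => /orP[/xn|/yn].
Qed.

Lemma AgradeN n (x : Arep k) : Agrade n x -> Agrade n (- x).
Proof. by rewrite -[- x]sub0r; apply: AgradeB; exact: Agrade0. Qed.

Lemma AgradeD n (x y : Arep k) : Agrade n x -> Agrade n y -> Agrade n (x + y).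
Proof. by move=> hx hy; rewrite -[y]opprK; apply: AgradeB => //; exact: AgradeN. Qed.

Lemma Agrade_sum n (I : Type) (r : seq I) (P : pred I) (F : I -> Arep k) :
  (forall i, P i -> Agrade n (F i)) -> Agrade n (\sum_(i <- r | P i) F i).
Proof. by move=> h; apply: big_ind; [exact: Agrade0 | exact: AgradeD |]. Qed.

Lemma AgradeMz n (z : int) (x : Arep k) : Agrade n x -> Agrade n (x *~ z).
Proof.
move=> hx; have hn m : Agrade n (x *+ m) by elim: m => [|m]; [exact: Agrade0 | rewrite mulrS; exact: AgradeD].
by case: z => m; rewrite ?NegzE ?mulrNz -pmulrn //; exact: AgradeN.
Qed.

Lemma Agrade_lab (a : irr_label k) : Agrade (lab_order a) (lab_class a).
Proof.
rewrite -zpi_fgen //; exists (fgen a) => // b.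
by rewrite domU1 inE => /eqP ->.
Qed.

Lemma Agrade_aclass (V : finType) (G : graph V) n (r : mx_representation k (graph_aut G) n) :
  Agrade #|V| (aclass r).
Proof.
rewrite /aclass /rep_incl raddf_sum; apply: Agrade_sum => i _.
rewrite raddfMz; apply: AgradeMz; rewrite /= zpi_fgen //.
exact: (@Agrade_lab (IrrLabel i)).
Qed.

Lemma Agrade_span n (x : Arep k) : Agrade n x ->
  x \in gen_subgroup (fun y => exists2 a, lab_order a = n & y = lab_class a).
Proof.
move=> [y -> yn]; rewrite (freeg_sum_fgen y) raddf_sum big_seq.
apply: rpred_sum => a ay; rewrite raddfMz rpredMz //= zpi_fgen //.
by apply: gen_subgroup_mem; exists a; first exact: yn.
Qed.

Lemma Agrade_ind n (P : Arep k -> Prop) :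
    (forall a, lab_order a = n -> P (lab_class a)) -> P 0 ->
    (forall x y, P x -> P y -> P (x - y)) ->
  forall x, Agrade n x -> P x.
Proof.
move=> Pa P0 PB x /Agrade_span; apply: gen_subgroup_ind => // _ [a an ->].
exact: Pa.
Qed.

Definition degree_part (n : nat) psi : family k := fun V E t T =>
  (#|T| == n)%:R * psi V E t T.

Lemma natural_degree_part n psi : natural psi -> natural (degree_part n psi).
Proof.
move=> [ps pn]; rewrite /degree_part; split=> [V E t T|V W j E F s t T injj js jE].
  by rewrite mulf_eq0 negb_or => /andP[_ /ps].
by rewrite card_imset // (pn _ _ j E F s).
Qed.

Lemma pair_degree_part n m psi (x : Arep k) : natural psi -> Agrade n x ->
  pair (degree_part m psi) x = (n == m)%:R * pair psi x.
Proof.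
move=> np xn; have nd := natural_degree_part m np.
move: x xn; apply: Agrade_ind => [a <-||x y hx hy].
- rewrite !(pair_aclass char0) // /rep_pair mulrCA; congr (_ * _).
  rewrite mulr_sumr; apply: eq_bigr => s _.
  by rewrite mulrCA /degree_part cardsT card_ord.
- by rewrite !(additive_map0 (pair_additive char0 _)) ?mulr0.
by rewrite !(additive_mapB (pair_additive char0 _)) // hx hy mulrBr.
Qed.

Lemma rep_grading : grading_axioms H.
Proof.
split.
- by move=> n; split; [exact: Agrade0 | exact: AgradeB].
- move=> x; pose y := zrepr x.
  pose c n := \sum_(a <- dom y | lab_order a == n) lab_class a *~ coeff a y.
  pose N := (\max_(a <- dom y) lab_order a).+1.
  exists N, c; split.
    move=> n; apply: Agrade_sum => a /eqP <-; apply: AgradeMz; exact: Agrade_lab.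
  rewrite -[x]zreprK (freeg_sum_fgen (zrepr x)) raddf_sum big_seq.
  rewrite (partition_big (fun a => inord (lab_order a) : 'I_N) xpredT) //=.
  apply: eq_bigr => i _; rewrite [RHS]big_seq_cond /=.
  apply: eq_big => [a|a _]; last by rewrite raddfMz /= zpi_fgen.
  have [ay /=|//] := boolP (a \in dom y).
  rewrite -val_eqE /= inordK // ltnS /N.
  exact: leq_bigmax_seq.
(* Restricting a family to sets of size [n] extracts the component of degree [n]. *)
move=> N c cn c0 n ltnN; apply: (Arep_eq0 char0) => psi np.
have := pair_degree_part n np (cn n); rewrite eqxx mul1r => <-.
have nd := natural_degree_part n np; have pD := pair_additive char0 nd.
rewrite -[RHS](additive_map0 pD) -c0 (additive_map_sum pD).
rewrite (bigD1 (Ordinal ltnN)) //= big1 ?addr0 // => i ne.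
rewrite (pair_degree_part n np (cn i)) (_ : (i == n :> nat) = false) ?mul0r //.
by apply: contraNF ne => /eqP e; apply/eqP/val_inj.
Qed.

Lemma mul_lab (a b : irr_label k) : lab_class a ** lab_class b = Amul_irr a b.
Proof.
apply: (Arep_eq char0) => psi np; have ns := natural_slices (lab_class b) np.
rewrite pair_mul // pair_Amul_irr // (pair_aclass char0) //; congr (_ * _).
apply: eq_bigr => s _; congr (_ * _); rewrite /slices (pair_aclass char0) //.
exact: natural_slice.
Qed.

Lemma AgradeM m n (x y : Arep k) : Agrade m x -> Agrade n y -> Agrade (m + n) (x ** y).
Proof.
move=> hx hy; have xD (z : Arep k) : additive_map (fun x : Arep k => x ** z) by move=> *; exact: AmulDl.
have yD (z : Arep k) : additive_map (fun x : Arep k => z ** x) by move=> *; exact: AmulDr.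
move: x hx; apply: Agrade_ind => [a <-||x x' hx hx'].
- move: y hy; apply: Agrade_ind => [b <-||y y' hy' hy''].
  + rewrite mul_lab; have := Agrade_aclass.
    move=> /(_ ('I_(lab_order a) + 'I_(lab_order b))%type) h.
    by rewrite -[lab_order a]card_ord -[lab_order b]card_ord -card_sum; exact: h.
  + rewrite (additive_map0 (yD _)); exact: Agrade0.
  by rewrite (additive_mapB (yD _)); exact: AgradeB.
- rewrite (additive_map0 (xD _)); exact: Agrade0.
by rewrite (additive_mapB (xD _)); exact: AgradeB.
Qed.

Lemma comul_lab (a : irr_label k) : D (lab_class a) = Acomul_rep (irr_repr (lab_irr a)).
Proof.
apply: (Arep2_eq char0) => psi phi np nq; have nc := natural_conv np nq.
by rewrite pair2_comul // pair2_Acomul_rep // (pair_aclass char0).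
Qed.

Lemma Acomul_grade n (x : Arep k) : Agrade n x ->
  D x \in gen_subgroup (@pure_tensor_of_degree H n).
Proof.
move: x; apply: Agrade_ind => [a an||x y hx hy].
- rewrite comul_lab; apply: rpred_sum => U _; apply: rpred_sum => i _.
  apply: rpred_sum => j _; apply: rpredMn; apply: gen_subgroup_mem.
  apply: (@PureTensorOfDegree H n _ _ _ _ _ (Agrade_aclass _) (Agrade_aclass _)).
  by rewrite !card_sig -an -[RHS]card_ord -(cardsC U).
- by rewrite (additive_map0 (AcomulD char0)) rpred0.
by rewrite (additive_mapB (AcomulD char0)) rpredB.
Qed.

Lemma rep_graded : graded_structure H.
Proof.
split.
- by have := Agrade_aclass (triv_repr k (graph_aut empty_graph)); rewrite card_ord.
- exact: AgradeM.
- exact: Acomul_grade.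
move=> n x n_gt0 nx; apply: (intr_inj_char0 char0); rewrite /= counitE // mulr0z.
have := pair_degree_part 0 (natural_one k) nx; rewrite eqn0Ngt n_gt0 mul0r => <-.
apply: eq_pair => m G s; rewrite /degree_part /fone cards_eq0.
by case: eqP; rewrite ?mulr1 ?mulr0.
Qed.

Lemma irr_degree_ord0 (G : graph 'I_0) (i : Irr k (graph_aut G)) : irr_degree i = 1%N.
Proof.
have := sum_irr_degree (Irr k (graph_aut G)) (pchar'_group char0 _)
  (@group_closure_closed_field k _ _).
rewrite card_aut_ord0 (bigD1 i) //=; have := irr_degree_gt0 i.
by case: (irr_degree i) => [|[|m]].
Qed.

(** The automorphism group of the empty graph is trivial, so degree 0 is spanned by its
    one irreducible representation. *)
Lemma rep_connected : connected_hopf H.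
Proof.
move=> x x0; suff [z xz] : exists z : int, x = Aone k *~ z.
  exists z; split=> // z'; rewrite xz => e; apply: (intr_inj_char0 char0) => /=.
  have pD := pair_additive char0 (natural_one k).
  have := congr1 (pair (fone k)) e; rewrite !(additive_mapMz pD) pair_one //; last exact: natural_one.
  by rewrite /fone eqxx.
move: x x0; apply: Agrade_ind => [[n G i] /= n0||x y [z ->] [z' ->]].
- exists 1; rewrite mulr1z; move: G i; rewrite n0 => G i.
  apply: (Arep_eq char0) => psi np; rewrite (pair_aclass char0) // rep_pair_ord0.
  by rewrite pair_one // irr_degree_ord0 mul1r.
- by exists 0.
by exists (z - z'); rewrite mulrzBr.
Qed.

Lemma rep_graded_hopf : graded_hopf_algebra H.
Proof.
have alg := rep_algebra char0; have coalg := rep_coalgebra char0.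
split; last exact: rep_graded; last exact: rep_grading.
split=> //; first exact: rep_bialgebra.
exact: (antipode_exists alg coalg rep_bialgebra rep_grading rep_graded rep_connected).
Qed.

End Bialgebra.

(** * The embedding of the Hopf algebra of graphs *)

Lemma transport1 (V W : finType) (G : graph V) (H : graph W) (w : graph_iso G H) :
  transport w 1%g = 1%g.
Proof. by apply/permP => v; rewrite permE perm1 iso_funK perm1. Qed.

Lemma natural_iso1 (k : closedFieldType) (psi : family k) (V W : finType) (G : graph V) (H : graph W) :
  natural psi -> graph_iso G H -> psi V (edges G) 1%g setT = psi W (edges H) 1%g setT.
Proof. by move=> np w; rewrite -(natural_iso w 1%g np) transport1. Qed.

Lemma class_graph_iso (V : finType) (G : graph V) :
  inhabited (graph_iso (std_graph G) (class_graph (graph_class_of G))).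
Proof.
apply/asboolP; rewrite -[asbool _]/(isomorphic (StdGraph (std_graph G)) _).
have : (\pi_({eq_quot isomorphic}) (generic_quotient.repr
  (\pi_({eq_quot isomorphic}) (StdGraph (std_graph G)))))%qT
  = (\pi_({eq_quot isomorphic}) (StdGraph (std_graph G)))%qT by rewrite reprK.
by move/eqmodP => /=; rewrite /isomorphic_equiv_rel /= equiv_sym.
Qed.

Lemma isomorphic_class_graph (c d : graph_class) (w : graph_iso (class_graph c) (class_graph d)) : c = d.
Proof.
rewrite -[c]reprK -[d]reprK; apply/eqmodP.
by apply/asboolP; constructor; exact: w.
Qed.

Lemma freeg_additive_eq (T : choiceType) (M : zmodType) (f g : {freeg T / int} -> M) :
  additive_map f -> additive_map g -> (forall t, f (fgen t) = g (fgen t)) -> f =1 g.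
Proof.
move=> fD gD fg x; rewrite (freeg_sum_fgen x) (additive_map_sum fD) (additive_map_sum gD).
by apply: eq_bigr => t _; rewrite (additive_mapMz fD) (additive_mapMz gD) fg.
Qed.

Section StableSets.
Variables (V W : finType) (j : V -> W) (E : {set {set V}}) (F : {set {set W}}).
Variables (s : {perm V}) (t : {perm W}) (T : {set V}).
Hypothesis injj : injective j.
Hypothesis js : {in T, forall v, j (s v) = t (j v)}.
Hypothesis jE : forall e : {set V}, e \subset T -> (j @: e \in F) = (e \in E).

Lemma stable_imset : (t @: (j @: T) == j @: T) = (s @: T == T).
Proof.
have -> : t @: (j @: T) = j @: (s @: T).
  by rewrite -!imset_comp; apply: eq_in_imset => v vT /=; rewrite js.
exact: (inj_eq (imset_inj injj)).
Qed.

(** Families are evaluated at arbitrary set systems; only two-element sets count as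
    edges, so that the empty vertex set is always edgeless. *)
Definition edgeless (U : finType) (D : {set {set U}}) (S : {set U}) : bool :=
  [forall e : {set U}, (e \in D) ==> (e \subset S) ==> (#|e| != 2%N)].

Lemma edgeless_imset : edgeless F (j @: T) = edgeless E T.
Proof.
apply/forallP/forallP => h e; apply/implyP => eE; apply/implyP => eT.
  have := h (j @: e); rewrite jE // eE imsetS //= card_imset //.
have e' : e = j @: (j @^-1: e).
  apply/setP => w; apply/idP/imsetP => [we|[v]]; last by rewrite inE => ? ->.
  by have /imsetP[v _ wv] := subsetP eT w we; exists v; rewrite // inE -wv.
have eT' : j @^-1: e \subset T.
  apply/subsetP => v; rewrite inE => /(subsetP eT)/imsetP[u uT].
  by move/injj ->.
have := h (j @^-1: e); rewrite -jE // -e' eE eT' /=.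
by rewrite {2}e' card_imset.
Qed.

End StableSets.

Section Regular.
Variable k : closedFieldType.
Hypothesis char0 : [pchar k] =i pred0.
Implicit Types psi phi : family k.

(** The regular character vanishes except at the identity. *)
Lemma pair_regular psi (V : finType) (G : graph V) : natural psi ->
  pair psi (aclass (regular_repr k (graph_aut G))) = psi V (edges G) 1%g setT.
Proof.
move=> np; rewrite (pair_aclass char0) // /rep_pair.
rewrite (eq_bigr (fun s => if s == 1%g then #|graph_aut G|%:R * psi V (edges G) 1%g setT else 0)).
  rewrite -big_mkcondr (big_pred1 1%g) => [|s]; last first.
    by rewrite [RHS]inE; case: eqP => [->|]; rewrite ?group1 ?andbF.
  by rewrite mulrA mulVf ?mul1r // cardG_neq0.
by move=> s Gs; rewrite mxtrace_regular //; case: eqP => [->//|_]; rewrite mul0r.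
Qed.

Lemma reg_gclass (V : finType) (G : graph V) :
  reg_map k (gclass G) = aclass (regular_repr k (graph_aut G)).
Proof.
rewrite /reg_map /gclass flift_fgen; apply: (Arep_eq char0) => psi np.
rewrite !pair_regular //; have [w] := class_graph_iso G.
by rewrite -(natural_iso1 np w) -(natural_iso1 np (std_iso G)).
Qed.

Lemma reg_additive : additive_map (reg_map k).
Proof. by move=> x y; rewrite /reg_map raddfD. Qed.

Lemma pair_reg psi c : natural psi ->
  pair psi (reg_map k (fgen c)) = psi _ (edges (class_graph c)) 1%g setT.
Proof. by move=> np; rewrite /reg_map flift_fgen pair_regular. Qed.

Lemma dunion_perm1 (V W : finType) : dunion_perm (1%g, 1%g) = 1%g :> {perm V + W}.
Proof. by apply/permP => -[v|w]; rewrite ?dunion_perm_inl ?dunion_perm_inr !perm1. Qed.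

Lemma restr_perm_sub1 (V : finType) (U : {set V}) : restr_perm_sub U 1%g = 1%g.
Proof.
apply/permP => x; apply: val_inj; rewrite restr_perm_subE ?perm1 // => v.
by rewrite perm1.
Qed.

Lemma Gmul_additive_l y : additive_map (fun x => Gmul x y).
Proof. by move=> x x'; rewrite /Gmul raddfD. Qed.

Lemma Gmul_additive_r x : additive_map (Gmul x).
Proof.
move=> y y'; move: x; apply: freeg_additive_eq; first exact: Gmul_additive_l.
  by move=> x x'; rewrite !Gmul_additive_l addrACA.
by move=> c; rewrite /Gmul !flift_fgen raddfD.
Qed.

Lemma Gmul_fgen c d :
  Gmul (fgen c) (fgen d) = gclass (dunion (class_graph c) (class_graph d)).
Proof. by rewrite /Gmul !flift_fgen. Qed.

(** After pairing, the two coproducts are sums over the same vertex subsets. *)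
Lemma reg_hopf_morphism : @hopf_morphism graph_hopf (rep_hopf k) (reg_map k).
Proof.
split; first exact: reg_additive.
- split=> [x y|] /=; last first.
    rewrite reg_gclass; apply: (Arep_eq char0) => psi np.
    rewrite pair_regular // pair_one // edges_ord0.
    by rewrite (set_ord0 setT set0).
  suff : reg_map k (Gmul x y) = @hmul (rep_hopf k) (reg_map k x) (reg_map k y) by [].
  move: x; apply: freeg_additive_eq.
  + by move=> x x'; rewrite Gmul_additive_l reg_additive.
  + by move=> x x'; rewrite reg_additive (AmulDl char0).
  move=> c; move: y; apply: freeg_additive_eq.
  + by move=> y y'; rewrite Gmul_additive_r reg_additive.
  + by move=> y y'; rewrite reg_additive (AmulDr char0).
  move=> d; rewrite Gmul_fgen reg_gclass; apply: (Arep_eq char0) => psi np.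
  rewrite pair_regular // pair_mul // pair_reg; last exact: natural_slices.
  rewrite /slices pair_reg; last exact: natural_slice.
  by rewrite /slice dunion_perm1 tsum_setT.
- have rD := reg_additive.
  apply: freeg_additive_eq.
  + by move=> x x'; rewrite rD (AcomulD char0).
  + by move=> x x' /=; rewrite /Gcomul raddfD (tmap_additive rD rD).
  move=> c; apply: (Arep2_eq char0) => psi phi np nq; have nc := natural_conv np nq.
  rewrite pair2_comul // pair_reg //= /Gcomul flift_fgen.
  rewrite (additive_map_sum (tmap_additive rD rD)) (additive_map_sum (pair2_additive char0 np nq)).
  apply: eq_big => [U|U _]; first by rewrite subsetT.
  rewrite tmap_tens // pair2_tens // !reg_gclass !pair_regular //.
  rewrite -[in RHS](restr_perm_sub1 U) -[in RHS](restr_perm_sub1 (~: U)).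
  by rewrite !natural_induced ?setTD // => v; rewrite perm1.
move=> x; apply: (intr_inj_char0 char0) => /=; rewrite counitE //.
have n1 := natural_one k; move: x; apply: freeg_additive_eq.
- by move=> x x'; rewrite reg_additive (pair_additive char0 n1).
- by move=> x x'; rewrite /Gcounit raddfD mulrzDr.
move=> c; rewrite pair_reg // /Gcounit flift_fgen /fone.
by rewrite -cards_eq0 cardsT card_ord -pmulrn.
Qed.

(** At the identity permutation this counts the isomorphisms from the graph of [c], so
    that pairing with it detects the coefficient of [c]. *)
Definition iso_family (c : graph_class) : family k := fun V E t T =>
  ((t @: T == T) * #|embeddings (class_graph c) E T|)%N%:R.

Lemma natural_iso_family c : natural (iso_family c).
Proof.
split=> [V E t T|V W j E F s t T injj js jE]; rewrite /iso_family.
  by case: (t @: T =P T) => // _; rewrite mul0n eqxx.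
rewrite (stable_imset injj js) (embeddings_imset _ injj jE) card_imset //.
by move=> w w' /ffunP e; apply/ffunP => v; apply: injj; have := e v; rewrite !ffunE.
Qed.

Lemma imset_perm1 (V : finType) (T : {set V}) : (1%g : {perm V}) @: T = T.
Proof. by rewrite -[RHS]imset_id; apply: eq_imset => v; rewrite perm1. Qed.

Lemma pair_iso_family c d : pair (iso_family c) (reg_map k (fgen d)) != 0 <-> c = d.
Proof.
rewrite pair_reg; last exact: natural_iso_family.
rewrite /iso_family imset_perm1 eqxx mul1n natr_neq0 // -lt0n card_gt0; split.
  case/set0Pn => w /embeddingsP[injw wT wE].
  have [i _] := graph_iso_of_fun injw wT wE.
  exact: (isomorphic_class_graph i).
move=> <-; apply/set0Pn; exists [ffun v => v]; apply/embeddingsP.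
have fid (e : {set 'I_(class_order c)}) : [ffun v => v] @: e = e.
  by rewrite -[RHS]imset_id; apply: eq_imset => v; rewrite ffunE.
by split=> [v v'||e]; rewrite ?ffunE ?fid.
Qed.

Lemma reg_injective : injective (reg_map k).
Proof.
move=> x y e; apply/eqP; rewrite -subr_eq0; apply/eqP/eqP/freeg_eqP => c.
have : reg_map k (x - y) = 0 by rewrite (additive_mapB reg_additive) e subrr.
move: (x - y) => z z0; rewrite coeff0; apply: (intr_inj_char0 char0) => /=.
have nc := natural_iso_family c; have pD := pair_additive char0 nc.
have : pair (iso_family c) (reg_map k z) = 0 by rewrite z0 (additive_map0 pD).
rewrite (freeg_sum_fgen z) (additive_map_sum reg_additive) (additive_map_sum pD) -freeg_sum_fgen.
have [cz|/coeff_outdom ->] := boolP (c \in dom z); last by rewrite mulr0z.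
rewrite (bigD1_seq c) ?uniq_dom //= big1 ?addr0 => [|d ne].
  rewrite (additive_mapMz reg_additive) (additive_mapMz pD) -mulrzl => /eqP.
  rewrite mulf_eq0 => /orP[/eqP ->|]; rewrite ?mulr0z //.
  by rewrite (negbTE ((pair_iso_family c c).2 erefl)).
rewrite (additive_mapMz reg_additive) (additive_mapMz pD).
suff -> : pair (iso_family c) (reg_map k (fgen d)) = 0 by rewrite mul0rz.
apply/eqP; apply: contraNT ne => /pair_iso_family ->; exact: eqxx.
Qed.

End Regular.

(** * The character [zeta] *)

Section Zeta.
Variable k : closedFieldType.
Hypothesis char0 : [pchar k] =i pred0.
Implicit Types psi phi : family k.

Definition fzeta : family k := fun V E t T => ((t @: T == T) && edgeless E T)%:R.

Lemma natural_zeta : natural fzeta.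
Proof.
split=> [V E t T|V W j E F s t T injj js jE]; rewrite /fzeta.
  by case: (t @: T =P T) => // _; rewrite eqxx.
by rewrite (stable_imset injj js) (edgeless_imset injj jE).
Qed.

Lemma edgeless_setT (V : finType) (G : graph V) : edgeless (edges G) setT = (edges G == set0).
Proof.
apply/forallP/eqP => [h|-> e]; last by rewrite inE.
apply/setP => e; rewrite inE; apply/negP => eG; have := h e.
by rewrite eG subsetT (edges2P _ (edges2 G) e eG).
Qed.

Lemma imset_permT (V : finType) (s : {perm V}) : s @: setT = setT.
Proof. by apply/setP => v; rewrite inE; apply/imsetP; exists (s^-1 v)%g; rewrite ?inE ?permKV. Qed.

Lemma zetaE (x : Arep k) : (Azeta x)%:~R = pair fzeta x.
Proof.
rewrite /Azeta /pair /Alift !flift_sum rmorph_sum; apply: eq_bigr => a _.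
rewrite rmorphMz; congr (_ *~ _); rewrite /irr_pair /rep_pair /fzeta.
rewrite edgeless_setT; under eq_bigr => s _ do rewrite imset_permT eqxx /=.
by rewrite -mulr_suml mulrA rep_pair_triv // -natrM mulnb andbC pmulrn.
Qed.

Lemma slice_zeta (V W : finType) (E : {set {set V}}) t T (F : {set {set W}}) s S :
  slice fzeta E t T F s S = fzeta E t T * fzeta F s S.
Proof.
rewrite /slice /fzeta -natrM mulnb andbACA; congr (nat_of_bool (_ && _))%:R.
  have -> : dunion_perm (t, s) @: tsum T S = tsum (t @: T) (s @: S).
    rewrite /tsum imsetU -!imset_comp; congr (_ :|: _).
      by apply: eq_imset => v /=; rewrite dunion_perm_inl.
    by apply: eq_imset => v /=; rewrite dunion_perm_inr.
  apply/eqP/andP => [e|[/eqP-> /eqP->] //].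
  split; apply/eqP/setP => v; first by rewrite -(mem_tsum_inl _ (s @: S)) e mem_tsum_inl.
  by rewrite -(mem_tsum_inr (t @: T)) e mem_tsum_inr.
have subl (e : {set V}) : (inl @: e \subset tsum T S) = (e \subset T).
  apply/subsetP/subsetP => h v ve; first by rewrite -(mem_tsum_inl _ S) h ?imset_f.
  by case/imsetP: ve => u /h uT ->; rewrite mem_tsum_inl.
have subr (e : {set W}) : (inr @: e \subset tsum T S) = (e \subset S).
  apply/subsetP/subsetP => h v ve; first by rewrite -(mem_tsum_inr T) h ?imset_f.
  by case/imsetP: ve => u /h uT ->; rewrite mem_tsum_inr.
apply/forallP/andP => [h|[/forallP hE /forallP hF] e].
  split; apply/forallP => e; apply/implyP => eE.
    have := h (inl @: e); rewrite subl card_imset; last exact: inl_inj.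
    by move=> /implyP; apply; apply/dsumP; left; exists e.
  have := h (inr @: e); rewrite subr card_imset; last exact: inr_inj.
  by move=> /implyP; apply; apply/dsumP; right; exists e.
apply/implyP => /dsumP[][d dE ->].
  by rewrite subl card_imset; [exact: (implyP (hE d)) | exact: inl_inj].
by rewrite subr card_imset; [exact: (implyP (hF d)) | exact: inr_inj].
Qed.

Lemma zeta_morphism : @algebra_morphism (rep_hopf k) (@Azeta k).
Proof.
have nz := natural_zeta; split=> [x y|x y|]; apply: (intr_inj_char0 char0) => /=.
- by rewrite rmorphD /= !zetaE (pair_additive char0 nz).
- rewrite rmorphM /= !zetaE -/(@hmul (rep_hopf k) x y).
  by rewrite pair_mul_char // => *; exact: slice_zeta.
rewrite zetaE pair_one // /fzeta imset0 eqxx /=.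
suff -> : edgeless set0 (set0 : {set 'I_0}) by [].
by apply/forallP => e; rewrite inE.
Qed.

End Zeta.

(** * Convolution products as sums over colorings *)

Section Colorings.
Variable k : closedFieldType.
Variables (L : nat) (phi : nat -> family k).
Variables (V : finType) (E : {set {set V}}) (t : {perm V}).

Definition color_class (n : nat) (kappa : {ffun V -> 'I_n}) (j : nat) : {set V} :=
  [set v | kappa v == j :> nat].

(** Colorings of [T] by the colors from [i] on, as functions on all of [V]: the vertices
    outside [T] get the additional color [L]. *)
Definition partial_colorings (i : nat) (T : {set V}) : {set {ffun V -> 'I_L.+1}} :=
  [set kappa : {ffun V -> 'I_L.+1} |
    [forall v, if v \in T then (i <= kappa v < L)%N else kappa v == ord_max]].

Definition class_product (i : nat) (kappa : {ffun V -> 'I_L.+1}) : k :=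
  \prod_(i <= j < L) phi j E t (color_class kappa j).

(** The first factor of the convolution splits off the class of the color [i]. *)
Lemma fconv_colorings_from i T : (i <= L)%N ->
  (\big[@fconv k/@fone k]_(i <= j < L) phi j) V E t T
  = \sum_(kappa in partial_colorings i T) class_product i kappa.
Proof.
move=> le_iL; rewrite /class_product -(subKn le_iL); move: (leq_subr i L).
elim: (L - i)%N T => [|d IH] T.
  rewrite subn0 => _; rewrite big_geq // /fone.
  under eq_bigr do rewrite big_geq //.
  have [->|/set0Pn[v vT]] := eqVneq T set0; last first.
    rewrite big1 // => kappa; rewrite inE => /forallP/(_ v).
    by rewrite vT; case: ltngtP.
  rewrite (big_pred1 [ffun=> ord_max]) // => kappa; rewrite inE.
  apply/forallP/eqP => [h|-> v]; last by rewrite inE ffunE.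
  by apply/ffunP => v; have := h v; rewrite inE ffunE => /eqP.
move=> lt_dL; have lt_iL : (L - d.+1 < L)%N by rewrite ltn_subrL (leq_trans _ lt_dL).
have eS : (L - d.+1).+1 = (L - d)%N by rewrite subnSK.
rewrite big_ltn // {1}/fconv /= eS.
pose i0 : 'I_L.+1 := inord (L - d.+1).
have i0E : i0 = (L - d.+1)%N :> nat by rewrite inordK // ltnS ltnW.
rewrite [RHS](partition_big (fun kappa => color_class kappa (L - d.+1))
  (fun S : {set V} => S \subset T)) /=; last first.
  move=> kappa; rewrite inE => /forallP h; apply/subsetP => v; rewrite inE => /eqP kv.
  have := h v; case: ifP => // _ /eqP e; rewrite e /= in kv.
  by rewrite -kv ltnn in lt_iL.
apply: eq_bigr => S sST; rewrite (IH _ (ltnW lt_dL)) mulr_sumr.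
(* Recoloring [S] by the additional color gives a coloring of [T :\: S]. *)
rewrite [RHS](reindex_onto
  (fun kappa : {ffun V -> 'I_L.+1} => [ffun v => if v \in S then i0 else kappa v])
  (fun kappa : {ffun V -> 'I_L.+1} => [ffun v => if v \in S then ord_max else kappa v])) /=; last first.
  move=> kappa /andP[_ /eqP kS]; apply/ffunP => v; rewrite !ffunE.
  have [vS|//] := boolP (v \in S); apply: val_inj; rewrite /= i0E.
  by move: vS; rewrite -kS inE => /eqP.
apply: eq_big => [kappa|kappa].
  rewrite !inE; apply/forallP/andP => [h|[/andP[/forallP h /eqP hS] /eqP hk] v].
    split; last first.
      apply/eqP/ffunP => v; rewrite !ffunE; have [vS|//] := boolP (v \in S).
      by have := h v; rewrite inE vS /= => /eqP ->.
    apply/andP; split.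
      apply/forallP => v; rewrite ffunE; have := h v; rewrite inE.
      have [vS _|vS] := boolP (v \in S); first by rewrite (subsetP sST) // i0E leqnn.
      by rewrite /=; case: ifP => //= _ /andP[lt_ ->]; rewrite andbT ltnW // eS.
    apply/eqP/setP => v; rewrite inE ffunE; have := h v; rewrite inE.
    have [vS _|vS] := boolP (v \in S); first by rewrite i0E eqxx.
    rewrite /=; case: ifP => /= _ => [/andP[lt_ _]|/eqP ->]; last by rewrite /= gtn_eqF.
    by rewrite -eS in lt_; rewrite gtn_eqF.
  have := h v; rewrite inE ffunE.
  have [vS _|vS] := boolP (v \in S).
    by rewrite /= -{1}hk !ffunE vS.
  rewrite /=; case: ifP => //= vT /andP[le_ ->]; rewrite andbT -eS ltn_neqAle le_ andbT.
  apply: contra vS => /eqP e; rewrite -hS inE ffunE; case: ifP => _; last by rewrite e.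
  by rewrite i0E.
rewrite inE => /forallP h; rewrite [RHS]big_ltn // eS; congr (_ * _).
  congr (phi _ E t _); apply/setP => v; rewrite inE ffunE; have := h v; rewrite inE.
  have [vS _|vS] := boolP (v \in S); first by rewrite i0E eqxx.
  rewrite /=; case: ifP => /= _ => [/andP[lt_ _]|/eqP ->]; last by rewrite /= gtn_eqF.
  by rewrite -eS in lt_; rewrite gtn_eqF.
apply: eq_big_nat => j /andP[le_j lt_j]; congr (phi _ E t _); apply/setP => v.
rewrite !inE ffunE; have := h v; rewrite inE.
have [vS /= /eqP ->|//] := boolP (v \in S).
by rewrite i0E /= gtn_eqF // ltn_eqF // (leq_trans _ le_j) // -eS.
Qed.

(** An ordered partition of the vertices into [L] sets is a coloring with [L] colors. *)
Lemma fconv_colorings :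
  (\big[@fconv k/@fone k]_(j < L) phi j) V E t setT
  = \sum_(kappa : {ffun V -> 'I_L}) \prod_(j < L) phi j E t (color_class kappa j).
Proof.
rewrite -(big_mkord xpredT) fconv_colorings_from // /class_product.
pose widen (kappa : {ffun V -> 'I_L}) : {ffun V -> 'I_L.+1} :=
  [ffun v => widen_ord (leqnSn L) (kappa v)].
have -> : partial_colorings 0 setT = widen @: setT.
  apply/setP => kappa'; rewrite inE; apply/forallP/imsetP => [h|[kappa _ ->] v]; last first.
    by rewrite inE ffunE /= ltn_ord.
  have /fin_all_exists[u uE] v : exists i : 'I_L, kappa' v = widen_ord (leqnSn L) i.
    have := h v; rewrite inE /= => lt_L; exists (Ordinal lt_L).
    exact: val_inj.
  by exists [ffun v => u v]; rewrite ?inE //; apply/ffunP => v; rewrite !ffunE.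
rewrite big_imset /=; last first.
  move=> x y _ _ /ffunP e; apply/ffunP => v; apply: val_inj.
  by have := congr1 val (e v); rewrite !ffunE.
apply: eq_big => [kappa|kappa _]; first by rewrite inE.
rewrite big_mkord; apply: eq_bigr => j _; congr (phi _ E t _).
by apply/setP => v; rewrite !inE ffunE.
Qed.

End Colorings.


(** * The families counting edgeless vertex sets and proper colorings *)

Section ColoringFamilies.
Variable k : closedFieldType.
Hypothesis char0 : [pchar k] =i pred0.

(** Size [n], stable and edgeless: a colour class of an invariant proper coloring. *)
Definition fclass (n : nat) : family k := degree_part n (fzeta k).

Lemma natural_fclass n : natural (fclass n).
Proof. exact/natural_degree_part/natural_zeta. Qed.

Lemma fclass0 : fclass 0 = fone k.
Proof.
apply: familyP => V E t T; rewrite /fclass /degree_part /fone cards_eq0.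
have [->|_] := eqVneq; last by rewrite mul0r.
rewrite mul1r /fzeta imset0 eqxx /= (_ : edgeless E set0) //.
apply/forallP => e; apply/implyP => _; apply/implyP; rewrite subset0 => /eqP ->.
by rewrite cards0.
Qed.

(** On graphs this is the character of the coloring representation (see
    [fcolor_trace]). *)
Definition fcolor (alpha : seq nat) : family k := \big[@fconv k/@fone k]_(n <- alpha) fclass n.

Lemma natural_fcolor alpha : natural (fcolor alpha).
Proof.
apply: big_ind => [|psi phi np nq|n _].
- exact: natural_one.
- exact: natural_conv.
exact: natural_fclass.
Qed.

Lemma fcolor_perm alpha beta : perm_eq alpha beta -> fcolor alpha = fcolor beta.
Proof. exact: perm_big. Qed.

Lemma fcolor_filter alpha : fcolor [seq n <- alpha | n != 0%N] = fcolor alpha.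
Proof.
rewrite /fcolor big_filter big_mkcond; apply: eq_bigr => n _.
by case: eqP => // ->; rewrite fclass0.
Qed.

Section OneGraph.
Variables (V : finType) (E : {set {set V}}) (t : {perm V}).

Definition good_class (n : nat) (S : {set V}) : bool :=
  [&& #|S| == n, t @: S == S & edgeless E S].

Lemma fclassE n S : fclass n E t S = (good_class n S)%:R.
Proof. by rewrite /fclass /degree_part /fzeta -natrM mulnb. Qed.

Definition good_coloring (alpha : seq nat) (kappa : {ffun V -> 'I_(size alpha)}) : bool :=
  [forall j : 'I_(size alpha), good_class (nth 0%N alpha j) (color_class kappa j)].

Lemma fcolor_setT alpha : fcolor alpha E t setT
  = #|[set kappa : {ffun V -> 'I_(size alpha)} | good_coloring kappa]|%:R.
Proof.
rewrite /fcolor (big_nth 0%N) big_mkord.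
rewrite (fconv_colorings _ (fun j => fclass (nth 0%N alpha j))) -sum1_card natr_sum.
rewrite [RHS]big_mkcond /=; apply: eq_bigr => kappa _; rewrite inE.
rewrite (eq_bigr (fun j : 'I_(size alpha) =>
  (good_class (nth 0%N alpha j) (color_class kappa j))%:R)); last first.
  by move=> j _; rewrite fclassE.
rewrite -natr_prod; have [/forallP h|nh] := boolP (good_coloring kappa).
  by rewrite big1 // => j _; rewrite h.
have [j nj] : exists j : 'I_(size alpha), ~~ good_class (nth 0%N alpha j) (color_class kappa j).
  by apply/existsP; rewrite -negb_forall.
by rewrite (bigD1 j) //= (negbTE nj) mul0n.
Qed.

End OneGraph.

Definition color_counts (L : nat) (a : nat -> nat) (V W : finType)
    (kappa : {ffun V -> 'I_L}) (kappa' : {ffun W -> 'I_L}) : bool :=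
  [forall j : 'I_L, #|color_class kappa j| + #|color_class kappa' j| == a j]%N.

Definition zeta_product (L : nat) (V : finType) (E : {set {set V}}) t (kappa : {ffun V -> 'I_L}) : k :=
  \prod_(j < L) fzeta k E t (color_class kappa j).

Lemma prod_natr_forall (L : nat) (b : 'I_L -> bool) :
  \prod_(j < L) (b j)%:R = [forall j, b j]%:R :> k.
Proof.
rewrite -natr_prod; congr (_%:R); have [/forallP h|] := boolP [forall j, b j].
  by rewrite big1 // => j _; rewrite h.
by rewrite negb_forall => /existsP[j nj]; rewrite (bigD1 j) //= (negbTE nj) mul0n.
Qed.

Lemma fclass_colorings (L : nat) (a : nat -> nat) (V : finType) (E : {set {set V}}) t :
  (\big[@fconv k/@fone k]_(j < L) fclass (a j)) V E t setT
  = \sum_(kappa : {ffun V -> 'I_L})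
      [forall j : 'I_L, #|color_class kappa j| == a j]%:R * zeta_product E t kappa.
Proof.
rewrite (fconv_colorings _ (fun j => fclass (a j))); apply: eq_bigr => kappa _.
by rewrite big_split prod_natr_forall.
Qed.

(** Colorings of a disjoint union are pairs of colorings. *)
Lemma fclass_slice (L : nat) (a : nat -> nat) (V W : finType) (E : {set {set V}}) t
    (F : {set {set W}}) s :
  slice (\big[@fconv k/@fone k]_(j < L) fclass (a j)) E t setT F s setT
  = \sum_(kappa : {ffun V -> 'I_L}) \sum_(kappa' : {ffun W -> 'I_L})
      (color_counts a kappa kappa')%:R * (zeta_product E t kappa * zeta_product F s kappa').
Proof.
rewrite /slice tsum_setT pair_bigA (fconv_colorings _ (fun j => fclass (a j))).
pose glue (p : {ffun V -> 'I_L} * {ffun W -> 'I_L}) : {ffun V + W -> 'I_L} :=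
  [ffun x => match x with inl v => p.1 v | inr w => p.2 w end].
pose split (kappa : {ffun V + W -> 'I_L}) : {ffun V -> 'I_L} * {ffun W -> 'I_L} :=
  ([ffun v => kappa (inl v)], [ffun w => kappa (inr w)]).
rewrite (reindex glue) /=; last first.
  exists split => [[x y] _|x _].
    by congr (_, _); apply/ffunP => v; rewrite !ffunE.
  by apply/ffunP => -[v|v]; rewrite !ffunE.
apply: eq_bigr => -[x y] _ /=.
have classE j : color_class (glue (x, y)) j = tsum (color_class x j) (color_class y j).
  by apply/setP => -[v|w]; rewrite ?mem_tsum_inl ?mem_tsum_inr !inE ffunE.
rewrite (eq_bigr (fun j : 'I_L =>
   (#|color_class x j| + #|color_class y j| == a j)%N%:R *
   (fzeta k E t (color_class x j) * fzeta k F s (color_class y j)))); last first.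
  move=> j _; rewrite classE /fclass /degree_part -slice_zeta /slice; congr (_%:R * _).
  congr (nat_of_bool (_ == _)); rewrite /tsum cardsU !card_imset; [|exact: inr_inj|exact: inl_inj].
  rewrite (_ : _ :&: _ = set0) ?cards0 ?subn0 //; apply/setP => z; rewrite !inE.
  by apply/negP => /andP[/imsetP[u _ ->] /imsetP[u' _]].
by rewrite big_split big_split prod_natr_forall.
Qed.

Lemma fcolor_degree alpha (V : finType) (E : {set {set V}}) t T :
  fcolor alpha E t T != 0 -> #|T| = sumn alpha.
Proof.
rewrite /fcolor; elim: alpha T => [|n alpha IH] T.
  by rewrite big_nil /fone; case: (T =P set0) => [->|_]; rewrite ?cards0 // eqxx.
rewrite big_cons => nz.
have [S /andP[sST]] : exists S : {set V}, (S \subset T) &&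
    (fclass n E t S * (\big[@fconv k/@fone k]_(j <- alpha) fclass j) V E t (T :\: S) != 0).
  apply/existsP; apply: contraNT nz; rewrite negb_exists => /forallP h.
  apply/eqP/big1 => S sST; apply/eqP; move: (h S); rewrite sST /= negbK.
  by [].
rewrite mulf_eq0 negb_or => /andP[nzS /IH eS].
rewrite -(cardsID S T) (setIidPr sST) eS /=; congr (_ + _)%N.
by move: nzS; rewrite /fclass /degree_part; case: (_ =P n) => //; rewrite mul0r eqxx.
Qed.

Section ColoringTrace.
Variables (V : finType) (G : graph V) (alpha : seq nat).
Implicit Types (t : {perm V}) (kappa : {ffun V -> 'I_(size alpha)}).

Lemma recolor_fixP t kappa :
  reflect (forall v, kappa (t v) = kappa v) (recolor t kappa == kappa).
Proof.
apply: (iffP eqP) => [/ffunP e v|e].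
  by have := e (t v); rewrite ffunE permK.
by apply/ffunP => v; rewrite ffunE -e permKV.
Qed.

Lemma good_coloringE t kappa :
  good_coloring (edges G) t kappa = (kappa \in Col G alpha) && (recolor t kappa == kappa).
Proof.
have classE (j : 'I_(size alpha)) : color_class kappa j = [set v | kappa v == j].
  by apply/setP => v; rewrite !inE.
apply/forallP/andP => [h|].
  split; last first.
    apply/recolor_fixP => v; have /and3P[_ /eqP tS _] := h (kappa v).
    have : t v \in t @: color_class kappa (kappa v) by rewrite imset_f ?inE.
    by rewrite tS inE => /eqP/val_inj.
  rewrite inE; apply/andP; split.
    by apply/forallP => j; rewrite -classE; have /and3P[] := h j.
  apply/forallP => v; apply/forallP => w; apply/implyP => eG; apply/eqP => kvw.
  have /and3P[_ _ /forallP/(_ [set v; w])] := h (kappa v).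
  rewrite eG (edges2P _ (edges2 G) _ eG) implybF => /negP; apply.
  by apply/subsetP => u; rewrite !inE => /orP[/eqP->|/eqP->]; rewrite ?kvw.
rewrite inE => -[/andP[/forallP hc /forallP hE] /recolor_fixP ht] j.
apply/and3P; split; first by rewrite classE.
  rewrite eqEcard card_imset ?leqnn ?andbT; last exact: perm_inj.
  by apply/subsetP => _ /imsetP[v vj ->]; move: vj; rewrite !inE ht.
apply/forallP => e; apply/implyP => eG; apply/implyP => sej.
have /eqP/cards2P[v [w [vw ee]]] := edges2P _ (edges2 G) _ eG.
have /forallP/(_ w)/implyP := hE v; rewrite -ee => /(_ eG).
have kj u : u \in e -> kappa u = j.
  by move=> /(subsetP sej); rewrite inE => /eqP/val_inj.
by rewrite !kj ?eqxx // ee !inE eqxx ?orbT.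
Qed.

Lemma mxtrace_coloring t :
  \tr (coloring_mx k G alpha t) = #|[set kappa in Col G alpha | recolor t kappa == kappa]|%:R.
Proof.
rewrite /mxtrace -[in RHS]sum1_card natr_sum.
rewrite (eq_bigr (fun i : 'I_#|Col G alpha| =>
  (recolor t (enum_val i) == enum_val i)%:R)); last by move=> i _; rewrite mxE eq_sym.
rewrite -(big_enum_val (fun kappa => (recolor t kappa == kappa)%:R)).
under [RHS]eq_bigl do rewrite inE.
rewrite big_mkcondr.
apply: eq_bigr => kappa _.
by case: (_ == _).
Qed.

Lemma fcolor_trace t : fcolor alpha (edges G) t setT = \tr (coloring_mx k G alpha t).
Proof.
rewrite fcolor_setT mxtrace_coloring; congr (_%:R); apply: eq_card => kappa.
by rewrite !inE good_coloringE inE.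
Qed.

(** A permutation and its inverse fix the same colorings, so the coloring character is
    its own dual. *)
Lemma dim_Hom_coloring n (r : mx_representation k (graph_aut G) n) :
  (dim_Hom (coloring_repr k G alpha) r)%:R = rep_pair (fcolor alpha) r.
Proof.
rewrite (dim_Hom_cfdot char0) /cfdot /rep_pair; congr (_ * _); apply: eq_bigr => s Gs.
rewrite mulrC fcolor_trace /= !mxtrace_coloring; congr (_ * _%:R); apply: eq_card => kappa.
rewrite !inE; congr (_ && _); apply/recolor_fixP/recolor_fixP => e v.
  by rewrite -[LHS]e permK.
by rewrite -[LHS]e permKV.
Qed.

End ColoringTrace.

End ColoringFamilies.
From mathcomp Require Import classical_sets functions cardinality fsbigop.
From mathcomp.multinomials Require Import monalg.

(** * Monomials up to renaming of the variables *)

Lemma mdeg_expcmn (m : mono) n : mdeg (expcmn m n) = (n * mdeg m)%N.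
Proof.
rewrite /expcmn; case: n => [|n]; first by rewrite mdeg1.
by rewrite iteropS; elim: n => [|n IH] /=; rewrite ?mul1n // mdegM IH -mulSn.
Qed.

Lemma mono_expand N (m : mono) : (forall i, (N <= i)%N -> m i = 0%N) ->
  m = \big[mmul/mone]_(i < N) expcmn (ucm (i : nat)) (m i).
Proof.
move=> mN; apply: monoP => j; rewrite mono_bigE.
under eq_bigr => i _ do rewrite expcmnE cmU.
have [lt_jN|le_Nj] := ltnP j N.
  rewrite (bigD1 (Ordinal lt_jN)) //= eqxx muln1 big1 ?addn0 // => i ne.
  rewrite (_ : (i == j :> nat) = false) ?muln0 //.
  by apply: contraNF ne => /eqP e; apply/eqP/val_inj.
rewrite mN // big1 // => i _.
by rewrite ltn_eqF ?muln0 // (leq_trans (ltn_ord i)).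
Qed.

Lemma mdeg_ord N (m : mono) : (forall i, (N <= i)%N -> m i = 0%N) ->
  mdeg m = (\sum_(i < N) m i)%N.
Proof.
move=> mN; rewrite {1}(mono_expand mN) mdeg_prod; apply: eq_bigr => i _.
by rewrite mdeg_expcmn mdegU muln1.
Qed.

Lemma mono_bounded (m : mono) : exists N, forall i, (N <= i)%N -> m i = 0%N.
Proof.
exists (\max_(i <- finsupp m) i).+1 => i lt_i; apply/eqP; rewrite cmE_eq0.
apply/negP => im; have : (i <= \max_(j <- finsupp m) j)%N by exact: leq_bigmax_seq.
by rewrite leqNgt lt_i.
Qed.

Lemma mrename_out (s : nat -> nat) (m : mono) j : (forall i, s i != j) -> mrename s m j = 0%N.
Proof.
move=> sj; rewrite /mrename mono_bigE big1 // => i _.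
by rewrite expcmnE cmU (negbTE (sj i)) muln0.
Qed.

Lemma mdeg_mrename (s : nat -> nat) (m : mono) : mdeg (mrename s m) = mdeg m.
Proof.
rewrite /mrename mdeg_prod [RHS]mdegE; apply: eq_bigr => i _.
by rewrite mdeg_expcmn mdegU muln1.
Qed.

Lemma mono_le_mdeg (m : mono) i : (m i <= mdeg m)%N.
Proof.
have [N mN] := mono_bounded m; have [lt_iN|/mN ->//] := ltnP i N.
by rewrite (mdeg_ord mN) (bigD1 (Ordinal lt_iN)) //= leq_addr.
Qed.

(** Monomials that no symmetric series distinguishes. *)
Definition msim (m m' : mono) : bool :=
  `[< exists2 s : nat -> nat, bijective s & forall i, m' (s i) = m i >].

Lemma msim_refl : reflexive msim.
Proof. by move=> m; apply/asboolP; exists id => //; exists id. Qed.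

Lemma msim_sym : symmetric msim.
Proof.
suff h m m' : msim m m' -> msim m' m by move=> m m'; apply/idP/idP; exact: h.
move=> /asboolP[s [t sK tK] e]; apply/asboolP; exists t; first by exists s.
by move=> i; rewrite -e tK.
Qed.

Lemma msim_trans : transitive msim.
Proof.
move=> m' m m'' /asboolP[s bs e] /asboolP[t bt e']; apply/asboolP.
by exists (t \o s); [exact: bij_comp | move=> i /=; rewrite e' e].
Qed.

Lemma mdeg_msim (m m' : mono) : msim m m' -> mdeg m' = mdeg m.
Proof.
move=> /asboolP[s bs e]; suff -> : m' = mrename s m by rewrite mdeg_mrename.
have [t sK tK] := bs; apply: monoP => i; rewrite -[i]tK e mrenameE //.
exact: can_inj sK.
Qed.

Definition swap_nat (a b i : nat) : nat := if i == a then b else if i == b then a else i.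

Lemma swap_natK a b : involutive (swap_nat a b).
Proof.
move=> i; rewrite /swap_nat; case: (i =P a) => [->|ia].
  by rewrite eqxx; case: eqP => // ->.
case: (i =P b) => [->|ib]; first by rewrite eqxx.
by case: (i =P a) => //; case: (i =P b).
Qed.

(** Variables can be renamed to use only as many of them as the degree: an
    unused variable below the degree is swapped with the largest used one. *)
Lemma msim_compress N (m : mono) : (mdeg m <= N)%N ->
  exists2 m', msim m m' & forall i, (N <= i)%N -> m' i = 0%N.
Proof.
have [M mM] := mono_bounded m; elim: M m mM => [|M IH] m mM degm.
  by exists m; [exact: msim_refl | move=> i _; exact: mM].
have [le_NM|lt_MN] := leqP N M; last first.
  exists m; first exact: msim_refl.
  by move=> i le_Ni; apply: mM; exact: leq_trans lt_MN le_Ni.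
have [m0|m0] := eqVneq (m M) 0%N.
  apply: IH => // i; rewrite leq_eqVlt => /orP[/eqP <- //|]; exact: mM.
(* If all variables below [M] were used, the degree would exceed [N]. *)
have [j lt_jM mj] : exists2 j, (j < M)%N & m j = 0%N.
  have : ~~ [forall j : 'I_M, (0 < m j)%N].
    apply/negP => /forallP h; suff : (N < mdeg m)%N by rewrite ltnNge degm.
    rewrite (mdeg_ord mM) big_ord_recr /= -addn1; apply: leq_add; last by rewrite lt0n.
    apply: leq_trans le_NM _; rewrite -[M in (M <= _)%N]card_ord -sum1_card.
    by apply: leq_sum => i _; exact: h.
  rewrite negb_forall => /existsP[j]; rewrite -eqn0Ngt => /eqP mj.
  by exists j.
pose s := swap_nat M j; have sK : involutive s := swap_natK M j.
have bs : bijective s by exists s.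
have inj_s := inv_inj sK; pose m2 := mrename s m.
have m2E i : m2 i = m (s i) by rewrite -{1}[i]sK /m2 mrenameE.
have sim2 : msim m m2 by apply/asboolP; exists s => // i; rewrite m2E sK.
have [||m' sim' m'N] := IH m2.
- move=> i; rewrite m2E leq_eqVlt => /orP[/eqP <-|lt_Mi]; first by rewrite /s /swap_nat eqxx.
  by rewrite /s /swap_nat !gtn_eqF ?mM // (ltn_trans lt_jM).
- by rewrite (mdeg_msim sim2).
by exists m'; first exact: msim_trans sim2 sim'.
Qed.

Definition mcanon (m : mono) : mono := choose (msim m) m.

Lemma mcanon_sim m : msim m (mcanon m).
Proof. exact/chooseP/msim_refl. Qed.

Lemma eq_mcanon m m' : msim m m' -> mcanon m = mcanon m'.
Proof.
move=> sim; have e : msim m =1 msim m'.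
  have sim' : msim m' m by rewrite msim_sym.
  by move=> x; apply/idP/idP; [exact: msim_trans sim' | exact: msim_trans sim].
rewrite /mcanon (eq_choose e).
by apply: choose_id; [rewrite msim_sym | exact: msim_refl].
Qed.

(** Every renaming class of degree at most [N] has exactly one member in this list,
    which also meets some classes of higher degree. *)
Definition mono_reps N : seq mono :=
  undup [seq mcanon (\big[mmul/mone]_(i < N) expcmn (ucm (i : nat)) (f i : nat)) |
          f : {ffun 'I_N -> 'I_N.+1} <- enum {: {ffun 'I_N -> 'I_N.+1}}].

Lemma mono_reps_canon N r : r \in mono_reps N -> mcanon r = r.
Proof.
rewrite mem_undup => /mapP[f _ ->]; apply/esym/eq_mcanon; exact: mcanon_sim.
Qed.

Lemma mcanon_reps N m : (mdeg m <= N)%N -> mcanon m \in mono_reps N.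
Proof.
move=> degm; have [m' sim m'N] := msim_compress degm.
rewrite (eq_mcanon sim) mem_undup; apply/mapP.
exists [ffun i : 'I_N => inord (m' i)]; rewrite ?mem_enum //; congr mcanon.
rewrite {1}(mono_expand m'N); apply: eq_bigr => i _; rewrite ffunE inordK //.
by rewrite ltnS (leq_trans (mono_le_mdeg _ _)) // (mdeg_msim sim).
Qed.

Lemma sum_mono_reps (A : zmodType) N (g : mono -> A) m :
    (forall m m', msim m m' -> g m = g m') ->
    (forall m, (N < mdeg m)%N -> g m = 0) ->
  \sum_(r <- mono_reps N) g r *~ (msim r m)%:Z = g m.
Proof.
move=> gsim gN; have [cm|ncm] := boolP (mcanon m \in mono_reps N).
  rewrite (bigD1_seq (mcanon m)) ?undup_uniq //= msim_sym mcanon_sim mulr1z.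
  rewrite -(gsim _ _ (mcanon_sim m)) big_seq_cond big1 ?addr0 // => r /andP[rR ne].
  case: (boolP (msim r m)) => [/eq_mcanon|_]; last by rewrite mulr0z.
  by rewrite (mono_reps_canon rR) => e; rewrite e eqxx in ne.
rewrite gN; last by rewrite ltnNge; apply: contra ncm; exact: mcanon_reps.
rewrite big_seq big1 // => r rR; case: (boolP (msim r m)) => [/eq_mcanon e|_]; last by rewrite mulr0z.
by rewrite -e (mono_reps_canon rR) rR in ncm.
Qed.

(** * Symmetric functions *)

Lemma symmetric_msim (f : SymZ) m m' : msim m m' -> sym_val f m = sym_val f m'.
Proof.
have /asboolP[_ sf] := sym_valP f => /asboolP[s bs e].
by rewrite (sf s m m').
Qed.

Lemma Sym_eq (f g : SymZ) : (forall m, sym_val f m = sym_val g m) -> f = g.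
Proof. by move=> e; apply: val_inj; apply/funext. Qed.

Lemma sym_valD (f g : SymZ) m : sym_val (f + g) m = sym_val f m + sym_val g m.
Proof. by []. Qed.

Lemma sym_val_additive m : additive_map (fun f : SymZ => sym_val f m).
Proof. by move=> f g. Qed.

Lemma msym_closed r : (fun m => (msim r m)%:Z) \in Sym_pred.
Proof.
apply/asboolP; split.
  exists (mdeg r) => m; case: (boolP (msim r m)) => // /mdeg_msim ->.
  by [].
move=> s m m' bs e; have sim : msim m m' by apply/asboolP; exists s.
congr (Posz (nat_of_bool _)); apply/idP/idP => h; apply: msim_trans h _ => //.
by rewrite msim_sym.
Qed.

(** The monomial symmetric function of the class of [r]. *)
Definition msym (r : mono) : SymZ := SymFun (msym_closed r).

Lemma Sym_expand (f : SymZ) : exists N, f = \sum_(r <- mono_reps N) msym r *~ sym_val f r.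
Proof.
have /asboolP[[N hN] _] := sym_valP f; exists N; apply: Sym_eq => m.
rewrite (additive_map_sum (sym_val_additive m)).
rewrite -[LHS](@sum_mono_reps _ N (fun m => sym_val f m)).
- apply: eq_bigr => r _; rewrite (additive_mapMz (sym_val_additive m)) /=.
  by rewrite !mulrzz mulrC.
- exact: symmetric_msim.
move=> m'; rewrite ltnNge => lt_N; apply/eqP; apply: contraNT lt_N; exact: hN.
Qed.

Lemma Sym_dual_basis : dual_basis (K := int) msym (fun m f => sym_val f m).
Proof.
split.
- exact: sym_val_additive.
- move=> m m' /=; rewrite natz; congr (Posz (nat_of_bool _)); apply/idP/eqP => [sim|e].
    apply: Sym_eq => x /=; congr (Posz (nat_of_bool _)).
    by apply/idP/idP; apply: msim_trans; rewrite // msim_sym.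
  have := congr1 (fun f : SymZ => sym_val f m) e; rewrite /= msim_refl.
  by case: (msim m' m).
move=> f; have [N ->] := Sym_expand f; apply: rpred_sum => r _.
by apply: rpredMz; apply: gen_subgroup_mem; exists r.
Qed.

Lemma intz_inj : injective (fun z : int => z%:~R : int).
Proof. by move=> x y; rewrite /= !intz. Qed.

Lemma tensor_series_bilinear : bilinear2 (fun f g : SymZ =>
  (fun m m' => sym_val f m * sym_val g m') : mono -> mono -> int).
Proof.
split=> [b a a'|a b b'] /=; apply/funext => m; apply/funext => m'.
  exact: mulrDl.
exact: mulrDr.
Qed.

Lemma tensor_series_additive : additive_map tensor_series.
Proof. exact/tlift_additive/tensor_series_bilinear. Qed.

Lemma tensor_series_tens f g : tensor_series (tens f g) = fun m m' => sym_val f m * sym_val g m'.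
Proof. by rewrite /tensor_series tliftE //; exact: tensor_series_bilinear. Qed.

Lemma tensor_seriesE t m m' :
  tensor_series t m m' = tlift (fun f g : SymZ => sym_val f m * sym_val g m') t.
Proof.
have bil : bilinear2 (fun f g : SymZ => sym_val f m * sym_val g m').
  by apply: mul_bilinear; exact: sym_val_additive.
move: t; apply: tensor_additive_eq.
- by move=> s t; rewrite tensor_series_additive.
- exact: tlift_additive.
by move=> f g; rewrite tensor_series_tens tliftE.
Qed.

Lemma tensor_series_inj : injective tensor_series.
Proof.
move=> s t e; apply/eqP; rewrite -subr_eq0; apply/eqP.
apply: (dual_basis_eq0 intz_inj (dual_basis_tensor Sym_dual_basis Sym_dual_basis)).
move=> [m m'] /=; rewrite -tensor_seriesE (additive_mapB tensor_series_additive) e.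
by rewrite subrr.
Qed.

(** Such an [F] is expanded over representatives of the renaming classes in both
    arguments. *)
Lemma tensor_series_exists N (F : mono -> mono -> int) :
    (forall m m1 m2, msim m1 m2 -> F m1 m = F m2 m) ->
    (forall m m1 m2, msim m1 m2 -> F m m1 = F m m2) ->
    (forall m m', (N < mdeg m)%N -> F m m' = 0) ->
    (forall m m', (N < mdeg m')%N -> F m m' = 0) ->
  exists t, tensor_series t = F.
Proof.
move=> Fl Fr Nl Nr.
exists (\sum_(r <- mono_reps N) \sum_(r' <- mono_reps N) tens (msym r) (msym r') *~ F r r').
apply/funext => m; apply/funext => m'.
have ev : additive_map (fun t => tensor_series t m m').
  by move=> s t; rewrite tensor_series_additive.
rewrite (additive_map_sum ev) -[RHS](@sum_mono_reps _ N (fun m => F m m')) //.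
- apply: eq_bigr => r _; rewrite (additive_map_sum ev).
  rewrite -[F r m'](@sum_mono_reps _ N (fun m => F r m)) // => [|x y|x]; [|exact: Fr|exact: Nr].
  rewrite mulrz_suml; apply: eq_bigr => r' _.
  rewrite (additive_mapMz ev) tensor_series_tens /= !mulrzz.
  by rewrite mulrC -mulrA [_%:Z * _]mulrC.
- by move=> x y; exact: Fl.
by move=> x; exact: Nl.
Qed.

(** [two_alphabets f m m'] is the coefficient of [f] at this monomial. *)
Definition interleave (m m' : mono) : mono :=
  mmul (mrename (fun i => i.*2) m) (mrename (fun i => i.*2.+1) m').

Lemma double_injS : injective (fun i => i.*2.+1).
Proof. by move=> i j [] /double_inj. Qed.

Lemma interleave_even m m' i : interleave m m' i.*2 = m i.
Proof.
rewrite cmM (mrenameE _ _ double_inj) mrename_out ?addn0 // => j.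
by apply/eqP => e; have := congr1 odd e; rewrite /= !odd_double.
Qed.

Lemma interleave_odd m m' i : interleave m m' i.*2.+1 = m' i.
Proof.
rewrite cmM (mrenameE _ _ double_injS) mrename_out ?add0n // => j.
by apply/eqP => e; have := congr1 odd e; rewrite /= !odd_double.
Qed.

Lemma mdeg_interleave m m' : mdeg (interleave m m') = (mdeg m + mdeg m')%N.
Proof. by rewrite mdegM !mdeg_mrename. Qed.

Lemma parityP (P : nat -> Prop) : (forall i, P i.*2) -> (forall i, P i.*2.+1) -> forall i, P i.
Proof.
by move=> Pe Po i; rewrite -(odd_double_half i); case: (odd i); [exact: Po | exact: Pe].
Qed.

Lemma msim_interleave m1 m2 m1' m2' :
  msim m1 m2 -> msim m1' m2' -> msim (interleave m1 m1') (interleave m2 m2').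
Proof.
move=> /asboolP[s [t sK tK] e] /asboolP[s' [t' sK' tK'] e']; apply/asboolP.
pose mix (a b : nat -> nat) i := if odd i then (b i./2).*2.+1 else (a i./2).*2.
have mixe a b i : mix a b i.*2 = (a i).*2 by rewrite /mix odd_double doubleK.
have mixo a b i : mix a b i.*2.+1 = (b i).*2.+1.
  by rewrite /mix /= odd_double uphalf_double.
exists (mix s s').
  exists (mix t t'); apply: parityP => i; by rewrite ?mixe ?mixo ?sK ?sK' ?tK ?tK' ?mixe ?mixo ?sK ?sK' ?tK ?tK'.
apply: parityP => i; rewrite ?mixe ?mixo ?interleave_even ?interleave_odd //.
Qed.

(** [Sym_comul] selects a tensor by its coefficients.  One exists because the
    coefficients of f(x; y) are bounded in degree and symmetric in each alphabet. *)
Lemma Sym_comulP f : tensor_series (Sym_comul f) = two_alphabets f.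
Proof.
have /asboolP[[N hN] _] := sym_valP f.
have ex : exists t, [set t | tensor_series t = two_alphabets f]%classic t.
  apply: (@tensor_series_exists N) => m m1 => [m2 sim|m2 sim|ltN|ltN].
  - by apply: symmetric_msim; apply: msim_interleave => //; exact: msim_refl.
  - by apply: symmetric_msim; apply: msim_interleave => //; exact: msim_refl.
  - apply/eqP; apply: contraTT ltN => /hN; rewrite -leqNgt mdeg_interleave.
    by apply: leq_trans; rewrite leq_addr.
  apply/eqP; apply: contraTT ltN => /hN; rewrite -leqNgt mdeg_interleave.
  by apply: leq_trans; rewrite leq_addl.
exact: xgetPex ex.
Qed.

Lemma Sym_comul_eq f t : tensor_series t = two_alphabets f -> Sym_comul f = t.
Proof. by move=> e; apply: tensor_series_inj; rewrite Sym_comulP. Qed.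

(** * Families indexed by monomials *)

(** Hence a family that depends only on the multiset of exponents of a monomial gives
    symmetric coefficients. *)
Lemma msim_exponents (m m' : mono) : msim m m' ->
  perm_eq [seq m i | i <- finsupp m] [seq m' i | i <- finsupp m'].
Proof.
move=> /asboolP[s [t sK tK] e].
have -> : [seq m i | i <- finsupp m] = [seq m' i | i <- [seq s i | i <- finsupp m]].
  by rewrite -map_comp; apply: eq_map => i /=; rewrite e.
apply/perm_map/uniq_perm.
- by rewrite map_inj_uniq ?fset_uniq //; exact: can_inj sK.
- exact: fset_uniq.
move=> j; apply/mapP/idP => [[i im ->]|jm].
  by move: im; rewrite -!cmE_neq0 e.
exists (t j); last by rewrite tK.
by rewrite -cmE_neq0 -e tK cmE_neq0.
Qed.

Section MonomialFamilies.
Variable k : closedFieldType.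

(** Pairing with this family extracts the coefficient of [m] (see [chromaticE]). *)
Definition fmono (m : mono) : family k := fcolor k [seq m i | i <- finsupp m].

Lemma natural_fmono m : natural (fmono m).
Proof. exact: natural_fcolor. Qed.

Lemma fmono_msim m m' : msim m m' -> fmono m = fmono m'.
Proof. by move=> /msim_exponents; exact: fcolor_perm. Qed.

(** Variables of exponent 0 contribute units of the convolution, so that any
    bound on the variables may be used. *)
Lemma fmono_seq (m : mono) (r : seq nat) : uniq r -> {subset finsupp m <= r} ->
  fmono m = \big[@fconv k/@fone k]_(j <- r) fclass k (m j).
Proof.
move=> ur sub; transitivity (fcolor k [seq m j | j <- r]); last by rewrite /fcolor big_map.
rewrite -[RHS]fcolor_filter; apply: fcolor_perm.
rewrite filter_map; apply/perm_map/uniq_perm.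
- exact: fset_uniq.
- exact: filter_uniq.
move=> j; rewrite mem_filter /= cmE_neq0.
by case: (boolP (j \in finsupp m)) => [/sub ->|].
Qed.

Lemma finsupp_bound N (m : mono) : (forall i, (N <= i)%N -> m i = 0%N) ->
  {subset finsupp m <= index_iota 0 N}.
Proof.
move=> mN i; rewrite -cmE_neq0 mem_index_iota /=; apply: contraR; rewrite -leqNgt.
by move=> /mN ->.
Qed.

Lemma fmono_ord N (m : mono) : (forall i, (N <= i)%N -> m i = 0%N) ->
  fmono m = \big[@fconv k/@fone k]_(j < N) fclass k (m j).
Proof.
move=> mN; rewrite (fmono_seq (iota_uniq 0 N)) -?(big_mkord xpredT (fun j => fclass k (m j))).
  by rewrite /index_iota subn0.
by have := finsupp_bound mN; rewrite /index_iota subn0.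
Qed.

Lemma fmono1 : fmono mone = fone k.
Proof. by rewrite (@fmono_ord 0) ?big_ord0 // => i _; rewrite cm1. Qed.

Lemma fmono_var n : fmono (expcmn (ucm 0%N) n) = fclass k n.
Proof.
rewrite (@fmono_ord 1) ?big_ord1 ?expcmnE ?cmU ?eqxx ?muln1 // => i.
by rewrite expcmnE cmU; case: i => // i _; rewrite muln0.
Qed.

Lemma fmono_interleave (p q : mono) : fmono (interleave p q) = fconv (fmono p) (fmono q).
Proof.
have [N [pN qN]] : exists N, (forall i, (N <= i)%N -> p i = 0%N) /\
    (forall i, (N <= i)%N -> q i = 0%N).
  have [N pN] := mono_bounded p; have [M qM] := mono_bounded q.
  exists (maxn N M); split=> i; rewrite geq_max => /andP[le1 le2]; [exact: pN|exact: qM].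
pose r := [seq i.*2 | i <- iota 0 N] ++ [seq i.*2.+1 | i <- iota 0 N].
rewrite (fmono_seq (r := r)).
- rewrite big_cat !big_map (fmono_ord pN) (fmono_ord qN) /=.
  rewrite -!(big_mkord xpredT (fun j => fclass k (_ j))) /index_iota subn0.
  congr (fconv _ _).
    by apply: eq_bigr => i _; rewrite interleave_even.
  by apply: eq_bigr => i _; rewrite interleave_odd.
- rewrite cat_uniq !map_inj_uniq ?iota_uniq ?andbT; [|exact: double_injS|exact: double_inj].
  apply/hasPn => _ /mapP[i _ ->]; apply/mapP => -[j _ e].
  by have := congr1 odd e; rewrite /= !odd_double.
move=> i; rewrite -cmE_neq0 mem_cat; move: i; apply: parityP => i.
  rewrite interleave_even => pi; rewrite map_f // mem_iota /= add0n.
  by apply: contraR pi; rewrite -leqNgt => /pN ->.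
rewrite interleave_odd => qi; rewrite orbC map_f // mem_iota /= add0n.
by apply: contraR qi; rewrite -leqNgt => /qN ->.
Qed.

(** The sums that define the product of power series are finite. *)
Lemma mono_factorizations (m : mono) : exists2 r : seq (mono * mono), uniq r &
  forall p q, ((p, q) \in r) = (mmul p q == m).
Proof.
have [N mN] := mono_bounded m.
pose ms := [seq \big[mmul/mone]_(i < N) expcmn (ucm (i : nat)) (f i : nat) |
          f : {ffun 'I_N -> 'I_(mdeg m).+1} <- enum {: {ffun 'I_N -> 'I_(mdeg m).+1}}].
have msP (p : mono) : (forall i, p i <= m i)%N -> p \in ms.
  move=> le_pm; apply/mapP; exists [ffun i : 'I_N => inord (p i)]; rewrite ?mem_enum //.
  rewrite {1}(@mono_expand N p); last by move=> i /mN mi; have := le_pm i; rewrite mi leqn0 => /eqP.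
  apply: eq_bigr => i _; rewrite ffunE inordK // ltnS.
  exact: leq_trans (le_pm i) (mono_le_mdeg _ _).
exists (undup [seq pq <- [seq (p, q) | p <- ms, q <- ms] | mmul pq.1 pq.2 == m]).
  exact: undup_uniq.
move=> p q; rewrite mem_undup mem_filter /=; case: eqP => //= pq.
by apply/allpairsP; exists (p, q); split => //=; apply: msP => i; rewrite -pq cmM ?leq_addr ?leq_addl.
Qed.

Definition color_mono (V : finType) N (kappa : {ffun V -> 'I_N}) : mono :=
  \big[mmul/mone]_(v : V) ucm (kappa v : nat).

Lemma color_monoE (V : finType) N (kappa : {ffun V -> 'I_N}) i :
  color_mono kappa i = #|color_class kappa i|.
Proof.
rewrite /color_mono mono_bigE -sum1_card [RHS]big_mkcond; apply: eq_bigr => v _.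
by rewrite cmU inE; case: eqP.
Qed.

Lemma color_mono_out (V : finType) N (kappa : {ffun V -> 'I_N}) i : (N <= i)%N ->
  color_mono kappa i = 0%N.
Proof.
move=> le_Ni; rewrite color_monoE; apply/eqP; rewrite cards_eq0; apply/eqP/setP => v.
by rewrite !inE ltn_eqF // (leq_trans (ltn_ord _)).
Qed.

Lemma fmono_colorings N (m : mono) (V : finType) (E : {set {set V}}) t :
    (forall i, (N <= i)%N -> m i = 0%N) ->
  fmono m E t [set: V]%SET
  = \sum_(kappa : {ffun V -> 'I_N}) (color_mono kappa == m)%:R * zeta_product k E t kappa.
Proof.
move=> mN; rewrite (fmono_ord mN) fclass_colorings; apply: eq_bigr => kappa _.
congr (_%:R * _); congr nat_of_bool; apply/forallP/eqP => [h|<- i]; last by rewrite color_monoE.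
apply: monoP => i; have [lt_iN|le_Ni] := ltnP i N.
  by rewrite color_monoE (eqP (h (Ordinal lt_iN))).
by rewrite mN // color_mono_out.
Qed.

(** A coloring of a disjoint union is a pair of colorings, and its monomial is the
    product of theirs. *)
Lemma fmono_slice (m : mono) (r : seq (mono * mono)) (V W : finType) (E : {set {set V}}) t
    (F : {set {set W}}) s :
    uniq r -> (forall p q, ((p, q) \in r) = (mmul p q == m)) ->
  slice (fmono m) E t [set: V]%SET F s [set: W]%SET
  = \sum_(pq <- r) fmono pq.1 E t [set: V]%SET * fmono pq.2 F s [set: W]%SET.
Proof.
move=> ur rP; have [N mN] := mono_bounded m.
rewrite (fmono_ord mN) fclass_slice.
transitivity (\sum_(pq <- r) \sum_(kappa : {ffun V -> 'I_N}) \sum_(kappa' : {ffun W -> 'I_N})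
    ((color_mono kappa, color_mono kappa') == pq)%:R *
    (zeta_product k E t kappa * zeta_product k F s kappa')); last first.
  apply: eq_big_seq => -[p q]; rewrite rP => /eqP pq /=.
  have [pN qN] : (forall i, (N <= i)%N -> p i = 0%N) /\ (forall i, (N <= i)%N -> q i = 0%N).
    split=> i /mN; rewrite -pq cmM => /eqP; rewrite addn_eq0 => /andP[/eqP ? /eqP ?] //.
  rewrite (fmono_colorings _ _ pN) (fmono_colorings _ _ qN) mulr_suml.
  apply: eq_bigr => kappa _; rewrite mulr_sumr; apply: eq_bigr => kappa' _.
  by rewrite xpair_eqE -mulnb natrM mulrACA.
rewrite [RHS]exchange_big; apply: eq_bigr => kappa _.
rewrite [RHS]exchange_big; apply: eq_bigr => kappa' _.
rewrite -mulr_suml; congr (_ * _).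
have -> : color_counts m kappa kappa' = ((color_mono kappa, color_mono kappa') \in r).
  rewrite rP; apply/forallP/eqP => [h|<- i]; last by rewrite cmM !color_monoE.
  apply: monoP => i; rewrite cmM; have [lt_iN|le_Ni] := ltnP i N.
    by rewrite !color_monoE (eqP (h (Ordinal lt_iN))).
  by rewrite mN // !color_mono_out.
have [cr|ncr] := boolP (_ \in r).
  rewrite (bigD1_seq _ cr ur) /= eqxx big1 ?addr0 // => pq.
  by rewrite eq_sym => /negbTE ->.
rewrite big_seq big1 // => pq pqr; case: eqP => // e.
by rewrite e pqr in ncr.
Qed.
End MonomialFamilies.

(** * Chromatic symmetric functions as pairings *)

(** The exponents of a monomial in the order of its variables; [Mqsym alpha] is
    the sum of the monomials whose exponents are [alpha]. *)
Definition exponents (m : mono) : seq nat := [seq m i | i <- sort leq (finsupp m)].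

Lemma seq_monoE (i alpha : seq nat) n : uniq i -> size i = size alpha ->
  (\big[mmul/mone]_(j < size alpha) expcmn (ucm (nth 0%N i j)) (nth 0%N alpha j)) n
  = if n \in i then nth 0%N alpha (index n i) else 0%N.
Proof.
move=> ui si; rewrite mono_bigE.
under eq_bigr => j _ do rewrite expcmnE cmU.
have [ni|ni] := boolP (n \in i); last first.
  rewrite big1 // => j _; case: eqP => [e|_]; last by rewrite muln0.
  by rewrite -e mem_nth // si in ni.
have lt_n : (index n i < size alpha)%N by rewrite -si index_mem.
rewrite (bigD1 (Ordinal lt_n)) //= nth_index // eqxx muln1 big1 ?addn0 // => j ne.
case: eqP => [e|_]; last by rewrite muln0.
by case/eqP: ne; apply: val_inj; rewrite /= -e index_uniq // si.
Qed.

Lemma exponents_gt0 m : all (ltn 0) (exponents m).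
Proof.
apply/allP => _ /mapP[i im ->]; rewrite mem_sort in im.
by rewrite /= lt0n cmE_neq0.
Qed.

Lemma sumn_exponents m : sumn (exponents m) = mdeg m.
Proof. by rewrite sumnE big_map mdegE; apply: perm_big; rewrite perm_sort. Qed.

(** A monomial determines the increasing sequence of its variables, so it occurs at
    most once in [Mqsym alpha]. *)
Lemma MqsymE alpha m : all (ltn 0) alpha -> Mqsym alpha m = (alpha == exponents m)%:Z.
Proof.
move=> /allP apos; have alpha_gt0 x : x \in alpha -> (0 < x)%N by move=> /apos.
rewrite /Mqsym.
have ltn_iota (s : seq nat) : sorted ltn s -> uniq s by rewrite ltn_sorted_uniq_leq => /andP[].
set I := (X in \sum_(i \in X) _).
(* All entries of [alpha] are positive, so the entries of [i] are exactly the variables of [m]. *)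
have II i : I i -> i = sort leq (finsupp m) /\ alpha = exponents m.
  move=> [si szi mE]; have ui := ltn_iota _ si.
  have mi n : m n = if n \in i then nth 0%N alpha (index n i) else 0%N by rewrite -mE seq_monoE.
  have ei : i = sort leq (finsupp m).
    apply: (@irr_sorted_eq _ ltn) => //; [exact: ltn_trans | exact: ltnn | |].
      by rewrite ltn_sorted_uniq_leq sort_uniq fset_uniq sort_sorted //; exact: leq_total.
    move=> n; rewrite mem_sort -cmE_neq0 mi; case: (boolP (n \in i)) => // ni.
    by rewrite -lt0n; apply/esym/alpha_gt0; rewrite mem_nth // -szi index_mem.
  split=> //; rewrite /exponents -ei; apply: (@eq_from_nth _ 0%N); first by rewrite size_map.
  move=> j lt_j; rewrite (nth_map 0%N) ?szi // mi mem_nth ?szi //.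
  by rewrite index_uniq // szi.
have [ealpha|ne] := eqVneq alpha (exponents m); last first.
  by apply: fsbig1 => i /II[_ e]; rewrite e eqxx in ne.
rewrite (_ : I = [set sort leq (finsupp m)]%classic) ?fsbig_set1 //.
apply/seteqP; split=> [i /II[-> _] //|_ ->].
have us : uniq (sort leq (finsupp m)) by rewrite sort_uniq fset_uniq.
have szs : size (sort leq (finsupp m)) = size alpha by rewrite ealpha size_map.
split=> //.
  by rewrite ltn_sorted_uniq_leq us sort_sorted //; exact: leq_total.
apply: monoP => n; rewrite seq_monoE //; case: (boolP (n \in _)) => [nm|]; last first.
  by rewrite mem_sort -cmE_eq0 => /eqP.
by rewrite ealpha (nth_map 0%N) ?index_mem // nth_index.
Qed.

Lemma sum_Mqsym n (c : seq nat -> int) m :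
  \sum_(alpha \in Comp n) c alpha * Mqsym alpha m = (mdeg m == n)%:R * c (exponents m).
Proof.
have [mn|mn] := eqVneq (mdeg m) n; last first.
  rewrite mul0r; apply: fsbig1 => alpha [apos asum].
  rewrite MqsymE //; case: eqP => [e|_]; last by rewrite mulr0.
  by rewrite -asum e sumn_exponents eqxx in mn.
rewrite -(@fsbig_widen _ _ _ _ [set exponents m]%classic).
- by rewrite fsbig_set1 MqsymE ?exponents_gt0 // eqxx mulr1 mul1r.
- by move=> _ ->; split; [exact: exponents_gt0 | rewrite sumn_exponents].
move=> alpha [[apos asum] /= ne]; rewrite MqsymE //; case: eqP => [//|_].
by rewrite mulr0.
Qed.

Section ChromaticPairing.
Variable k : closedFieldType.
Hypothesis char0 : [pchar k] =i pred0.

Lemma fmono_exponents m : fmono k m = fcolor k (exponents m).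
Proof. by apply: fcolor_perm; apply: perm_map; rewrite perm_sym perm_sort. Qed.

Lemma fcolor_degree_sum alpha (V : finType) (E : {set {set V}}) t :
  #|V| != sumn alpha -> fcolor k alpha E t [set: V]%SET = 0.
Proof.
by move=> ne; apply/eqP; apply: contraNT ne => /fcolor_degree <-; rewrite cardsT.
Qed.

(** Only the composition [exponents m] contributes to the coefficient of [m]. *)
Lemma XrepE (V : finType) (G : graph V) n (r : mx_representation k (graph_aut G) n) m :
  (Xrep r m)%:~R = rep_pair (fmono k m) r.
Proof.
rewrite /Xrep sum_Mqsym fmono_exponents; have [mn|mn] := eqVneq (mdeg m) #|V|.
  by rewrite mul1r -(dim_Hom_coloring char0) pmulrn.
rewrite mul0r /rep_pair big1 ?mulr0 // => s _; rewrite fcolor_degree_sum ?mulr0 //.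
by rewrite sumn_exponents eq_sym.
Qed.

Lemma Xrep_pair (V : finType) (G : graph V) n (r : mx_representation k (graph_aut G) n) m :
  (Xrep r m)%:~R = pair (fmono k m) (aclass r).
Proof. by rewrite XrepE (pair_aclass char0) //; exact: natural_fmono. Qed.

(** Evaluated at the identity, the coloring character counts all colorings. *)
Lemma Xstanley_regular (V : finType) (G : graph V) :
  Xrep (regular_repr k (graph_aut G)) = Xstanley G.
Proof.
apply/funext => m; apply: (intr_inj_char0 char0) => /=.
rewrite Xrep_pair (pair_regular char0); last exact: natural_fmono.
rewrite /Xstanley sum_Mqsym fmono_exponents.
have [mn|mn] := eqVneq (mdeg m) #|V|; last first.
  by rewrite mul0r fcolor_degree_sum // sumn_exponents eq_sym.
rewrite mul1r fcolor_trace mxtrace_coloring -pmulrn; congr (_%:R).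
apply: eq_card => kappa; rewrite [LHS]inE; apply/andb_idr => _.
by apply/recolor_fixP => v; rewrite perm1.
Qed.

(** The regular representation contains each irreducible with multiplicity its degree. *)
Lemma Xstanley_irr (V : finType) (G : graph V) :
  Xstanley G = \sum_(i : Irr k (graph_aut G)) Xrep (irr_repr i) *+ irr_degree i.
Proof.
have evD m : additive_map (fun f : power_series => f m) by [].
rewrite -Xstanley_regular; apply/funext => m; rewrite (additive_map_sum (evD m)).
apply: (intr_inj_char0 char0); transitivity (rep_pair (fmono k m) (regular_repr k (graph_aut G))).
  exact: XrepE.
rewrite [RHS]rmorph_sum.
rewrite /rep_pair (eq_bigr (fun s => \sum_(i : Irr k (graph_aut G))
  (\tr (irr_repr i s) * fmono k m (edges G) s [set: V]%SET) *+ irr_degree i)) => [|s Gs].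
  rewrite exchange_big mulr_sumr; apply: eq_bigr => i _.
  transitivity ((Xrep (irr_repr i) m)%:~R *+ irr_degree i : k).
    by rewrite XrepE /rep_pair -mulrnAr -sumrMnl.
  by rewrite (additive_mapMn (evD m)) -rmorphMn.
have split : group_splitting_field k (graph_aut G) by exact: group_closure_closed_field.
rewrite (mxtrace_regular_pchar (Irr k (graph_aut G)) (pchar'_group char0 _)) // mulr_suml.
by apply: eq_bigr => i _; rewrite mulrnAl.
Qed.

End ChromaticPairing.

(** * The Hopf morphism to symmetric functions *)

Section ChromaticMorphism.
Variable k : closedFieldType.
Hypothesis char0 : [pchar k] =i pred0.
Implicit Types psi phi : family k.
Local Notation H := (rep_hopf k).
Local Notation "x ** y" := (@hmul (rep_hopf k) x y) (at level 40).
Local Notation D := (@hcomul (rep_hopf k)).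
Local Notation fmono := (fmono k).

Lemma Xrep_degree (V : finType) (G : graph V) n (r : mx_representation k (graph_aut G) n) m :
  Xrep r m != 0 -> mdeg m = #|V|.
Proof. by rewrite /Xrep sum_Mqsym; case: (mdeg m =P #|V|) => //; rewrite mul0r eqxx. Qed.

Lemma Xrep_closed (V : finType) (G : graph V) n (r : mx_representation k (graph_aut G) n) :
  Xrep r \in Sym_pred.
Proof.
apply/asboolP; split; first by exists #|V| => m /Xrep_degree ->.
move=> s m m' bs e; apply: (intr_inj_char0 char0); have sim : msim m m' by apply/asboolP; exists s.
rewrite !(XrepE char0); congr (rep_pair _ r); exact/esym/fmono_msim.
Qed.

Definition Xsym (V : finType) (G : graph V) n (r : mx_representation k (graph_aut G) n) : SymZ :=
  SymFun (Xrep_closed r).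

Definition chromatic (x : Arep k) : SymZ := Alift (fun a => Xsym (irr_repr (lab_irr a))) x.

(** Extracting the coefficient of [m] is pairing with the family of [m], so the
    identities below can be checked on families. *)
Lemma chromaticE x m : (sym_val (chromatic x) m)%:~R = pair (fmono m) x.
Proof.
rewrite /chromatic /pair /Alift !flift_sum (additive_map_sum (sym_val_additive m)) rmorph_sum.
apply: eq_bigr => a _; rewrite (additive_mapMz (sym_val_additive m)) rmorphMz.
congr (_ *~ _); exact: XrepE.
Qed.

Lemma chromatic_eq x (f : SymZ) :
  (forall m, pair (fmono m) x = (sym_val f m)%:~R) -> chromatic x = f.
Proof.
by move=> e; apply: Sym_eq => m; apply: (intr_inj_char0 char0); rewrite /= chromaticE.
Qed.

Lemma chromaticD : additive_map chromatic.
Proof.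
move=> x y; apply: chromatic_eq => m; rewrite sym_valD rmorphD /= !chromaticE.
exact/(pair_additive char0)/natural_fmono.
Qed.

Lemma chromatic_aclass (V : finType) (G : graph V) n (r : mx_representation k (graph_aut G) n) :
  chromatic (aclass r) = Xsym r.
Proof. by apply: chromatic_eq => m; rewrite -Xrep_pair. Qed.

Lemma pair_sum_seq (I : Type) (r : seq I) (psi : I -> family k) x :
  pair (fun V E t T => \sum_(i <- r) psi i V E t T) x = \sum_(i <- r) pair (psi i) x.
Proof.
elim: r => [|i r IH]; first by rewrite big_nil; apply: pair0 => *; rewrite big_nil.
by rewrite big_cons -IH; apply: pair_addf => *; rewrite big_cons addrC addrC.
Qed.

Lemma pair_fmono_mul (m : mono) (r : seq (mono * mono)) x y :
    uniq r -> (forall p q, ((p, q) \in r) = (mmul p q == m)) ->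
  pair (fmono m) (x ** y) = \sum_(pq <- r) pair (fmono pq.1) x * pair (fmono pq.2) y.
Proof.
move=> ur rP; rewrite (pair_mul char0); last exact: natural_fmono.
transitivity (pair (fun V E t T => \sum_(pq <- r) fmono pq.1 E t T * pair (fmono pq.2) y) x).
  apply: eq_pair => n G s; rewrite /slices.
  transitivity (pair (fun W F u S => \sum_(pq <- r)
      fmono pq.1 (edges G) s [set: 'I_n]%SET * fmono pq.2 F u S) y).
    apply: eq_pair => n' G' s'; exact: fmono_slice.
  by rewrite (pair_sum_seq _ (fun pq W F u S => _ * _)); apply: eq_bigr => pq _; exact: pair_scale.
rewrite (pair_sum_seq _ (fun pq V E t T => _ * _)); apply: eq_bigr => pq _.
by rewrite [RHS]mulrC; apply: pair_scale => *; rewrite mulrC.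
Qed.

Lemma chromaticM x y : chromatic (x ** y) = Sym_mul (chromatic x) (chromatic y).
Proof.
apply: chromatic_eq => m; have [r ur rP] := mono_factorizations m.
rewrite (pair_fmono_mul _ _ ur rP) /= /psmul.
rewrite (eq_fsbigl _ _ _ (_ : _ = [set` r]%classic)) -?fsbig_seq //; last first.
  by apply/seteqP; split=> -[p q] /=; rewrite rP => /eqP.
by rewrite rmorph_sum; apply: eq_bigr => pq _; rewrite rmorphM /= !chromaticE.
Qed.

Lemma chromatic1 : chromatic (Aone k) = Sym_one.
Proof.
apply: chromatic_eq => m; rewrite (pair_one char0); last exact: natural_fmono.
rewrite /= /psone; have [->|nm] := eqVneq m mone; first by rewrite fmono1 /fone eqxx.
rewrite (set_ord0 finset.set0 [set: 'I_0]%SET) fmono_exponents fcolor_degree_sum //.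
by rewrite card_ord sumn_exponents eq_sym mdeg_eq0.
Qed.

Lemma chromatic_counit x : Sym_counit (chromatic x) = Acounit x.
Proof.
by apply: (intr_inj_char0 char0); rewrite /= counitE // chromaticE fmono1.
Qed.

(** Interleaving monomials corresponds to the convolution of their families. *)
Lemma chromatic_comul x : Sym_comul (chromatic x) = tmap chromatic chromatic (D x).
Proof.
have cD := chromaticD; apply: Sym_comul_eq; apply/funext => m; apply/funext => m'.
apply: (intr_inj_char0 char0); transitivity (pair2 (fmono m) (fmono m') (D x)); last first.
  have [nm nm'] := (natural_fmono k m, natural_fmono k m').
  by rewrite (pair2_comul char0) // -fmono_interleave -chromaticE.
move: (D x); apply: tensor_additive_eq.
- move=> s t; rewrite -rmorphD /=; congr (_%:~R).
  by rewrite (tmap_additive cD cD) tensor_series_additive.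
- exact: (pair2_additive char0 (natural_fmono k m) (natural_fmono k m')).
move=> a b; rewrite (tmap_tens _ _ cD cD) tensor_series_tens (pair2_tens char0); try exact: natural_fmono.
by rewrite /= rmorphM /= !chromaticE.
Qed.

Lemma Sym_gradeB n (f g : SymZ) : Sym_grade n f -> Sym_grade n g -> Sym_grade n (f - g).
Proof.
move=> fn gn m; rewrite (additive_mapB (sym_val_additive m)).
by have [->|/fn ->//] := eqVneq (sym_val f m) 0; rewrite sub0r oppr_eq0 => /gn.
Qed.

Lemma chromatic_grade n x : Agrade n x -> Sym_grade n (chromatic x).
Proof.
move: x; apply: (Agrade_ind char0) => [a an||x y xn yn].
- rewrite chromatic_aclass => m /Xrep_degree ->; by rewrite card_ord.
- by rewrite (additive_map0 chromaticD) => m; rewrite eqxx.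
by rewrite (additive_mapB chromaticD); exact: Sym_gradeB.
Qed.

(** The monomials with value 1 at the point (1, 0, 0, ...) are the powers of [x_0]. *)
Lemma eval100_grade n (f : SymZ) : Sym_grade n f ->
  eval100 (sym_val f) = sym_val f (expcmn (ucm 0%N) n).
Proof.
move=> fn; rewrite /eval100 -(@fsbig_widen _ _ _ _ [set expcmn (ucm 0%N) n]%classic).
- by rewrite fsbig_set1.
- by move=> _ -> i; rewrite expcmnE cmU; case: i => // i _; rewrite muln0.
move=> m [/= m0 ne]; apply/eqP; apply: contra_notT ne => /fn mn.
apply: monoP => i; rewrite expcmnE cmU -mn; case: i => [|i]; last by rewrite m0 // muln0.
by rewrite muln1 (@mdeg_ord 1 m) ?big_ord1 // => i; exact: m0.
Qed.

Lemma eval100_bound N (f : power_series) : (forall m, f m != 0 -> (mdeg m <= N)%N) ->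
  eval100 f = \sum_(n < N.+1) f (expcmn (ucm 0%N) n).
Proof.
move=> fN; rewrite /eval100 -(big_mkord xpredT (fun n => f (expcmn (ucm 0%N) n))).
rewrite -(big_map (fun n => expcmn (ucm 0%N) n) xpredT f).
rewrite [RHS]fsbig_seq; last first.
  rewrite map_inj_uniq ?iota_uniq // => n n' /(congr1 (fun m : mono => m 0%N)).
  by rewrite !expcmnE cmU eqxx !muln1.
apply/esym/fsbig_widen => [_ /mapP[n _ ->] i i_gt0|m [m0 ne]].
  by rewrite expcmnE cmU; case: i i_gt0 => // i _; rewrite muln0.
apply/eqP; apply: contra_notT ne => /fN mN.
have mE : mdeg m = m 0%N by rewrite (@mdeg_ord 1 m) ?big_ord1 // => i; exact: m0.
apply/mapP; exists (mdeg m); first by rewrite mem_index_iota.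
apply: monoP => i; rewrite expcmnE cmU mE; case: i => [|i]; first by rewrite muln1.
by rewrite muln0 m0.
Qed.

Lemma eval100D (f g : SymZ) :
  eval100 (sym_val (f + g)) = eval100 (sym_val f) + eval100 (sym_val g).
Proof.
have /asboolP[[N fN] _] := sym_valP f; have /asboolP[[M gM] _] := sym_valP g.
have fb m : sym_val f m != 0 -> (mdeg m <= maxn N M)%N by move/fN => h; rewrite leq_max h.
have gb m : sym_val g m != 0 -> (mdeg m <= maxn N M)%N.
  by move/gM => h; rewrite leq_max h orbT.
rewrite !(@eval100_bound (maxn N M)) ?big_split // => m; rewrite sym_valD.
by have [->|/fb //] := eqVneq (sym_val f m) 0; rewrite add0r => /gb.
Qed.

(** In degree [d] both sides are pairings with the stable edgeless sets, of size [d]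
    on the left. *)
Lemma eval100_chromatic x : eval100 (sym_val (chromatic x)) = Azeta x.
Proof.
have [zD _ _] := zeta_morphism char0.
have eD : additive_map (fun x => eval100 (sym_val (chromatic x))).
  by move=> y z; rewrite chromaticD eval100D.
move: (Arep_span char0 x); apply: (gen_subgroup_ind
    (Q := fun x => eval100 (sym_val (chromatic x)) = Azeta x)) => [_ [a ->]||y z ey ez].
- have agr := Agrade_lab char0 a.
  rewrite (eval100_grade (chromatic_grade agr)); apply: (intr_inj_char0 char0).
  rewrite /= chromaticE fmono_var zetaE // (pair_degree_part char0 _ (natural_zeta k) agr).
  by rewrite eqxx mul1r.
- by rewrite (additive_map0 eD) (additive_map0 zD).
by rewrite (additive_mapB eD) (additive_mapB zD) ey ez.
Qed.

Lemma chromatic_induced : @induced_by (rep_hopf k) (@Azeta k) chromatic.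
Proof.
split; last exact: eval100_chromatic.
split; last exact: chromatic_grade.
split; [exact: chromaticD | | exact: chromatic_comul | exact: chromatic_counit].
by split; [exact: chromaticM | exact: chromatic1].
Qed.

End ChromaticMorphism.

(** * Uniqueness of the induced morphism *)

(** The values are corrected one at a time by transpositions. *)
Lemma bijective_extension (s : nat -> nat) N :
    (forall i j, (i < N)%N -> (j < N)%N -> s i = s j -> i = j) ->
  exists2 b : nat -> nat, bijective b & forall i, (i < N)%N -> b i = s i.
Proof.
elim: N => [|N IH] inj_s; first by exists id => //; exists id.
have [i j lti ltj|b bij_b bs] := IH.
  by apply: inj_s; exact: ltnW.
exists (swap_nat (b N) (s N) \o b).
  by apply: bij_comp => //; exists (swap_nat (b N) (s N)); exact: swap_natK.
move=> i; rewrite ltnS leq_eqVlt => /orP[/eqP -> /=|lt_iN /=]; first by rewrite /swap_nat eqxx.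
rewrite /swap_nat (inj_eq (bij_inj bij_b)) ltn_eqF // bs //.
case: eqP => // /(inj_s _ _ (ltnW lt_iN) (ltnSn N)) e.
by rewrite e ltnn in lt_iN.
Qed.

(** A monomial in [N.+1] variables is, up to renaming, one in [N] variables times
    a power of a further variable. *)
Lemma msim_split N (m : mono) : (forall i, (N < i)%N -> m i = 0%N) ->
  exists2 p : mono, (forall i, (N <= i)%N -> p i = 0%N) &
    msim m (interleave p (expcmn (ucm 0%N) (m N))).
Proof.
move=> mN; pose p : mono := \big[mmul/mone]_(i < N) expcmn (ucm (i : nat)) (m i).
have pE i : p i = if (i < N)%N then m i else 0%N.
  rewrite /p mono_bigE; under eq_bigr => j _ do rewrite expcmnE cmU.
  case: ltnP => [lt_i|le_i]; last first.
    by rewrite big1 // => j _; rewrite ltn_eqF ?muln0 // (leq_trans (ltn_ord j)).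
  rewrite (bigD1 (Ordinal lt_i)) //= eqxx muln1 big1 ?addn0 // => j ne.
  rewrite (_ : (j == i :> nat) = false) ?muln0 //.
  by apply: contraNF ne => /eqP e; apply/eqP/val_inj.
exists p; first by move=> i le_i; rewrite pE ltnNge le_i.
pose s i := if i == N then 1%N else i.*2.
have [i j _ _|b bij_b bs] := @bijective_extension s N.+1.
  rewrite /s; case: eqP => [->|_]; case: eqP => [->|_] // e.
  - by have := congr1 odd e; rewrite odd_double.
  - by have := congr1 odd e; rewrite odd_double.
  exact: double_inj.
apply/asboolP; exists b => // i.
have [lt_Ni|] := ltnP N i; last first.
  rewrite leq_eqVlt => /orP[/eqP->|lt_iN].
    by rewrite bs // /s eqxx -[1%N]/(0.*2.+1) interleave_odd expcmnE cmU eqxx muln1.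
  by rewrite bs ?ltnS 1?ltnW // /s ltn_eqF // interleave_even pE lt_iN.
(* The variables beyond [N] are sent outside the support of the right-hand side. *)
rewrite [RHS]mN //; have out j : (j <= N)%N -> b i <> s j.
  by move=> le_j; rewrite -bs // => /(bij_inj bij_b) e; rewrite e ltnNge le_j in lt_Ni.
move: (out); have [j ->] : exists j, b i = j by exists (b i).
move: j; apply: parityP => j outj.
  rewrite interleave_even pE; have [lt_j|//] := ltnP j N.
  by case: (outj j (ltnW lt_j)); rewrite /s ltn_eqF.
rewrite interleave_odd expcmnE cmU; case: j outj => [|j _]; last by rewrite muln0.
by move=> /(_ N (leqnn N)); rewrite /s eqxx.
Qed.

Section Uniqueness.
Variables (H : hopf_data) (zeta : H -> int) (Phi Psi : H -> SymZ).
Hypothesis H_graded : grading_axioms H.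
Hypothesis Phi_zeta : induced_by zeta Phi.
Hypothesis Psi_zeta : induced_by zeta Psi.

Definition agree_at (m : mono) : Prop := forall x, sym_val (Phi x) m = sym_val (Psi x) m.

Lemma agree_at_msim m m' : msim m m' -> agree_at m' -> agree_at m.
Proof. by move=> sim a x; rewrite !(symmetric_msim _ sim). Qed.

(** On a homogeneous element the character determines the coefficient of the one
    power of [x_0] of its degree, and the other powers have coefficient 0. *)
Lemma agree_at_power d : agree_at (expcmn (ucm 0%N) d).
Proof.
have [[[PhiD _ _ _] Phi_gr] Phi_e] := Phi_zeta; have [[[PsiD _ _ _] Psi_gr] Psi_e] := Psi_zeta.
have [_ decomp _] := H_graded; move=> x; have [N [c [cn ->]]] := decomp x.
rewrite (additive_map_sum PhiD) (additive_map_sum PsiD) !(additive_map_sum (sym_val_additive _)).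
apply: eq_bigr => n _; have [Phin Psin] := (Phi_gr _ _ (cn n), Psi_gr _ _ (cn n)).
have [->|ne] := eqVneq d n.
  by rewrite -(eval100_grade Phin) -(eval100_grade Psin) Phi_e Psi_e.
have zero (f : SymZ) : Sym_grade n f -> sym_val f (expcmn (ucm 0%N) d) = 0.
  move=> fn; apply/eqP; apply: contraNT ne => /fn.
  by rewrite mdeg_expcmn mdegU muln1 => ->.
by rewrite !zero.
Qed.

(** The coefficient at two interleaved monomials is read off the coproduct. *)
Lemma agree_at_interleave p q : agree_at p -> agree_at q -> agree_at (interleave p q).
Proof.
move=> ap aq x.
have [[[PhiD _ PhiC _] _] _] := Phi_zeta; have [[[PsiD _ PsiC _] _] _] := Psi_zeta.
rewrite -[LHS]/(two_alphabets (Phi x) p q) -[RHS]/(two_alphabets (Psi x) p q) -!Sym_comulP.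
rewrite -[Sym_comul (Phi x)]/(@hcomul Sym_hopf (Phi x)) PhiC.
rewrite -[Sym_comul (Psi x)]/(@hcomul Sym_hopf (Psi x)) PsiC.
move: (hcomul x); apply: tensor_additive_eq.
- by move=> s t; rewrite (tmap_additive PhiD PhiD) tensor_series_additive.
- by move=> s t; rewrite (tmap_additive PsiD PsiD) tensor_series_additive.
move=> a b; rewrite (tmap_tens _ _ PhiD PhiD) (tmap_tens _ _ PsiD PsiD) !tensor_series_tens.
by rewrite ap aq.
Qed.

Lemma induced_by_unique : Phi =1 Psi.
Proof.
move=> x; apply: Sym_eq => m; have [N mN] := mono_bounded m.
suff : agree_at m by [].
elim: N m mN => [|N IH] m mN.
  have -> : m = expcmn (ucm 0%N) 0; last exact: agree_at_power.
  by apply: monoP => i; rewrite mN // expcmnE mul0n.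
have [p pN sim] := msim_split mN; apply: agree_at_msim sim _.
by apply: agree_at_interleave; [exact: IH | exact: agree_at_power].
Qed.

End Uniqueness.

Theorem theorem4p4 (k : closedFieldType) (char0 : [pchar k]%R =i pred0) :
  [/\ [/\ graded_hopf_algebra (rep_hopf k), connected_hopf (rep_hopf k),
          commutative_hopf (rep_hopf k) & cocommutative_hopf (rep_hopf k)],
      [/\ forall (V : finType) (G : graph V),
            reg_map k (gclass G) = aclass (regular_repr k (graph_aut G)),
          @hopf_morphism graph_hopf (rep_hopf k) (reg_map k)
        & injective (reg_map k)],
      @algebra_morphism (rep_hopf k) (@Azeta k) /\
      (exists Psi : rep_hopf k -> SymZ,
        [/\ @induced_by (rep_hopf k) (@Azeta k) Psi,
            forall Psi', @induced_by (rep_hopf k) (@Azeta k) Psi' -> Psi' =1 Psi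
          & forall (V : finType) (G : graph V) (n : nat)
              (gamma : mx_representation k (graph_aut G) n),
              sym_val (Psi (aclass gamma)) = Xrep gamma])
    & forall (V : finType) (G : graph V),
        Xrep (regular_repr k (graph_aut G)) = Xstanley G /\
        Xstanley G = (\sum_(i : Irr k (graph_aut G))
                        Xrep (irr_repr i) *+ irr_degree i)%R].
Proof.
have graded := rep_graded_hopf char0; split.
- split=> //; [exact: rep_connected | exact: Amul_comm | exact: rep_cocommutative].
- by split; [exact: reg_gclass | exact: reg_hopf_morphism | exact: reg_injective].
- split; first exact: zeta_morphism.
  exists (chromatic char0); split=> [|Psi'|V G n gamma].
  + exact: chromatic_induced.
  + have [_ grading _] := graded => ind; apply: (induced_by_unique grading ind).
    exact: chromatic_induced.
  by rewrite chromatic_aclass.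
by move=> V G; split; [exact: Xstanley_regular | exact: Xstanley_irr].
Qed.
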